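(* Let $\mathfrak V=(A_1,A_2,B;\sigma_1,\sigma_2,\gamma,\gamma_*;\mathcal H,\mathcal E)$ and $\widetilde{\mathfrak V}=(\widetilde A_1,\widetilde A_2,\widetilde B;\sigma_1,\sigma_2,\gamma,\gamma_*;\widetilde{\mathcal H},\mathcal E)$ be two minimal conservative $t_1$-invariant vessels in the differential form (with the same $\sigma_1,\sigma_2,\gamma,\gamma_*$ and $\mathcal E$), with transfer functions $S(\lambda,t_2)$ and $\widetilde S(\lambda,t_2)$. Then $\mathfrak V$ and $\widetilde{\mathfrak V}$ are (unitarily) gauge equivalent if and only if $S(\lambda,t_2)=\widetilde S(\lambda,t_2)$ at all points of analyticity.
   Context: Let $I\subseteq\mathbb R$ be an interval with variable $t_2$, and let $\mathcal E,\mathcal H$ be Hilbert spaces. Let $\sigma_1,\sigma_2,\gamma,\gamma_*$ be functions on $I$ with values bounded operators on $\mathcal E$: $\sigma_1$ is locally absolutely continuous with invertible values, $\sigma_2,\gamma,\gamma_*$ are locally integrable (all in operator norm), $\sigma_j^*=\sigma_j$, $\gamma^*=-\gamma-\frac{d}{dt_2}\sigma_1$, $\gamma_*^*=-\gamma_*-\frac{d}{dt_2}\sigma_1$. A conservative vessel in the differential form is a collection $(A_1,A_2,B;\sigma_1,\sigma_2,\gamma,\gamma_*;\mathcal H,\mathcal E)$, where $A_1(t_2),A_2(t_2)$ are bounded operators on $\mathcal H$ and $B(t_2):\mathcal E\to\mathcal H$ is bounded, $A_1,B$ are locally absolutely continuous and $A_2$ is locally integrable in operator norm, such that for almost all $t_2$: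 (i) $A_j+A_j^*+B\sigma_jB^*=0$ for $j=1,2$; (ii) $\frac{d}{dt_2}A_1=A_2A_1-A_1A_2$; (iii) $\frac{d}{dt_2}(B\sigma_1)-A_2B\sigma_1+A_1B\sigma_2+B\gamma=0$; (iv) $\sigma_1\frac{d}{dt_2}B^*+\sigma_1B^*A_2-\sigma_2B^*A_1-\gamma_*B^*=0$; (v) $\gamma_*=\gamma+\sigma_2B^*B\sigma_1-\sigma_1B^*B\sigma_2$. Its transfer function is $S(\lambda,t_2)=I-B^*(t_2)(\lambda I-A_1(t_2))^{-1}B(t_2)\sigma_1(t_2)$. The vessel is minimal if for all $t_2$ the closed linear span of $\{A_1^n(t_2)B(t_2)e: n\ge 0,\ e\in\mathcal E\}$ is $\mathcal H$. Two vessels as in the claim are (unitarily) gauge equivalent if there is a locally absolutely continuous family of unitary operators $U(t_2):\mathcal H\to\widetilde{\mathcal H}$ with $\widetilde A_1=UA_1U^{-1}$, $\widetilde A_2=UA_2U^{-1}+\frac{dU}{dt_2}U^{-1}$ (for almost all $t_2$), $\widetilde B=UB$. *)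

(* Defs.v *)
From HB Require Import structures.
From mathcomp Require Import all_boot all_order all_algebra.
From mathcomp Require Export complex.
From mathcomp Require Export all_classical all_reals all_analysis.

Set Implicit Arguments.
Unset Strict Implicit.
Unset Printing Implicit Defensive.

Import Order.TTheory GRing.Theory Num.Theory.
Import numFieldNormedType.Exports.

Local Open Scope classical_set_scope.
Local Open Scope ring_scope.
Local Open Scope complex_scope.

(* Complex Hilbert spaces over R[i]; the inner product is linear in its first
   argument and conjugate-linear in the second. *)
HB.mixin Record isHilbert (R : realType) V of CompleteNormedModule R[i] V := {
  hdot : V -> V -> R[i] ;
  hdot_linear : forall z a x y, hdot (a *: x + y) z = a * hdot x z + hdot y z ;
  hdotC : forall x y, hdot y x = (hdot x y)^*%C ;
  hdot_norm : forall x, hdot x x = `|x| ^+ 2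
}.

#[short(type="hilbertType")]
HB.structure Definition Hilbert (R : realType) :=
  {V of isHilbert R V & CompleteNormedModule R[i] V}.

(* The complex-linear bounded operators U -> V, as a normed space over the
   real field R: time derivatives and norms of operator-valued functions of a
   real variable are then those of the library. *)
Section bounded_operators.
Variables (R : realType) (U V : normedModType R[i]).

Record bop : Type := Bop {
  bop_fun :> U -> V ;
  bop_linear : linear bop_fun ;
  bop_bounded : exists M : R[i], forall x, `|bop_fun x| <= M * `|x|
}.

HB.instance Definition _ := gen_eqMixin bop.
HB.instance Definition _ := gen_choiceMixin bop.
HB.instance Definition _ (T : bop) :=
  GRing.isLinear.Build R[i] U V *:%R (bop_fun T) (bop_linear T).

Lemma bopP (S T : bop) : (forall x, S x = T x) -> S = T.
Proof.
case: S T => [f lf bf] [g lg bg] /= /funext fg; subst g.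
by congr Bop; exact: Prop_irrelevance.
Qed.

Lemma bop_bound (T : bop) :
  exists2 M : R, 0 <= M & forall x, `|T x| <= M%:C * `|x|.
Proof.
have [M bM] := bop_bounded T.
have [[x x0]|V0] := pselect (exists x : U, x != 0); last first.
  exists 0 => // x; have -> : x = 0.
    by apply: contrapT => /eqP x0; apply: V0; exists x.
  by rewrite linear0 !normr0 mulr0.
have M0 : 0 <= M.
  have xp : 0 < `|x| by rewrite normr_gt0.
  by rewrite -(pmulr_lge0 _ xp); exact: le_trans (normr_ge0 _) (bM x).
exists (complex.Re M); first by move: M0; case: (M) => a b; rewrite lecE /= => /andP[].
move=> y; have -> // : (complex.Re M)%:C = M.
by move: M0; case: (M) => a b; rewrite lecE /= => /andP[/eqP -> _].
Qed.

Lemma bop0_subproof : linear (fun _ : U => 0 : V) /\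
  exists M : R[i], forall x : U, `|0 : V| <= M * `|x|.
Proof.
split; first by move=> a x y; rewrite scaler0 addr0.
by exists 0 => x; rewrite normr0 mul0r.
Qed.
Definition bop0 := Bop bop0_subproof.1 bop0_subproof.2.

Lemma bopN_subproof (T : bop) : linear (fun x => - T x) /\
  exists M : R[i], forall x : U, `|- T x| <= M * `|x|.
Proof.
split; first by move=> a x y; rewrite linearP opprD scalerN.
by have [M bM] := bop_bounded T; exists M => x; rewrite normrN.
Qed.
Definition bopN T := Bop (bopN_subproof T).1 (bopN_subproof T).2.

Lemma bopD_subproof (S T : bop) : linear (fun x => S x + T x) /\
  exists M : R[i], forall x : U, `|S x + T x| <= M * `|x|.
Proof.
split; first by move=> a x y; rewrite !linearP scalerDr addrACA.
have [M bM] := bop_bounded S; have [N bN] := bop_bounded T; exists (M + N) => x.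
by rewrite mulrDl (le_trans (ler_normD _ _))// lerD.
Qed.
Definition bopD S T := Bop (bopD_subproof S T).1 (bopD_subproof S T).2.

Lemma bopZ_subproof (r : R) (T : bop) : linear (fun x => r%:C *: T x) /\
  exists M : R[i], forall x : U, `|r%:C *: T x| <= M * `|x|.
Proof.
split; first by move=> a x y; rewrite linearP scalerDr !scalerA mulrC.
have [M bM] := bop_bounded T; exists (`|r%:C| * M) => x.
by rewrite normrZ -mulrA ler_wpM2l.
Qed.
Definition bopZ r T := Bop (bopZ_subproof r T).1 (bopZ_subproof r T).2.

Fact bop_addA : associative bopD.
Proof. by move=> S T W; apply: bopP => x /=; rewrite addrA. Qed.
Fact bop_addC : commutative bopD.
Proof. by move=> S T; apply: bopP => x /=; rewrite addrC. Qed.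
Fact bop_add0 : left_id bop0 bopD.
Proof. by move=> T; apply: bopP => x /=; rewrite add0r. Qed.
Fact bop_addN : left_inverse bop0 bopN bopD.
Proof. by move=> T; apply: bopP => x /=; rewrite addNr. Qed.

HB.instance Definition _ :=
  GRing.isZmodule.Build bop bop_addA bop_addC bop_add0 bop_addN.

Fact bop_scaleA a b (T : bop) : bopZ a (bopZ b T) = bopZ (a * b) T.
Proof. by apply: bopP => x /=; rewrite scalerA rmorphM. Qed.
Fact bop_scale1 : left_id 1 bopZ.
Proof. by move=> T; apply: bopP => x /=; rewrite rmorph1 scale1r. Qed.
Fact bop_scaleDr : right_distributive bopZ +%R.
Proof. by move=> a S T; apply: bopP => x /=; rewrite scalerDr. Qed.
Fact bop_scaleDl T : {morph bopZ^~ T : a b / a + b}.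
Proof. by move=> a b; apply: bopP => x /=; rewrite rmorphD scalerDl. Qed.

HB.instance Definition _ := GRing.Zmodule_isLmodule.Build R bop
  bop_scaleA bop_scale1 bop_scaleDr bop_scaleDl.

Definition opnorm (T : bop) : R :=
  sup [set complex.Re `|T x| | x in [set x : U | `|x| <= 1]].

Lemma normc_Re (W : normedModType R[i]) (x : W) : (complex.Re `|x|)%:C = `|x|.
Proof.
by move: (normr_ge0 x); case: `|x| => a b; rewrite lecE /= => /andP[/eqP -> _].
Qed.

Lemma opnorm_has_sup (T : bop) :
  has_sup [set complex.Re `|T x| | x in [set x : U | `|x| <= 1]].
Proof.
split; first by exists (complex.Re `|T 0|), 0 => //=; rewrite normr0.
have [M M0 bM] := bop_bound T; exists M => _ [x /= x1 <-].
rewrite -lecR normc_Re (le_trans (bM x))// -[leRHS]mulr1 ler_wpM2l//.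
by rewrite ler0c.
Qed.

Lemma opnorm_ge0 (T : bop) : 0 <= opnorm T.
Proof.
apply: le_trans (ub_le_sup (opnorm_has_sup T).2 _); last first.
  by exists 0 => //=; rewrite normr0.
by rewrite linear0 normr0.
Qed.

Lemma opnorm_le (T : bop) x : `|T x| <= (opnorm T)%:C * `|x|.
Proof.
have [->|x0] := eqVneq x 0; first by rewrite linear0 !normr0 mulr0.
have xp : 0 < `|x| by rewrite normr_gt0.
rewrite -ler_pdivrMr// mulrC -[X in X * _]ger0_norm ?invr_ge0//.
rewrite -normrZ -linearZ -[leLHS]normc_Re lecR.
apply: (ub_le_sup (opnorm_has_sup T).2); exists (`|x|^-1 *: x) => //=.
by rewrite normrZ ger0_norm ?invr_ge0// mulVf// gt_eqF.
Qed.

Lemma opnorm_lub (T : bop) (M : R) :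
  (forall x, `|x| <= 1 -> `|T x| <= M%:C) -> opnorm T <= M.
Proof.
move=> TM; apply: ge_sup; first exact: (opnorm_has_sup T).1.
by move=> _ [x /= x1 <-]; rewrite -lecR normc_Re TM.
Qed.

Fact opnormD (S T : bop) : opnorm (S + T) <= opnorm S + opnorm T.
Proof.
apply: opnorm_lub => x x1 /=; rewrite rmorphD (le_trans (ler_normD _ _))//.
have le1 (W : bop) : `|W x| <= (opnorm W)%:C.
  rewrite (le_trans (opnorm_le W x))// -[leRHS]mulr1 ler_wpM2l//.
  by rewrite ler0c opnorm_ge0.
by rewrite lerD.
Qed.

Fact opnormZ_le r (T : bop) : opnorm (r *: T) <= `|r| * opnorm T.
Proof.
apply: opnorm_lub => x x1 /=; rewrite normrZ rmorphM.
rewrite normc_def /= expr0n /= addr0 sqrtr_sqr.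
rewrite ler_wpM2l ?ler0c// (le_trans (opnorm_le T x))// -[leRHS]mulr1.
by rewrite ler_wpM2l// ler0c opnorm_ge0.
Qed.

Fact opnormZ r (T : bop) : opnorm (r *: T) = `|r| * opnorm T.
Proof.
apply/eqP; rewrite eq_le opnormZ_le/=.
have [->|r0] := eqVneq r 0; first by rewrite normr0 mul0r opnorm_ge0.
rewrite -ler_pdivlMl ?normr_gt0// -normfV (le_trans _ (opnormZ_le _ _))//.
by rewrite scalerA mulVf// scale1r.
Qed.

Fact opnorm_eq0 (T : bop) : opnorm T = 0 -> T = 0.
Proof.
move=> T0; apply: bopP => x /=; apply/eqP; rewrite -normr_le0.
by rewrite (le_trans (opnorm_le T x))// T0 mul0r.
Qed.

HB.instance Definition _ :=
  Lmodule_isNormed.Build R bop opnormD opnormZ opnorm_eq0.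

End bounded_operators.

Section operator_algebra.
Variable R : realType.

Section comp.
Variables U V W : normedModType R[i].

Lemma bcomp_subproof (S : bop V W) (T : bop U V) : linear (S \o T) /\
  exists M : R[i], forall x : U, `|(S \o T) x| <= M * `|x|.
Proof.
split; first by move=> a x y /=; rewrite !linearP.
have [M M0 bM] := bop_bound S; have [N N0 bN] := bop_bound T.
exists (M%:C * N%:C) => x /=; rewrite (le_trans (bM _))// -mulrA.
by rewrite ler_wpM2l ?ler0c.
Qed.
Definition bcomp S T := Bop (bcomp_subproof S T).1 (bcomp_subproof S T).2.
End comp.

Lemma bscalar_subproof (U : normedModType R[i]) (l : R[i]) :
  linear (fun x : U => l *: x) /\
  exists M : R[i], forall x : U, `|l *: x| <= M * `|x|.
Proof.
split; first by move=> a x y; rewrite scalerDr !scalerA mulrC.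
by exists `|l| => x; rewrite normrZ.
Qed.
Definition bscalar (U : normedModType R[i]) (l : R[i]) : bop U U :=
  Bop (bscalar_subproof U l).1 (bscalar_subproof U l).2.

Definition bid (U : normedModType R[i]) : bop U U := bscalar U 1.

Section inverse.
Variables U V : normedModType R[i].

Definition is_binv (T : bop U V) (S : bop V U) : Prop :=
  bcomp S T = bid U /\ bcomp T S = bid V.

Definition binvertible (T : bop U V) : Prop := exists S, is_binv T S.

(* T^-1 for an invertible T (0 otherwise) *)
Definition binv (T : bop U V) : bop V U := xget 0 [set S | is_binv T S].
End inverse.

Section adjoint.
Variables U V : hilbertType R.

Definition is_adjoint (T : bop U V) (S : bop V U) : Prop :=
  forall x y, hdot (T x) y = hdot x (S y).

(* Every bounded operator between Hilbert spaces has exactly one adjoint, by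
   the Riesz representation theorem, so the default value 0 is never used. *)
Definition adj (T : bop U V) : bop V U := xget 0 [set S | is_adjoint T S].

Definition unitary (T : bop U V) : Prop :=
  bcomp (adj T) T = bid U /\ bcomp T (adj T) = bid V.
End adjoint.

Definition resolvent_set (U : normedModType R[i]) (A : bop U U) : set R[i] :=
  [set l | binvertible (bscalar U l - A)].

Definition lin_span (U : normedModType R[i]) (X : set U) : set U :=
  [set x | exists (n : nat) (c : 'I_n -> R[i]) (v : 'I_n -> U),
     (forall i, X (v i)) /\ x = \sum_(i < n) c i *: v i].

End operator_algebra.

Notation "S \bo T" := (bcomp S T) (at level 40, left associativity).

Section functions_of_time.
Variables (R : realType) (V : normedModType R) (I : set R).
Implicit Type F : R -> V.

Definition ae_on (P : R -> Prop) : Prop :=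
  {ae (@lebesgue_measure R), forall t, I t -> P t}.

Definition nonoverlapping n (x y : 'I_n -> R) : Prop :=
  forall i j, i != j -> y i <= x j \/ y j <= x i.

Definition abs_continuous_on (a b : R) F : Prop :=
  forall e : R, 0 < e -> exists2 d : R, 0 < d &
    forall n (x y : 'I_n -> R),
      (forall i, a <= x i /\ x i <= y i /\ y i <= b) ->
      nonoverlapping x y ->
      \sum_(i < n) (y i - x i) < d ->
      \sum_(i < n) `|F (y i) - F (x i)| < e.

(* A Banach-space-valued function satisfying the epsilon-delta condition need
   not be differentiable anywhere. Requiring in addition that the derivative
   exist (in norm) almost everywhere singles out the indefinite Bochner
   integrals of locally integrable functions. The two-sided derivative is
   used: end points of I form a null set. *)
Definition locally_abs_continuous F : Prop :=
  (forall a b, I a -> I b -> abs_continuous_on a b F) /\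
  ae_on (fun t => derivable F t 1).

Definition simple_function F : Prop :=
  finite_set (range F) /\ forall v, measurable (F @^-1` [set v]).

Definition strongly_measurable F : Prop :=
  exists2 s : nat -> R -> V, (forall n, simple_function (s n)) &
    ae_on (fun t => s n t @[n --> \oo] --> F t).

Definition locally_bochner_integrable F : Prop :=
  strongly_measurable F /\
  forall a b, I a -> I b ->
    (\int[@lebesgue_measure R]_(t in `[a, b]) (`|F t|%:E) < +oo)%E.

End functions_of_time.

Section vessels.
Variables (R : realType) (I : set R) (E : hilbertType R).
Variables sigma1 sigma2 gamma gammas : R -> bop E E.

Definition vessel_parameters : Prop :=
  [/\ locally_abs_continuous I sigma1,
      (forall t, I t -> binvertible (sigma1 t)),
      [/\ locally_bochner_integrable I sigma2,
          locally_bochner_integrable I gamma &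
          locally_bochner_integrable I gammas],
      (forall t, I t -> adj (sigma1 t) = sigma1 t) &
      ae_on I (fun t =>
        [/\ adj (sigma2 t) = sigma2 t,
            adj (gamma t) = - gamma t - derive1 sigma1 t &
            adj (gammas t) = - gammas t - derive1 sigma1 t])].

Record vessel (H : hilbertType R) := Vessel {
  vA1 : R -> bop H H ;
  vA2 : R -> bop H H ;
  vB : R -> bop E H
}.

Definition conservative_vessel (H : hilbertType R) (v : vessel H) : Prop :=
  let A1 := vA1 v in let A2 := vA2 v in let B := vB v in
  [/\ locally_abs_continuous I A1,
      locally_abs_continuous I B,
      locally_bochner_integrable I A2 &
      ae_on I (fun t =>
        [/\ A1 t + adj (A1 t) + B t \bo sigma1 t \bo adj (B t) = 0 /\
            A2 t + adj (A2 t) + B t \bo sigma2 t \bo adj (B t) = 0,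
            derive1 A1 t = A2 t \bo A1 t - A1 t \bo A2 t,
            derive1 (fun s => B s \bo sigma1 s) t - A2 t \bo B t \bo sigma1 t
              + A1 t \bo B t \bo sigma2 t + B t \bo gamma t = 0,
            sigma1 t \bo derive1 (fun s => adj (B s)) t
              + sigma1 t \bo adj (B t) \bo A2 t
              - sigma2 t \bo adj (B t) \bo A1 t - gammas t \bo adj (B t) = 0 &
            gammas t = gamma t + sigma2 t \bo adj (B t) \bo B t \bo sigma1 t
              - sigma1 t \bo adj (B t) \bo B t \bo sigma2 t])].

Definition minimal (H : hilbertType R) (v : vessel H) : Prop :=
  forall t, I t ->
    closure (lin_span [set x | exists n e, x = iter n (vA1 v t) (vB v t e)])
    = setT.

(* The value is meaningful for l in the resolvent set of vA1 v t. *)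
Definition transfer_function (H : hilbertType R) (v : vessel H)
    (l : R[i]) (t : R) : bop E E :=
  bid E - adj (vB v t) \bo binv (bscalar H l - vA1 v t) \bo vB v t \bo sigma1 t.

(* S(., t) is the operator-valued function defined, and analytic, on the
   resolvent set of vA1 v t. *)
Definition analytic_point (H : hilbertType R) (v : vessel H) (t : R)
    (l : R[i]) : Prop := resolvent_set (vA1 v t) l.

Definition gauge_equivalent (H H' : hilbertType R)
    (v : vessel H) (v' : vessel H') : Prop :=
  exists U : R -> bop H H',
    [/\ locally_abs_continuous I U,
        (forall t, I t -> unitary (U t)),
        (forall t, I t -> vA1 v' t = U t \bo vA1 v t \bo binv (U t)),
        ae_on I (fun t => vA2 v' t =
          U t \bo vA2 v t \bo binv (U t) + derive1 U t \bo binv (U t)) &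
        (forall t, I t -> vB v' t = U t \bo vB v t)].

End vessels.

(* Main.v *)
Require Import Defs.
From HB Require Import structures.
From mathcomp Require Import all_boot all_order all_algebra.
From mathcomp Require Import all_classical all_reals all_analysis.
From mathcomp Require Import measurable_realfun complex ring lra.

Set Implicit Arguments.
Unset Strict Implicit.
Unset Printing Implicit Defensive.

Import Order.TTheory GRing.Theory Num.Theory.
Import numFieldNormedType.Exports.

Local Open Scope classical_set_scope.
Local Open Scope ring_scope.
Local Open Scope complex_scope.

(* If S = S~, comparing the expansions of the two transfer functions at large
   [l] gives equality of all moments [B^* A_1^n B].  Since [A_1^*] is
   [- A_1 - B sigma_1 B^*], the moments determine the Gram matrix of the vectors
   [A_1^n B e], so at every time there is a unitary operator U with
   [U A_1^n B e = A~_1^n B~ e].  Norm regularity of U in time is not visible from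
   this construction.  Instead one solves
   [W' = A~_2 W - W A_2] with [W(t0) = U(t0)]: the vessel equations turn into
   homogeneous linear equations for [W A_1 - A~_1 W] and [(W B - B~) sigma_1],
   both of which vanish at t0 and hence everywhere.  So W agrees with U on the
   total set [A_1^n B e], W is unitary, and its equation is the gauge relation
   between A_2 and A~_2.

   The equation is solved by Picard iteration.  The primitive of a Bochner
   integrable function is a limit of primitives of simple functions, all
   estimates resting on one mean value inequality: an absolutely continuous D
   with [|D'| <= M'] almost everywhere, M nondecreasing, satisfies
   [|D b - D a| <= M b - M a]. *)

(** * Hilbert spaces and bounded operators *)

(** The equation for W is forced: multiplying the gauge relation by U on the right gives
    [U' = A~_2 U - U A_2]. The pointwise unitaries are pinned down through the vectors A_1^n B e,
    and approximating a general vector by combinations of these is not uniform over the unit ball,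
    so this gives no control of [|U(t) - U(s)|]. A solution of the initial value problem, in
    contrast, is locally absolutely continuous in operator norm by construction. The obstacle is
    that A_2, sigma_2 and gamma are merely integrable: the equations hold almost everywhere, and
    increments of Banach-valued functions have to be recovered from derivatives outside a null set.
    Every estimate is therefore brought to the form [|D'| <= m'] with a nondecreasing real m. The
    same kind of majorant serves for primitives, for uniqueness and for the contraction estimate of
    the Picard operator. *)

Section cauchy_sequences.
Variables (K : numFieldType) (V : completeNormedModType K).

Lemma cauchy_seq_cvg (x : nat -> V) :
  (forall e : K, 0 < e ->
     exists N, forall m n, (N <= m)%N -> (N <= n)%N -> `|x m - x n| <= e) ->
  cvg (x n @[n --> \oo]).
Proof.
move=> cx; apply: cauchy_cvg; apply/cauchy_exP => e e0.
have [N cN] := cx (e / 2) (divr_gt0 e0 (ltr0Sn _ 1)).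
exists (x N); exists N => // n /= Nn.
rewrite -ball_normE /ball_ /=.
by rewrite (le_lt_trans (cN _ _ _ _))// ltr_pdivrMr// ltr_pMr// ltr1n.
Qed.

End cauchy_sequences.

Section real_norm.
Variable R : realType.

Section defs.
Variable V : normedModType R[i].
Implicit Types x y : V.

(** Norms of complex spaces take values in [R[i]]; the copy in [R] gives access to a total order, to
    [lra] and to infima. *)
Definition rnorm x : R := complex.Re `|x|.

Lemma rnormE x : (rnorm x)%:C = `|x|. Proof. exact: normc_Re. Qed.

Lemma rnorm_ge0 x : 0 <= rnorm x. Proof. by rewrite -ler0c rnormE. Qed.

Lemma rnormD x y : rnorm (x + y) <= rnorm x + rnorm y.
Proof. by rewrite -lecR rmorphD/= !rnormE ler_normD. Qed.

Lemma rnormN x : rnorm (- x) = rnorm x. Proof. by rewrite /rnorm normrN. Qed.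

Lemma rnormB x y : rnorm (x - y) = rnorm (y - x).
Proof. by rewrite /rnorm distrC. Qed.

Lemma rnorm0 : rnorm 0 = 0. Proof. by rewrite /rnorm normr0. Qed.

Lemma rnorm0_eq0 x : rnorm x = 0 -> x = 0.
Proof. by move=> x0; apply/eqP; rewrite -normr_eq0 -rnormE x0. Qed.

Lemma rnorm_triangle x y z : rnorm (x - z) <= rnorm (x - y) + rnorm (y - z).
Proof. by rewrite (le_trans _ (rnormD _ _))// addrA subrK. Qed.

Lemma normcR (r : R) : `|r%:C| = `|r|%:C.
Proof. by rewrite normc_def /= expr0n /= addr0 sqrtr_sqr. Qed.

Lemma rnormZr (r : R) x : rnorm (r%:C *: x) = `|r| * rnorm x.
Proof. by apply: complexI; rewrite rmorphM/= !rnormE normrZ normcR. Qed.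

Lemma posC_Re (e : R[i]) : 0 < e -> e = (complex.Re e)%:C /\ 0 < complex.Re e.
Proof. by case: e => a b; rewrite ltcE /= => /andP[/eqP -> ->]. Qed.

Lemma rnorm_cvgP (x : nat -> V) y : x n @[n --> \oo] --> y <->
  forall e : R, 0 < e -> exists N, forall n, (N <= n)%N -> rnorm (x n - y) <= e.
Proof.
split=> [/cvgrPdist_le xy e e0|xy].
  have /xy [N _ xyN] : 0 < e%:C by rewrite ltcR.
  by exists N => n /xyN; rewrite /= rnormB -rnormE lecR.
apply/cvgrPdist_le => e /posC_Re[-> /xy[N xyN]].
by exists N => // n /xyN; rewrite /= rnormB -rnormE lecR.
Qed.

End defs.

Lemma rnorm_cauchy (V : completeNormedModType R[i]) (x : nat -> V) :
  (forall e : R, 0 < e ->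
     exists N, forall m n, (N <= m)%N -> (N <= n)%N -> rnorm (x m - x n) <= e) ->
  exists y : V, x n @[n --> \oo] --> y.
Proof.
move=> cx; apply/cvg_ex; apply: cauchy_seq_cvg => e /posC_Re[-> /cx[N cN]].
by exists N => m n mN nN; rewrite -rnormE lecR cN.
Qed.

Lemma opnorm_rnorm (U V : normedModType R[i]) (T : bop U V) x :
  rnorm (T x) <= opnorm T * rnorm x.
Proof. by rewrite -lecR rmorphM/= !rnormE opnorm_le. Qed.

Lemma opnorm_le_bound (U V : normedModType R[i]) (T : bop U V) (M : R) :
  0 <= M -> (forall x, rnorm (T x) <= M * rnorm x) -> opnorm T <= M.
Proof.
move=> M0 TM; apply: opnorm_lub => x x1; rewrite -rnormE lecR.
rewrite (le_trans (TM x))// -[leRHS]mulr1 ler_wpM2l//.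
by move: x1; rewrite -rnormE -[X in _ <= X](rmorph1 (real_complex R)) lecR.
Qed.

End real_norm.

Section operator_algebra_lemmas.
Variable R : realType.
Implicit Types U V W X : normedModType R[i].

Lemma bopBE U V (S T : bop U V) x : (S - T) x = S x - T x. Proof. by []. Qed.
Lemma bopZE U V (r : R) (S : bop U V) x : (r *: S) x = r%:C *: S x.
Proof. by []. Qed.
Lemma bcompE U V W (S : bop V W) (T : bop U V) x : (S \bo T) x = S (T x).
Proof. by []. Qed.
Lemma bidE U x : bid U x = x. Proof. by rewrite /= scale1r. Qed.

Lemma bop_mapD U V (T : bop U V) x y : T (x + y) = T x + T y.
Proof. exact: linearD. Qed.
Lemma bop_mapB U V (T : bop U V) x y : T (x - y) = T x - T y.
Proof. exact: linearB. Qed.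
Lemma bop_mapZ U V (T : bop U V) a x : T (a *: x) = a *: T x.
Proof. exact: linearZ. Qed.
Lemma bop_map0 U V (T : bop U V) : T 0 = 0.
Proof. exact: linear0. Qed.

Lemma bcompA U V W X (S : bop W X) (T : bop V W) (Q : bop U V) :
  S \bo (T \bo Q) = S \bo T \bo Q.
Proof. exact: bopP. Qed.

Lemma bcomp1l U V (T : bop U V) : bid V \bo T = T.
Proof. by apply: bopP => x; rewrite bcompE bidE. Qed.

Lemma bcomp1r U V (T : bop U V) : T \bo bid U = T.
Proof. by apply: bopP => x; rewrite bcompE bidE. Qed.

Lemma bcompDl U V W (S S' : bop V W) (T : bop U V) :
  (S + S') \bo T = S \bo T + S' \bo T.
Proof. exact: bopP. Qed.

Lemma bcompDr U V W (S : bop V W) (T T' : bop U V) :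
  S \bo (T + T') = S \bo T + S \bo T'.
Proof. by apply: bopP => x /=; rewrite linearD. Qed.

Lemma bcompNl U V W (S : bop V W) (T : bop U V) : (- S) \bo T = - (S \bo T).
Proof. exact: bopP. Qed.

Lemma bcompNr U V W (S : bop V W) (T : bop U V) : S \bo (- T) = - (S \bo T).
Proof. by apply: bopP => x /=; rewrite linearN. Qed.

Lemma bcompBl U V W (S S' : bop V W) (T : bop U V) :
  (S - S') \bo T = S \bo T - S' \bo T.
Proof. by rewrite bcompDl bcompNl. Qed.

Lemma bcompBr U V W (S : bop V W) (T T' : bop U V) :
  S \bo (T - T') = S \bo T - S \bo T'.
Proof. by rewrite bcompDr bcompNr. Qed.

Lemma bcompZl U V W r (S : bop V W) (T : bop U V) :
  (r *: S) \bo T = r *: (S \bo T).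
Proof. exact: bopP. Qed.

Lemma bcompZr U V W r (S : bop V W) (T : bop U V) :
  S \bo (r *: T) = r *: (S \bo T).
Proof. by apply: bopP => x /=; rewrite linearZ. Qed.

Lemma bcomp0l U V W (T : bop U V) : (0 : bop V W) \bo T = 0.
Proof. exact: bopP. Qed.

Lemma bop_normE U V (T : bop U V) : `|T| = opnorm T. Proof. by []. Qed.

Lemma bcomp_norm U V W (S : bop V W) (T : bop U V) : `|S \bo T| <= `|S| * `|T|.
Proof.
rewrite !bop_normE; apply: opnorm_le_bound => [|x].
  by rewrite mulr_ge0 ?opnorm_ge0.
rewrite bcompE (le_trans (opnorm_rnorm _ _))// -mulrA ler_wpM2l ?opnorm_ge0//.
exact: opnorm_rnorm.
Qed.

Lemma is_binv_uniq U V (T : bop U V) (S S' : bop V U) :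
  is_binv T S -> is_binv T S' -> S = S'.
Proof.
by move=> [ST _] [_ TS']; rewrite -(bcomp1r S) -TS' bcompA ST bcomp1l.
Qed.

Lemma binvE U V (T : bop U V) (S : bop V U) : is_binv T S -> binv T = S.
Proof.
move=> TS; apply: is_binv_uniq (TS).
by rewrite /binv; case: xgetP => [Q -> //|/(_ S)].
Qed.

Lemma binvP U V (T : bop U V) : binvertible T -> is_binv T (binv T).
Proof. by move=> [S TS]; rewrite (binvE TS). Qed.

End operator_algebra_lemmas.

(** * Completeness of the space of bounded operators *)

Section bop_complete.
Variables (R : realType) (U : normedModType R[i]) (V : completeNormedModType R[i]).

Lemma bop_cauchy_cvg (F : set_system (bop U V)) : ProperFilter F ->
  cauchy F -> cvg F.
Proof.
move=> FF /cauchyP Fc.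
have {}Fc (e : R) : 0 < e ->
    exists T0 : bop U V, F [set T | opnorm (T - T0) <= e].
  move=> e0; have [T0 FT0] := Fc e e0; exists T0; apply: filterS FT0 => T.
  by rewrite -ball_normE /ball_ /= distrC bop_normE => /ltW.
have cvx (x : U) : cvg ((fun T : bop U V => T x) @ F).
  apply: cauchy_cvg; apply/cauchy_exP => e /posC_Re[eE e0].
  have n0 : 0 < rnorm x + 1 by rewrite ltr_wpDl ?rnorm_ge0.
  have [T0 FT0] := Fc _ (divr_gt0 e0 n0); exists (T0 x).
  suff : F [set T : bop U V | ball (T0 x) e (T x)] by [].
  apply: filterS FT0 => T /= TT0; rewrite -ball_normE /ball_ /= eE.
  rewrite distrC -bopBE -rnormE ltcR (le_lt_trans (opnorm_rnorm _ _))//.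
  rewrite (le_lt_trans (ler_wpM2r (rnorm_ge0 _) TT0))//.
  by rewrite mulrAC ltr_pdivrMr// ltr_pM2l// ltrDl.
pose f x := lim ((fun T : bop U V => T x) @ F).
have fl : linear f.
  move=> a x y; apply: cvg_lim => //.
  have -> : (fun T : bop U V => T (a *: x + y)) = (fun T => a *: T x + T y).
    by apply/funext => T; rewrite linearP.
  by apply: cvgD; [apply: cvgZr; exact: cvx|exact: cvx].
(* Some T lies both in the given ball around [T0] and, at the point [x], within any [d] of the
   limit; this carries the bound over to [f] and makes the convergence uniform. *)
have fT0 (e : R) (T0 : bop U V) x : F [set T | opnorm (T - T0) <= e] ->
    rnorm (f x - T0 x) <= e * rnorm x.
  move=> FT0; apply/ler_addgt0Pl => d d0.
  have dC : 0 < d%:C by rewrite ltcR.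
  have /cvgrPdist_le/(_ _ dC) FTd := cvx x.
  have [T [/= TT0]] := filter_ex (filterI FT0 FTd).
  rewrite -/(f x) -rnormE lecR => fT.
  rewrite (le_trans (rnorm_triangle _ (T x) _))// lerD// -bopBE.
  by rewrite (le_trans (opnorm_rnorm _ _))// ler_wpM2r ?rnorm_ge0.
have fb : exists M : R[i], forall x, `|f x| <= M * `|x|.
  have [T0 FT0] := Fc 1 ltr01; exists (1 + opnorm T0)%:C => x.
  rewrite -!rnormE -rmorphM/= lecR -[f x](subrK (T0 x)).
  by rewrite (le_trans (rnormD _ _))// mulrDl lerD ?opnorm_rnorm ?fT0.
apply/cvg_ex; exists (Bop fl fb); apply/cvgrPdist_le => /= e e0.
have [T0 FT0] := Fc (e / 2) (divr_gt0 e0 (ltr0Sn _ 1)).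
apply: filterS (FT0) => T /= TT0.
rewrite -(subrK T0 (Bop fl fb)) -addrA (le_trans (ler_normD _ _))//.
rewrite [leRHS](splitr e) lerD//; last by rewrite distrC.
by rewrite bop_normE; apply: opnorm_le_bound => [|x];
  [rewrite divr_ge0// ltW|rewrite bopBE fT0].
Qed.

HB.instance Definition _ := Uniform_isComplete.Build (bop U V) bop_cauchy_cvg.

End bop_complete.

(** * Inner products and the Riesz representation theorem *)

Section inner_product.
Variables (R : realType) (V : hilbertType R).
Implicit Types x y z : V.

Definition rdot x y : R := complex.Re (hdot x y).

Lemma hdotDl x y z : hdot (x + y) z = hdot x z + hdot y z.
Proof. by have := hdot_linear z 1 x y; rewrite scale1r mul1r. Qed.

Lemma hdot0l z : hdot 0 z = 0.
Proof. by have := hdotDl 0 0 z; rewrite addr0 -{1}[hdot 0 z]addr0 => /addrI. Qed.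

Lemma hdotZl a x z : hdot (a *: x) z = a * hdot x z.
Proof. by have := hdot_linear z a x 0; rewrite !addr0 hdot0l addr0. Qed.

Lemma hdotNl x z : hdot (- x) z = - hdot x z.
Proof. by rewrite -scaleN1r hdotZl mulN1r. Qed.

Lemma hdotBl x y z : hdot (x - y) z = hdot x z - hdot y z.
Proof. by rewrite hdotDl hdotNl. Qed.

Lemma hdotDr x y z : hdot z (x + y) = hdot z x + hdot z y.
Proof. by rewrite hdotC hdotDl rmorphD/= -!hdotC. Qed.

Lemma hdotNr x z : hdot z (- x) = - hdot z x.
Proof. by rewrite hdotC hdotNl rmorphN/= -hdotC. Qed.

Lemma hdotBr x y z : hdot z (x - y) = hdot z x - hdot z y.
Proof. by rewrite hdotDr hdotNr. Qed.

Lemma hdot0r z : hdot z 0 = 0.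
Proof. by rewrite hdotC hdot0l rmorph0. Qed.

Lemma hdotZr a x z : hdot z (a *: x) = a^*%C * hdot z x.
Proof. by rewrite hdotC hdotZl rmorphM/= -hdotC. Qed.

Lemma rdotxx x : rdot x x = rnorm x ^+ 2.
Proof.
apply: complexI; rewrite rmorphXn/= rnormE -hdot_norm /rdot hdot_norm.
by rewrite -rnormE -rmorphXn.
Qed.

Lemma rdotC x y : rdot x y = rdot y x.
Proof. by rewrite /rdot hdotC; case: (hdot y x). Qed.

Lemma rdotDl x y z : rdot (x + y) z = rdot x z + rdot y z.
Proof. by rewrite /rdot hdotDl raddfD. Qed.

Lemma rdotDr x y z : rdot z (x + y) = rdot z x + rdot z y.
Proof. by rewrite /rdot hdotDr raddfD. Qed.

Lemma rdotNl x z : rdot (- x) z = - rdot x z.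
Proof. by rewrite /rdot hdotNl raddfN. Qed.

Lemma rdotNr x z : rdot z (- x) = - rdot z x.
Proof. by rewrite /rdot hdotNr raddfN. Qed.

Lemma rdotZl (r : R) x z : rdot (r%:C *: x) z = r * rdot x z.
Proof. by rewrite /rdot hdotZl; case: (hdot x z) => a b /=; rewrite mul0r subr0. Qed.

Lemma rdotZr (r : R) x z : rdot z (r%:C *: x) = r * rdot z x.
Proof. by rewrite rdotC rdotZl rdotC. Qed.

Lemma Im_hdot x y : complex.Im (hdot x y) = - rdot ('i%C *: x) y.
Proof. by rewrite /rdot hdotZl; case: (hdot x y) => a b /=; ring. Qed.

Lemma rnorm_sqrD x y :
  rnorm (x + y) ^+ 2 = rnorm x ^+ 2 + 2 * rdot x y + rnorm y ^+ 2.
Proof. by rewrite -!rdotxx !(rdotDl, rdotDr) (rdotC y x); ring. Qed.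

Lemma rnorm_sqrB x y :
  rnorm (x - y) ^+ 2 = rnorm x ^+ 2 - 2 * rdot x y + rnorm y ^+ 2.
Proof. by rewrite rnorm_sqrD rdotNr rnormN; ring. Qed.

Lemma rdot_le x y : rdot x y <= rnorm x * rnorm y.
Proof.
have [x0|x0] := eqVneq (rnorm x) 0.
  by rewrite (rnorm0_eq0 x0) /rdot hdot0l rnorm0 mul0r.
have [y0|y0] := eqVneq (rnorm y) 0.
  by rewrite (rnorm0_eq0 y0) /rdot hdot0r rnorm0 mulr0.
have xp : 0 < rnorm x by rewrite lt0r x0 rnorm_ge0.
have yp : 0 < rnorm y by rewrite lt0r y0 rnorm_ge0.
(* This square expands to [2 a b (a b - d)]. *)
have := sqr_ge0 (rnorm ((rnorm y)%:C *: x - (rnorm x)%:C *: y)).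
rewrite rnorm_sqrB !rnormZr rdotZl rdotZr !ger0_norm ?rnorm_ge0//.
set a := rnorm x in xp *; set b := rnorm y in yp *; set d := rdot x y => H.
have : 0 <= (a * b) * (a * b - d) by lra.
by rewrite pmulr_rge0 ?mulr_gt0// subr_ge0.
Qed.

Lemma hdot_ext x y : (forall z, hdot z x = hdot z y) -> x = y.
Proof.
move=> xy; apply/eqP; rewrite -subr_eq0; apply/eqP/rnorm0_eq0/eqP.
by rewrite -sqrf_eq0 -rdotxx /rdot hdotBr xy subrr.
Qed.

(** The imaginary part at [x] is minus the real part at ['i *: x], so a homogeneous [f] is
    determined by real parts. *)
Lemma rdot_hdot x y (f : V -> R[i]) :
  (forall a z, f (a *: z) = a * f z) ->
  (forall z, rdot z y = complex.Re (f z)) -> hdot x y = f x.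
Proof.
move=> fZ fy; apply/eqP; rewrite eq_complex -/(rdot x y) fy eqxx/=.
by rewrite Im_hdot fy fZ; case: (f x) => a b /=; apply/eqP; ring.
Qed.

(** The representing vector is the minimizer of [|x|^2 - 2 Re f(x)]: a minimizing sequence is Cauchy
    by the parallelogram law, and at the minimizer the first variation vanishes. *)
Lemma riesz (f : V -> R[i]) (M : R) : linear_for *%R f ->
  (forall x, complex.Re (f x) <= M * rnorm x) ->
  exists y, forall x, f x = hdot x y.
Proof.
move=> fl fM.
have f0 : f 0 = 0.
  by have := fl 1 0 0; rewrite scale1r addr0 mul1r -{1}[f 0]addr0 => /addrI.
have fD x y : f (x + y) = f x + f y by rewrite -(scale1r x) fl mul1r scale1r.
have fZ a x : f (a *: x) = a * f x by rewrite -[a *: x]addr0 fl f0 addr0.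
pose g x := complex.Re (f x).
have gD x y : g (x + y) = g x + g y by rewrite /g fD raddfD.
have gZ (r : R) x : g (r%:C *: x) = r * g x.
  by rewrite /g fZ; case: (f x) => a b /=; rewrite mul0r subr0.
pose J x := rnorm x ^+ 2 - 2 * g x.
have Jlb x : - M ^+ 2 <= J x.
  have := sqr_ge0 (rnorm x - M); have := fM x; rewrite -/(g x) /J; lra.
pose S := [set J x | x in [set: V]].
have Si : has_inf S.
  split; first by exists (J 0), 0.
  by exists (- M ^+ 2) => _ [x _ <-].
pose d := inf S.
have dJ x : d <= J x by apply: (ge_inf Si.2); exists x.
have /choice[x xd] (n : nat) : exists x, J x <= d + n.+1%:R^-1.
  have [_ [x _ <-] Jx] : exists2 s, S s & s < d + n.+1%:R^-1.
    by apply: inf_adherent => //; rewrite invr_gt0.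
  by exists x; exact: ltW.
(* The parallelogram law combined with [d <= J] at the midpoint of [u] and [v]. *)
have para u v : rnorm (u - v) ^+ 2 <= 2 * (J u - d) + 2 * (J v - d).
  have := dJ ((2^-1)%:C *: (u + v)).
  rewrite /J gZ gD rnormZr exprMn rnorm_sqrD rnorm_sqrB.
  have -> : `|2^-1| ^+ 2 = 4^-1 :> R by rewrite ger0_norm ?invr_ge0//; field.
  lra.
have xc (e : R) : 0 < e ->
    exists N, forall m n, (N <= m)%N -> (N <= n)%N -> rnorm (x m - x n) <= e.
  move=> e0; have [N Ne] : exists N : nat, 4 / e ^+ 2 <= N%:R.
    exists (Num.bound (4 / e ^+ 2)).
    by apply/ltW/archi_boundP; rewrite divr_ge0// sqr_ge0.
  exists N => m n Nm Nn.
  rewrite -(@ler_pXn2r _ 2) ?nnegrE ?rnorm_ge0 ?(ltW e0)//.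
  rewrite (le_trans (para _ _))//.
  have Ni k : (N <= k)%N -> k.+1%:R^-1 <= e ^+ 2 / 4.
    move=> Nk; rewrite -[leRHS]invf_div lef_pV2 ?posrE ?divr_gt0 ?exprn_gt0//.
    by rewrite (le_trans Ne)// ler_nat (leq_trans Nk).
  have := le_trans (xd m) (lerD (lexx d) (Ni _ Nm)).
  have := le_trans (xd n) (lerD (lexx d) (Ni _ Nn)).
  move: (J (x m)) (J (x n)) (e ^+ 2) => a b c; lra.
have [y /rnorm_cvgP xy] := rnorm_cauchy xc.
have gM u : `|g u| <= M * rnorm u.
  rewrite ler_norml fM andbT lerNl.
  have := fM (- u); rewrite rnormN -/(g (- u)) -scaleN1r.
  by rewrite -(rmorphN1 (real_complex R)) gZ mulN1r.
have JD u v : J (u + v) = J u + 2 * (rdot u v - g v) + rnorm v ^+ 2.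
  by rewrite /J rnorm_sqrD gD; ring.
have Jy : J y <= d.
  apply/ler_addgt0Pl => e e0.
  (* With h = x n - y, the difference [J y - J (x n)] is at most [2 (|y| + |M|) |h|]; the summand 1
     keeps the divisor positive. *)
  pose c := 2 * (rnorm y + `|M|) + 1.
  have c0 : 0 < c.
    by rewrite /c; have := rnorm_ge0 y; have := normr_ge0 M; lra.
  have [N xyN] := xy _ (divr_gt0 (divr_gt0 e0 (ltr0Sn _ 1)) c0).
  pose n := maxn N (Num.bound (2 / e)).
  have := xyN n (leq_maxl _ _).
  have ne : n.+1%:R^-1 <= e / 2.
    rewrite -[leRHS]invf_div lef_pV2 ?posrE ?divr_gt0//.
    apply/ltW/(lt_le_trans (archi_boundP _)); first by rewrite divr_ge0// ltW.
    by rewrite ler_nat ltnW// ltnS leq_maxr.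
  rewrite ler_pdivlMr//; set h := x n - y => hc.
  have := le_trans (xd n) (lerD (lexx d) ne).
  have -> : J y = J (x n) - 2 * (rdot y h - g h) - rnorm h ^+ 2.
    by have := JD y h; rewrite /h (addrC y) subrK => ->; ring.
  have := gM h; rewrite ler_norml => /andP[_ gh].
  have := rdot_le y (- h); rewrite rdotNr rnormN => yh.
  have := sqr_ge0 (rnorm h); have := rnorm_ge0 h => h0.
  have : M * rnorm h <= `|M| * rnorm h by rewrite ler_wpM2r// ler_norm.
  move: hc yh gh h0; rewrite /c.
  move: (J (x n)) (rnorm h ^+ 2) (rnorm h) (rnorm y) `|M| (g h) (rdot y h).
  by move=> *; lra.
exists y => z; apply/esym/rdot_hdot => // {}z.
pose c := rdot y z - g z; pose s := rnorm z ^+ 2.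
have s0 : 0 <= s by exact: sqr_ge0.
(* The best step along [z] would be [- c / s]; the denominator [s + 1] also covers z = 0 and still
   changes [J] by [- c^2 (s + 2) / (s + 1)^2], which forces c = 0. *)
have := le_trans Jy (dJ (y + (- c / (s + 1))%:C *: z)).
rewrite JD rdotZr gZ rnormZr exprMn real_normK ?num_real// -/s => H.
have s1 : 0 < s + 1 by lra.
suff : c = 0 by rewrite /c rdotC -/(g z) => /eqP; rewrite subr_eq0 => /eqP.
apply/eqP; rewrite -sqrf_eq0 eq_le sqr_ge0 andbT.
have {}H : 0 <= 2 * (- c / (s + 1) * c) + (- c / (s + 1)) ^+ 2 * s.
  by rewrite /c in H *; lra.
have : 0 <= (2 * (- c / (s + 1) * c) + (- c / (s + 1)) ^+ 2 * s) * (s + 1) ^+ 2.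
  by rewrite mulr_ge0// sqr_ge0.
have -> : (2 * (- c / (s + 1) * c) + (- c / (s + 1)) ^+ 2 * s) * (s + 1) ^+ 2 =
   - c ^+ 2 * (s + 2) by field; rewrite gt_eqF.
by rewrite mulNr oppr_ge0 pmulr_lle0//; lra.
Qed.

End inner_product.

Section adjoints.
Variable R : realType.
Implicit Types U V W : hilbertType R.

(** Riesz representation for each [y]; boundedness comes from [|S y|^2 = <T (S y), y>]. *)
Lemma adjoint_exists U V (T : bop U V) : exists S, is_adjoint T S.
Proof.
have /choice[S TS] y : exists z, forall x, hdot (T x) y = hdot x z.
  apply: (riesz (M := opnorm T * rnorm y)) => [a u v|x].
    by rewrite linearP hdot_linear.
  rewrite (le_trans (rdot_le (T x) y))// mulrAC ler_wpM2r ?rnorm_ge0//.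
  exact: opnorm_rnorm.
have Sl : linear S.
  move=> a u v; apply: hdot_ext => z.
  by rewrite hdotDr hdotZr -!TS hdotDr hdotZr.
have Sb y : rnorm (S y) <= opnorm T * rnorm y.
  have [->|y0] := eqVneq (rnorm (S y)) 0.
    by rewrite mulr_ge0 ?opnorm_ge0 ?rnorm_ge0.
  have yp : 0 < rnorm (S y) by rewrite lt0r y0 rnorm_ge0.
  rewrite -(ler_pM2l yp) -expr2 -rdotxx {1}/rdot -TS.
  rewrite (le_trans (rdot_le _ _))// mulrA ler_wpM2r ?rnorm_ge0// mulrC.
  exact: opnorm_rnorm.
have Sb' : exists M : R[i], forall x, `|S x| <= M * `|x|.
  by exists (opnorm T)%:C => x; rewrite -!rnormE -rmorphM/= lecR.
by exists (Bop Sl Sb').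
Qed.

Lemma adjP U V (T : bop U V) x y : hdot (T x) y = hdot x (adj T y).
Proof.
rewrite /adj; case: xgetP => [S _ TS|]; first exact: TS.
by have [S TS] := adjoint_exists T => /(_ S).
Qed.

Lemma adjP' U V (T : bop U V) x y : hdot (adj T x) y = hdot x (T y).
Proof. by rewrite hdotC -adjP -hdotC. Qed.

Lemma adj_eq U V (T : bop U V) (S : bop V U) : is_adjoint T S -> adj T = S.
Proof.
by move=> TS; apply: bopP => y; apply: hdot_ext => z; rewrite -adjP TS.
Qed.

Lemma adjM U V W (S : bop V W) (T : bop U V) : adj (S \bo T) = adj T \bo adj S.
Proof. by apply: adj_eq => x y; rewrite !bcompE adjP adjP. Qed.

Lemma adjB U V (S T : bop U V) : adj (S - T) = adj S - adj T.
Proof. by apply: adj_eq => x y; rewrite !bopBE hdotBl hdotBr !adjP. Qed.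

Lemma adj_norm U V (T : bop U V) : `|adj T| <= `|T|.
Proof.
rewrite !bop_normE; apply: opnorm_le_bound => [|y]; first exact: opnorm_ge0.
have [->|y0] := eqVneq (rnorm (adj T y)) 0.
  by rewrite mulr_ge0 ?opnorm_ge0 ?rnorm_ge0.
have yp : 0 < rnorm (adj T y) by rewrite lt0r y0 rnorm_ge0.
rewrite -(ler_pM2l yp) -expr2 -rdotxx {1}/rdot -adjP.
rewrite (le_trans (rdot_le _ _))// mulrA ler_wpM2r ?rnorm_ge0// mulrC.
exact: opnorm_rnorm.
Qed.

End adjoints.

Section dense_span.
Variable R : realType.

Section approx.
Variables (V : normedModType R[i]) (J : Type) (f : J -> V).

(** The list stores indices instead of vectors, so the same coefficients can be transported from one
    family to another. *)
Definition comb (s : seq (R[i] * J)) : V := \sum_(p <- s) p.1 *: f p.2.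

Lemma dense_approx : closure (lin_span (range f)) = setT ->
  forall x (e : R), 0 < e -> exists s, rnorm (x - comb s) <= e.
Proof.
move=> fd x e e0; have : closure (lin_span (range f)) x by rewrite fd.
move=> /(_ (ball x e%:C)) [].
  by apply: nbhsx_ballx; rewrite ltcR.
move=> _ [[n [c [v [vf ->]]]]].
have /choice[j jv] i : exists j, f j = v i by have [j _ <-] := vf i; exists j.
rewrite -ball_normE /ball_ /= => xv.
exists [seq (c i, j i) | i <- index_enum 'I_n].
rewrite /comb big_map /=; under eq_bigr do rewrite jv.
by rewrite -lecR rnormE ltW.
Qed.

End approx.

Lemma bop_dense_eq (V W : normedModType R[i]) (J : Type) (f : J -> V)
    (S T : bop V W) :
  closure (lin_span (range f)) = setT -> (forall j, S (f j) = T (f j)) -> S = T.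
Proof.
move=> fd ST; apply/eqP; rewrite -subr_eq0; apply/eqP/bopP => x.
apply: rnorm0_eq0; apply/eqP; rewrite eq_le rnorm_ge0 andbT.
apply/ler_addgt0Pl => e e0; rewrite addr0.
have c0 : 0 < opnorm (S - T) + 1 by rewrite ltr_wpDl ?opnorm_ge0.
have [s xs] := dense_approx fd x (divr_gt0 e0 c0).
have -> : (S - T) x = (S - T) (x - comb f s).
  rewrite bop_mapB (_ : (S - T) (comb f s) = 0) ?subr0//.
  rewrite /comb; elim: s {xs} => [|p s IH]; first by rewrite big_nil bop_map0.
  by rewrite big_cons bop_mapD IH bop_mapZ bopBE ST subrr scaler0 addr0.
rewrite (le_trans (opnorm_rnorm _ _))//.
rewrite ler_pdivlMr// in xs; rewrite (le_trans _ xs)// mulrC ler_wpM2l ?rnorm_ge0//.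
by rewrite lerDl.
Qed.

End dense_span.

(** * Unitary operators from equal Gram matrices *)

Section gram.
Variables (R : realType) (H H' : hilbertType R) (J : Type).
Variables (f : J -> H) (g : J -> H').
Hypothesis fg : forall i j, hdot (f i) (f j) = hdot (g i) (g j).
Hypothesis fd : closure (lin_span (range f)) = setT.
Hypothesis gd : closure (lin_span (range g)) = setT.

(** The graph of the operator to be built: [y] is the image of [x] when it has the same inner
    products with the [g j] as [x] has with the [f j]. The complex factor [c] lets real parts
    account for imaginary parts too. *)
Let corr (x : H) (y : H') :=
  forall c j, rdot y (c *: g j) = rdot x (c *: f j).

Let rdot_comb x y s : corr x y -> rdot y (comb g s) = rdot x (comb f s).
Proof.
move=> xy; rewrite /comb; elim: s => [|p s IH].
  by rewrite !big_nil /rdot !hdot0r.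
by rewrite !big_cons !rdotDr IH xy.
Qed.

Let comb_norm s : rnorm (comb f s) = rnorm (comb g s).
Proof.
apply/eqP; rewrite -(@eqrXn2 _ 2) ?rnorm_ge0//; apply/eqP.
rewrite -!rdotxx /rdot; congr (complex.Re _); rewrite /comb.
elim: {1 3}s => [|p u IH]; first by rewrite !big_nil !hdot0l.
rewrite !big_cons !hdotDl IH !hdotZl; congr (_ * _ + _).
elim: s {IH} => [|q s IH]; first by rewrite !big_nil !hdot0r.
by rewrite !big_cons !hdotDr IH !hdotZr fg.
Qed.

Let corrD x y x' y' : corr x y -> corr x' y' -> corr (x + x') (y + y').
Proof. by move=> xy xy' c j; rewrite !rdotDl xy xy'. Qed.

Let corrZ a x y : corr x y -> corr (a *: x) (a *: y).
Proof.
move=> xy c j; have swap (V : hilbertType R) (u v : V) :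
    rdot (a *: u) v = rdot u (a^*%C *: v).
  by rewrite /rdot hdotZl hdotZr conjcK.
by rewrite !swap !scalerA xy.
Qed.

Let corrN x y : corr x y -> corr (- x) (- y).
Proof. by move=> /(corrZ (-1)); rewrite !scaleN1r. Qed.

(** Approximate [y] by a combination w of the [g j]. Then [|y|^2] is close to [<y, w>], which equals
    the product of [x] with the matching combination of the [f j], a vector of norm [|w|]; the error
    is at most [(|x| + |y|) |y - w|]. *)
Let corr_le x y : corr x y -> rnorm y <= rnorm x.
Proof.
move=> xy; have [->|y0] := eqVneq (rnorm y) 0; first exact: rnorm_ge0.
have yp : 0 < rnorm y by rewrite lt0r y0 rnorm_ge0.
rewrite -(ler_pM2l yp) -expr2; apply/ler_addgt0Pl => e e0.
have x0 := rnorm_ge0 x.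
have c0 : 0 < rnorm x + rnorm y by lra.
have [s] := dense_approx gd y (divr_gt0 e0 c0).
set w := comb g s; rewrite ler_pdivlMr// => yw.
have -> : rnorm y ^+ 2 = rdot y w + rdot y (y - w).
  by rewrite -rdotDr addrC subrK rdotxx.
have := rdot_le y (y - w); rewrite (rdot_comb _ xy).
have := rdot_le x (comb f s); rewrite comb_norm -/w.
have : rnorm w <= rnorm y + rnorm (y - w).
  by rewrite (rnormB y) -{1}(subrK y w) addrC rnormD.
by move=> /(ler_wpM2l x0); lra.
Qed.

Let corr_uniq x y y' : corr x y -> corr x y' -> y = y'.
Proof.
move=> xy /corrN xy'; have := corr_le (corrD xy xy'); rewrite subrr rnorm0.
move=> yy'; apply/eqP; rewrite -subr_eq0; apply/eqP/rnorm0_eq0/eqP.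
by rewrite eq_le yy' rnorm_ge0.
Qed.

Let corr_gen j : corr (f j) (g j).
Proof. by move=> c k; rewrite /rdot !hdotZr fg. Qed.

Let corr_comb s : corr (comb f s) (comb g s).
Proof.
rewrite /comb; elim: s => [|p s IH].
  by rewrite !big_nil => c j; rewrite /rdot !hdot0l.
by rewrite !big_cons; apply: corrD => //; exact/corrZ/corr_gen.
Qed.

(** [y] is the limit of the images of combinations tending to [x]; these images form a Cauchy
    sequence by [corr_le]. *)
Let corr_ex x : exists y, corr x y.
Proof.
have /choice[s xs] (n : nat) : exists s, rnorm (x - comb f s) <= n.+1%:R^-1.
  by apply: dense_approx => //; rewrite invr_gt0.
have xlim (e : R) : 0 < e ->
    exists N, forall n, (N <= n)%N -> rnorm (x - comb f (s n)) <= e.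
  move=> e0; exists (Num.bound e^-1) => n Nn.
  rewrite (le_trans (xs n))// -[leRHS]invrK lef_pV2 ?posrE ?invr_gt0//.
  apply/ltW/(lt_le_trans (archi_boundP _)); first by rewrite invr_ge0 ltW.
  by rewrite ler_nat leqW.
have [|y /rnorm_cvgP yl] := @rnorm_cauchy R H' (fun n => comb g (s n)).
  move=> e e0; have [N xN] := xlim _ (divr_gt0 e0 (ltr0Sn _ 1)).
  exists N => m n Nm Nn.
  rewrite (le_trans (corr_le (corrD (corr_comb _) (corrN (corr_comb _)))))//.
  rewrite (le_trans (rnorm_triangle _ x _))// [leRHS]splitr.
  by rewrite lerD ?xN// rnormB xN.
exists y => c j; apply/eqP; rewrite -subr_eq0 -normr_eq0 eq_le normr_ge0 andbT.
apply/ler_addgt0Pl => e e0; rewrite addr0.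
pose k := rnorm (c *: g j) + rnorm (c *: f j) + 1.
have k0 : 0 < k.
  by rewrite ltr_wpDl ?addr_ge0 ?rnorm_ge0.
have [N xN] := xlim _ (divr_gt0 e0 k0).
have [N' yN] := yl _ (divr_gt0 e0 k0).
pose n := maxn N N'.
have := xN n (leq_maxl _ _); have := yN n (leq_maxr _ _).
rewrite !ler_pdivlMr// rnormB => xn yn.
have -> : rdot y (c *: g j) - rdot x (c *: f j) =
    rdot (y - comb g (s n)) (c *: g j) - rdot (x - comb f (s n)) (c *: f j).
  by rewrite !rdotDl !rdotNl corr_comb; ring.
set a := y - _ in xn *; set b := x - _ in yn *.
have := rdot_le a (c *: g j); have := rdot_le (- a) (c *: g j).
have := rdot_le b (c *: f j); have := rdot_le (- b) (c *: f j).
rewrite !rdotNl !rnormN ler_norml.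
have := rnorm_ge0 a; have := rnorm_ge0 b; move: xn yn; rewrite /k.
have := rnorm_ge0 (c *: g j); have := rnorm_ge0 (c *: f j).
move: (rnorm a) (rnorm b) (rnorm _) (rnorm _) (rdot a _) (rdot b _).
move=> ra rb rf rg da db *; apply/andP; split; nra.
Qed.

Lemma gram_contraction : exists2 U : bop H H', (forall j, U (f j) = g j) &
  forall x j, hdot (U x) (g j) = hdot x (f j).
Proof.
have /choice[U xU] := corr_ex.
have Ul : linear U.
  move=> a x y; apply: corr_uniq (xU _) _.
  by apply: corrD => //; exact: corrZ.
have Ub : exists M : R[i], forall x, `|U x| <= M * `|x|.
  by exists 1 => x; rewrite mul1r -!rnormE lecR; exact: corr_le.
exists (Bop Ul Ub) => [j|x j] /=; first exact: corr_uniq (xU _) (corr_gen j).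
apply/eqP; rewrite eq_complex; apply/andP; split; apply/eqP.
  by have := xU x 1 j; rewrite !scale1r.
rewrite !Im_hdot; congr (- _).
by have := corrZ 'i%C (xU x) 1 j; rewrite !scale1r.
Qed.

End gram.

(** The inner product relation says that the adjoint sends [g j] back to [f j], so each of the two
    products fixes a total family. *)
Lemma gram_unitary (R : realType) (H H' : hilbertType R) (J : Type)
    (f : J -> H) (g : J -> H') :
  (forall i j, hdot (f i) (f j) = hdot (g i) (g j)) ->
  closure (lin_span (range f)) = setT -> closure (lin_span (range g)) = setT ->
  exists2 U : bop H H', unitary U & forall j, U (f j) = g j.
Proof.
move=> fg fd gd; have [U Uf Ucorr] := gram_contraction fg fd gd.
have aU j : adj U (g j) = f j.
  by apply: hdot_ext => z; rewrite -adjP Ucorr.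
exists U => //; split.
  by apply: (bop_dense_eq fd) => j; rewrite bcompE Uf aU bidE.
by apply: (bop_dense_eq gd) => j; rewrite bcompE aU Uf bidE.
Qed.

(** * Moments of the transfer function *)

Section neumann.
Variables (R : realType) (H : completeNormedModType R[i]).
Implicit Types (A : bop H H) (l : R).

Lemma bscalarR_comp l (T : bop H H) : bscalar H l%:C \bo T = l *: T.
Proof. exact: bopP. Qed.

Lemma bcomp_bscalarR l (T : bop H H) : T \bo bscalar H l%:C = l *: T.
Proof. by apply: bopP => x; rewrite bcompE bop_mapZ. Qed.

Lemma bid_norm : `|bid H| <= 1.
Proof.
by rewrite bop_normE; apply: opnorm_le_bound => // x; rewrite bidE mul1r.
Qed.

Lemma affine_fixpoint (V : completeNormedModType R) (f : V -> V) (q : R) :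
  0 <= q -> q < 1 -> (forall x y, `|f x - f y| <= q * `|x - y|) ->
  exists x, x = f x.
Proof.
move=> q0 q1 fq.
pose F : {fun [set: V] >-> [set: V]} :=
  mkfun (fun x (_ : [set: V] x) => I : [set: V] (f x)).
have [||//|x _ xF] := @banach_fixed_point R V setT F.
- exists (NngNum q0); split => // -[x y] _; exact: fq.
- exact: closedT.
- by exists 0.
by exists x.
Qed.

(** In place of a Neumann series, Banach's theorem solves [Z = (1 + A Z) / l] and
    [Z = (1 + Z A) / l], both with contraction factor [|A| / l]. The solutions are a right and a
    left inverse, hence equal. *)
Lemma large_resolvent A l : `|A| < l -> binvertible (bscalar H l%:C - A).
Proof.
move=> Al; have l0 : 0 < l by rewrite (le_lt_trans _ Al).
have q1 : `|A| / l < 1 by rewrite ltr_pdivrMr// mul1r.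
have q0 : 0 <= `|A| / l by rewrite divr_ge0// ltW.
have [|Z ZE] := @affine_fixpoint (bop H H) (fun Z => l^-1 *: (bid H + A \bo Z)) _ q0 q1.
  move=> X Y; rewrite -scalerBr opprD addrACA subrr add0r -bcompBr normrZ.
  rewrite ger0_norm ?invr_ge0 ?(ltW l0)// mulrC mulrAC ler_wpM2r ?invr_ge0 ?(ltW l0)//.
  exact: bcomp_norm.
have [|Z' Z'E] := @affine_fixpoint (bop H H) (fun Z => l^-1 *: (bid H + Z \bo A)) _ q0 q1.
  move=> X Y; rewrite -scalerBr opprD addrACA subrr add0r -bcompBl normrZ.
  rewrite ger0_norm ?invr_ge0 ?(ltW l0)// mulrC mulrAC ler_wpM2r ?invr_ge0 ?(ltW l0)//.
  by rewrite mulrC; exact: bcomp_norm.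
have lZ : (bscalar H l%:C - A) \bo Z = bid H.
  rewrite bcompBl bscalarR_comp [X in l *: X]ZE scalerA divff ?gt_eqF// scale1r.
  by rewrite addrK.
have Z'l : Z' \bo (bscalar H l%:C - A) = bid H.
  rewrite bcompBr bcomp_bscalarR [X in l *: X]Z'E scalerA divff ?gt_eqF// scale1r.
  by rewrite addrK.
exists Z; split => //.
have -> : Z = Z'; last by [].
by rewrite -[Z]bcomp1l -Z'l -bcompA lZ bcomp1r.
Qed.

Lemma resolventE A l : `|A| < l ->
  l *: binv (bscalar H l%:C - A) = bid H + A \bo binv (bscalar H l%:C - A).
Proof.
move=> /large_resolvent/binvP[_]; rewrite bcompBl bscalarR_comp => /eqP.
by rewrite subr_eq => /eqP.
Qed.

Lemma resolvent_norm A l : `|A| < l ->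
  `|binv (bscalar H l%:C - A)| <= (l - `|A|)^-1.
Proof.
move=> Al; have l0 : 0 < l by rewrite (le_lt_trans _ Al).
rewrite -[leRHS]mul1r ler_pdivlMr ?subr_gt0// mulrBr lerBlDr.
rewrite mulrC -{1}[l]gtr0_norm// -normrZ resolventE//.
rewrite (le_trans (ler_normD _ _))// lerD ?bid_norm// mulrC.
exact: bcomp_norm.
Qed.

Fixpoint bpow A n : bop H H := if n is m.+1 then A \bo bpow A m else bid H.

Lemma bpowE A n x : bpow A n x = iter n A x.
Proof. by elim: n => [|n IH]; rewrite ?bidE//= IH. Qed.

Lemma bpowSr A n : bpow A n.+1 = bpow A n \bo A.
Proof.
elim: n => [|n IH]; first by rewrite /= bcomp1l bcomp1r.
by rewrite [LHS]/= [X in A \bo X]IH bcompA.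
Qed.

End neumann.

Section moments.
Variables (R : realType) (E H H' : completeNormedModType R[i]).
Variables (A : bop H H) (B : bop E H) (C : bop H E).
Variables (A' : bop H' H') (B' : bop E H') (C' : bop H' E).

(** The Laurent coefficients at infinity are peeled off one at a time. With [D n l] the difference
    of the functions [C A^n (l - A)^-1 B] and [M n] the difference of moments,
    [l D_n = M_n + D_(n+1)]. If D_n vanishes, M_n is minus D_(n+1), which decays in l; so M_n = 0,
    and then D_(n+1) = 0. *)
Lemma moments_eq (l0 : R) :
  (forall l : R, l0 < l ->
    C \bo binv (bscalar H l%:C - A) \bo B =
    C' \bo binv (bscalar H' l%:C - A') \bo B') ->
  forall n, C \bo bpow A n \bo B = C' \bo bpow A' n \bo B'.
Proof.
move=> CB0.
pose a := Num.max l0 (Num.max `|A| `|A'|).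
pose D n l := C \bo bpow A n \bo binv (bscalar H l%:C - A) \bo B -
  C' \bo bpow A' n \bo binv (bscalar H' l%:C - A') \bo B'.
pose M n := C \bo bpow A n \bo B - C' \bo bpow A' n \bo B'.
have DE n l : a < l -> l *: D n l = M n + D n.+1 l.
  rewrite !gt_max => /and3P[_ Al Al']; rewrite /D scalerBr.
  rewrite -(bcompZl l (C \bo _ \bo _)) -(bcompZl l (C' \bo _ \bo _)).
  rewrite -(bcompZr l (C \bo _)) -(bcompZr l (C' \bo _)).
  rewrite !resolventE// !bcompDr !bcompDl !bcomp1r !bpowSr !bcompA /M.
  by rewrite opprD addrACA.
pose K n := `|C \bo bpow A n| * `|B| + `|C' \bo bpow A' n| * `|B'|.
have Db n l : a < l -> `|D n l| <= (l - a)^-1 * K n.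
  rewrite !gt_max => /and3P[ll Al Al'].
  have la : a < l by rewrite !gt_max ll Al.
  have aA : `|A| <= a by rewrite !le_max lexx orbT.
  have aA' : `|A'| <= a by rewrite !le_max lexx !orbT.
  rewrite (le_trans (ler_normB _ _))// mulrDr; apply: lerD.
    rewrite (le_trans (bcomp_norm _ _))// mulrA ler_wpM2r// mulrC.
    rewrite (le_trans (bcomp_norm _ _))// ler_wpM2l//.
    rewrite (le_trans (resolvent_norm Al))// lef_pV2 ?posrE ?subr_gt0//.
    by rewrite lerB.
  rewrite (le_trans (bcomp_norm _ _))// mulrA ler_wpM2r// mulrC.
  rewrite (le_trans (bcomp_norm _ _))// ler_wpM2l//.
  rewrite (le_trans (resolvent_norm Al'))// lef_pV2 ?posrE ?subr_gt0//.
  by rewrite lerB.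
have D0 n : (forall l, a < l -> D n l = 0) -> M n = 0.
  move=> Dn; apply/eqP; rewrite -normr_le0; apply/ler_addgt0Pl => e e0.
  rewrite addr0.
  have K0 : 0 < K n.+1 + 1 by rewrite ltr_wpDl// addr_ge0// mulr_ge0.
  (* Chosen so that [K / (l - a)] is at most [e]. *)
  pose l := a + (K n.+1 + 1) / e.
  have la : a < l by rewrite /l ltrDl divr_gt0.
  have := DE n l la; rewrite Dn// scaler0 => /esym/eqP; rewrite addr_eq0 => /eqP ->.
  rewrite normrN (le_trans (Db _ _ la))// /l addrAC subrr add0r invf_div.
  by rewrite mulrAC ler_pdivrMr// ler_pM2l// lerDl.
have Dn n : forall l, a < l -> D n l = 0.
  elim: n => [l la|n IH l la].
    move: (la); rewrite !gt_max => /and3P[/CB0 E0 _ _].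
    by rewrite /D /= !bcomp1r E0 subrr.
  by have := DE n l la; rewrite IH// scaler0 D0// add0r.
by move=> n; apply/eqP; rewrite -subr_eq0; apply/eqP/D0/Dn.
Qed.

End moments.

Section gram_of_moments.
Variables (R : realType) (E H H' : hilbertType R) (sigma : bop E E).
Variables (A : bop H H) (B : bop E H) (A' : bop H' H') (B' : bop E H').

(* The colligation condition turns [A^*] into [- A - B sigma B^*], so every inner
   product reduces to the moments [B^* A^n B]. *)
Lemma gram_of_moments :
  A + adj A + B \bo sigma \bo adj B = 0 ->
  A' + adj A' + B' \bo sigma \bo adj B' = 0 ->
  (forall n, adj B \bo bpow A n \bo B = adj B' \bo bpow A' n \bo B') ->
  forall m n e e',
    hdot (iter n A (B e)) (iter m A (B e')) =
    hdot (iter n A' (B' e)) (iter m A' (B' e')).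
Proof.
move=> Ai Ai' mom.
have momE n e : adj B (iter n A (B e)) = adj B' (iter n A' (B' e)).
  by rewrite -!bpowE; have := congr1 (fun T : bop E E => T e) (mom n).
have step (G : hilbertType R) (T : bop G G) (S : bop E G) x y :
    T + adj T + S \bo sigma \bo adj S = 0 ->
    hdot x (T y) = - hdot (T x) y - hdot (S (sigma (adj S x))) y.
  move=> /(congr1 (fun Q : bop G G => Q x)) /= Q0.
  rewrite -adjP' (_ : adj T x = - T x - S (sigma (adj S x))).
    by rewrite hdotBl hdotNl.
  apply/eqP; rewrite -subr_eq0; apply/eqP; rewrite -Q0 !opprD !opprK.
  by rewrite addrA (addrC (adj T x)).
elim=> [|m IH] n e e'; first by rewrite /= -!adjP' momE.
(* The correction term is the product of [B f], with f = sigma B^* x, and [A^m B e']: again a Gram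
   entry, with exponent 0 on the left, so the induction hypothesis covers it. *)
rewrite /= (step _ _ _ _ _ Ai) (step _ _ _ _ _ Ai') -!iterS IH momE.
by rewrite (IH 0%N).
Qed.

End gram_of_moments.

Section similarity.
Variables (R : realType) (H H' : hilbertType R) (A : bop H H).
Variables (U : bop H H') (V : bop H' H).

Lemma binv_similar (l : R[i]) : is_binv U V ->
  binvertible (bscalar H l - A) ->
  binv (bscalar H' l - U \bo A \bo V) = U \bo binv (bscalar H l - A) \bo V.
Proof.
move=> [VU UV] /binvP[Zl lZ].
have lE : bscalar H' l - U \bo A \bo V = U \bo (bscalar H l - A) \bo V.
  rewrite bcompBr bcompBl; congr (_ - _).
  have -> : U \bo bscalar H l = bscalar H' l \bo U.
    by apply: bopP => x; rewrite !bcompE bop_mapZ.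
  by rewrite -bcompA UV bcomp1r.
apply: binvE; rewrite lE; set Z := binv _ in Zl lZ *; set L := _ - _ in Zl lZ *.
split.
  have -> : U \bo Z \bo V \bo (U \bo L \bo V) = U \bo (Z \bo ((V \bo U) \bo L)) \bo V.
    by rewrite !bcompA.
  by rewrite VU bcomp1l Zl bcomp1r.
have -> : U \bo L \bo V \bo (U \bo Z \bo V) = U \bo (L \bo ((V \bo U) \bo Z)) \bo V.
  by rewrite !bcompA.
by rewrite VU bcomp1l lZ bcomp1r.
Qed.

End similarity.

(** * Almost everywhere differentiable functions *)

Section almost_everywhere.
Variable R : realType.
Implicit Types (I J : set R) (P Q : R -> Prop).
Local Notation mu := (@lebesgue_measure R).

Lemma ae_onS I P Q : (forall t, I t -> P t -> Q t) -> ae_on I P -> ae_on I Q.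
Proof.
move=> PQ; rewrite /ae_on; apply: filterS; first exact: (ae_filter_ringOfSetsType mu).
by move=> t IP It; exact/PQ/IP.
Qed.

Lemma ae_onS2 I P Q S : (forall t, I t -> P t -> Q t -> S t) ->
  ae_on I P -> ae_on I Q -> ae_on I S.
Proof.
move=> PQS; rewrite /ae_on; apply: filterS2; first exact: (ae_filter_ringOfSetsType mu).
move=> t IP IQ It.
exact: PQS (IP It) (IQ It).
Qed.

Lemma ae_on_sub I J P : J `<=` I -> ae_on I P -> ae_on J P.
Proof.
move=> JI; rewrite /ae_on; apply: filterS.
  exact: (ae_filter_ringOfSetsType mu).
by move=> t IP /JI.
Qed.

Lemma ae_on_all I P : (forall t, I t -> P t) -> ae_on I P.
Proof. by move=> IP; rewrite /ae_on; apply: aeW => t; exact: IP. Qed.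

Lemma ae_on_foralln I (P : nat -> R -> Prop) :
  (forall n, ae_on I (P n)) -> ae_on I (fun t => forall n, P n t).
Proof.
move=> IP; have := @ae_foralln _ _ _ mu (fun n t => I t -> P n t) IP.
apply: (@filterS _ _ (ae_filter_ringOfSetsType mu)).
by move=> t IPt It n; exact: IPt.
Qed.

Lemma ae_on_null I P : ae_on I P ->
  exists N : set R, [/\ measurable N, mu N = 0%E & forall t, I t -> ~ N t -> P t].
Proof.
move=> [N [mN N0 NP]]; exists N; split => // t It Nt.
by apply: contrapT => Pt; apply/Nt/NP => /(_ It).
Qed.

End almost_everywhere.

Section derivatives.
Variables (R : realType) (V : normedModType R).
Implicit Types (F G : R -> V) (t : R).

(** The quotient-free form makes sense at s = t, so it applies directly to intervals having [t] as
    an end point. *)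
Definition has_deriv F t (L : V) := forall e : R, 0 < e ->
  exists2 d : R, 0 < d & forall s, `|s - t| < d ->
    `|F s - F t - (s - t) *: L| <= e * `|s - t|.

Let quotient_cvg F t L :
  h^-1 *: (F (h + t) - F t) @[h --> 0^'] --> L <-> has_deriv F t L.
Proof.
have key h : h != 0 ->
    `|L - h^-1 *: (F (h + t) - F t)| = `|h|^-1 * `|F (h + t) - F t - h *: L|.
  move=> h0; rewrite -normfV -normrZ [in RHS]scalerBr scalerA mulVf// scale1r.
  exact: distrC.
split=> [/cvgrPdist_le FL e /FL /nbhs_ballP[d /= d0 dF]|FL].
  exists d => // s sd; have [->|st] := eqVneq s t.
    by rewrite !subrr scale0r subrr !normr0 mulr0.
  have h0 : s - t != 0 by rewrite subr_eq0.
  have := dF (s - t); rewrite /ball/= sub0r normrN => /(_ sd h0).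
  by rewrite key// subrK mulrC ler_pdivrMr ?normr_gt0.
apply/cvgrPdist_le => e /FL[d d0 dF]; apply/nbhs_ballP; exists d => // h /=.
rewrite /ball/= sub0r normrN => hd h0.
rewrite key// mulrC ler_pdivrMr ?normr_gt0//.
by have := dF (h + t); rewrite addrK; apply.
Qed.

Lemma derivable_has_deriv F t : derivable F t 1 -> has_deriv F t (derive1 F t).
Proof.
move=> Ft; apply/quotient_cvg; rewrite /derive1.
have -> : (fun h => h^-1 *: (F (h + t) - F t)) =
    (fun h => h^-1 *: (F (h *: 1 + t) - F t)) :> (R -> V).
  by apply/funext => h; rewrite [h *: 1]mulr1.
exact: Ft.
Qed.

Lemma has_deriv_derivable F t L : has_deriv F t L -> derivable F t 1.
Proof.
move=> /quotient_cvg FL; rewrite /derivable.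
have -> : (fun h => h^-1 *: (F (h *: 1 + t) - F t)) =
   (fun h => h^-1 *: (F (h + t) - F t)) :> (R -> V).
  by apply/funext => h; rewrite [h *: 1]mulr1.
by apply/cvg_ex; exists L.
Qed.

Lemma has_deriv_derive1 F t L : has_deriv F t L -> derive1 F t = L.
Proof. by move=> /quotient_cvg FL; apply: cvg_lim. Qed.

Lemma has_deriv_bound F t L : has_deriv F t L ->
  exists2 d : R, 0 < d & forall s, `|s - t| < d ->
    `|F s - F t| <= (`|L| + 1) * `|s - t|.
Proof.
move=> /(_ 1 ltr01)[d d0 dF]; exists d => // s sd.
rewrite -(subrK ((s - t) *: L) (F s - F t)) (le_trans (ler_normD _ _))//.
by rewrite normrZ mulrDl [leRHS]addrC [`|s - t| * _]mulrC lerD// dF.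
Qed.

Lemma has_derivD F G t L K : has_deriv F t L -> has_deriv G t K ->
  has_deriv (fun s => F s + G s) t (L + K).
Proof.
move=> FL GK e e0; have e2 : 0 < e / 2 by rewrite divr_gt0.
have [d d0 dF] := FL _ e2; have [d' d'0 dG] := GK _ e2.
exists (Num.min d d') => [|s]; first by rewrite lt_min d0.
rewrite lt_min => /andP[/dF sF /dG sG].
have -> : F s + G s - (F t + G t) - (s - t) *: (L + K) =
    (F s - F t - (s - t) *: L) + (G s - G t - (s - t) *: K).
  by rewrite scalerDr !opprD (addrACA (F s)) [LHS]addrACA.
rewrite (le_trans (ler_normD _ _))// (le_trans (lerD sF sG))//.
by rewrite -mulrDl -splitr.
Qed.

Lemma has_derivN F t L : has_deriv F t L -> has_deriv (fun s => - F s) t (- L).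
Proof.
move=> FL e /FL[d d0 dF]; exists d => // s /dF.
by rewrite scalerN -!opprD normrN.
Qed.

Lemma has_derivB F G t L K : has_deriv F t L -> has_deriv G t K ->
  has_deriv (fun s => F s - G s) t (L - K).
Proof. by move=> FL /has_derivN; exact: has_derivD. Qed.

Lemma has_deriv_cst (c : V) t : has_deriv (fun=> c) t 0.
Proof.
move=> e e0; exists 1 => // s _.
by rewrite scaler0 !subrr normr0 mulr_ge0// ltW.
Qed.

End derivatives.

Section cousin.
Variable R : realType.

(* Cousin's lemma: a relation between points that composes along consecutive
   intervals and holds for every sufficiently small interval around each point
   holds for the whole interval. *)
Lemma cousin (P : R -> R -> Prop) (a b : R) : a <= b ->
  (forall x y z, a <= x -> x <= y -> y <= z -> z <= b ->
     P x y -> P y z -> P x z) ->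
  (forall t, a <= t -> t <= b -> exists2 d : R, 0 < d &
     forall u v, a <= u -> u <= t -> t <= v -> v <= b ->
       t - d < u -> v < t + d -> P u v) ->
  P a b.
Proof.
move=> ab trans local.
pose S := [set t | a <= t <= b /\ P a t].
have Sa : S a.
  split; first by rewrite lexx.
  have [d d0] := local a (lexx _) ab; apply => //; first by rewrite ltrBlDr ltrDl.
  by rewrite ltrDl.
have Ss : has_sup S.
  by split; [exists a|exists b => t [/andP[]]].
pose c := sup S.
have ac : a <= c by exact: (ub_le_sup Ss.2).
have cb : c <= b by apply: ge_sup; [exists a|move=> t [/andP[]]].
have [d d0 dP] := local c ac cb.
have [t [/andP[a_t tb] Pt] tc] : exists2 t, S t & c - d < t.
  by apply: sup_adherent.
have tc' : t <= c by apply: (ub_le_sup Ss.2); split => //; rewrite a_t.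
(* A step past the supremum, cut off at [b]: since [v] belongs to [S], it cannot exceed [c], and
   only v = b remains. *)
pose v := Num.min b (c + d / 2).
have d2 : 0 < d / 2 by rewrite divr_gt0.
have cv : c <= v by rewrite le_min cb lerDl ltW.
have vb : v <= b by rewrite ge_min lexx.
have Pv : P a v.
  apply: (trans a t v) => //; first exact: le_trans cv.
  apply: dP => //; rewrite (@le_lt_trans _ _ (c + d / 2))//.
    by rewrite ge_min lexx orbT.
  by rewrite ltrD2l ltr_pdivrMr// ltr_pMr// ltr1n.
have vc : v <= c.
  by apply: (ub_le_sup Ss.2); split => //; rewrite (le_trans ac cv).
have : v = b.
  move: vc; rewrite /v /Num.min; case: ifP => // _.
  by rewrite leNgt ltrDl d2.
by move=> <-.
Qed.

End cousin.

(** * The mean value inequality for absolutely continuous functions *)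

Section mean_value.
Variables (R : realType) (V : normedModType R).
Local Notation mu := (@lebesgue_measure R).

Lemma lebesgue_measure_itvoc (x y : R) : x <= y -> mu `]x, y] = (y - x)%:E.
Proof.
rewrite lebesgue_measure_itv/= lte_fin; by case: ltgtP => // -> _; rewrite subrr.
Qed.

(** Induction removing the first interval from [O]; half-open intervals that abut are disjoint, so
    the others lie in what is left. *)
Lemma sum_length_le (s : seq (R * R)) (O : set R) : measurable O ->
  (forall p, p \in s -> p.1 <= p.2 /\ `]p.1, p.2] `<=` O) ->
  pairwise (fun p q : R * R => p.2 <= q.1) s ->
  ((\sum_(p <- s) (p.2 - p.1))%:E <= mu O)%E.
Proof.
elim: s O => [|p s IH] O mO sO /=; first by rewrite big_nil.
move=> /andP[ps sp]; rewrite big_cons EFinD.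
have [p12 pO] := sO p (mem_head _ _).
have mp : measurable (`]p.1, p.2] : set R) by [].
rewrite (@measureDI _ _ _ mu O `]p.1, p.2])//.
rewrite (setIidr pO) addeC leeD//; last first.
  by rewrite -(lebesgue_measure_itvoc p12).
apply: IH => //; first exact: measurableD.
move=> q qs; have [|q12 qO] := sO q; first by rewrite inE qs orbT.
split=> // z /= zq; split; first exact: qO.
rewrite /= !in_itv/= in zq *; move/allP: ps => /(_ q qs) pq.
move: zq => /andP[qz _] /andP[_ zp].
by have := lt_le_trans (le_lt_trans pq qz) zp; rewrite ltxx.
Qed.

(** Ordered lists can be concatenated, as the gluing in Cousin's lemma requires. *)
Lemma abs_continuous_seq (D : R -> V) (a b : R) :
  abs_continuous_on a b D -> forall e : R, 0 < e ->
  exists2 d : R, 0 < d & forall s : seq (R * R),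
    (forall p, p \in s -> a <= p.1 /\ p.1 <= p.2 /\ p.2 <= b) ->
    pairwise (fun p q : R * R => p.2 <= q.1) s ->
    \sum_(p <- s) (p.2 - p.1) < d -> \sum_(p <- s) `|D p.2 - D p.1| < e.
Proof.
move=> Dac e /Dac[d d0 dD]; exists d => // s sab sp.
rewrite !(big_nth (0, 0)) !big_mkord; apply: dD => [i|i j ij].
  exact/sab/mem_nth.
have nth_le (k l : 'I_(size s)) : (k < l)%N ->
    (nth (0, 0) s k).2 <= (nth (0, 0) s l).1.
  by move=> kl; move/(pairwiseP (0, 0)): sp => /(_ k l); apply => //; rewrite inE.
have [/nth_le|/nth_le|/val_inj ijE] := ltngtP i j; [by left|by right|].
by rewrite ijE eqxx in ij.
Qed.

(* Cover the exceptional null set by an open set so small that, by absolute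
   continuity, the intervals inside it contribute little; every other point is
   a tag at which the derivatives control the increment. *)
Lemma mean_value_ae (D : R -> V) (M : R -> R) (a b : R) : a <= b ->
  abs_continuous_on a b D ->
  (forall x y, a <= x -> x <= y -> y <= b -> M x <= M y) ->
  ae_on `[a, b] (fun t => exists L l,
    [/\ has_deriv D t L, has_deriv M t l & `|L| <= l]) ->
  `|D b - D a| <= M b - M a.
Proof.
move=> ab Dac Mmono /ae_on_null[N [mN N0 NP]].
apply/ler_addgt0Pr => e e0.
have [d d0 dD] := abs_continuous_seq Dac (divr_gt0 e0 (ltr0Sn _ 1)).
have NOfin : (mu N < +oo)%E by rewrite N0.
have [ O [Oo NO mO]] := lebesgue_regularity_outer mN NOfin d0.
have mOm : measurable O by exact: open_measurable.
have muO : (mu O < d%:E)%E.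
  rewrite (@measureDI _ _ _ mu O N)// (setIidr NO).
  by rewrite -[X in (X < _)%E]/(mu (O `\` N) + mu N)%E N0 adde0.
(* The slope error over the whole interval is at most [e / 2]; adding 1 covers a = b. *)
pose k := e / 2 / (b - a + 1).
have ba : 0 <= b - a by rewrite subr_ge0.
have k0 : 0 < k by rewrite !divr_gt0// ltr_wpDl.
(* The list collects the subintervals tagged by exceptional points. Their increments are carried
   along unestimated and bounded all at once at the end, since their total length is below [d]. *)
pose P u v := exists s : seq (R * R),
  [/\ forall p, p \in s -> [/\ u <= p.1, p.1 <= p.2, p.2 <= v & `]p.1, p.2] `<=` O],
      pairwise (fun p q : R * R => p.2 <= q.1) s &
      `|D v - D u| <= M v - M u + k * (v - u) + \sum_(p <- s) `|D p.2 - D p.1|].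
have [s [sO sp sD]] : P a b.
  apply: cousin => // [x y z ax xy yz zb [s [sO sp sD]] [r [rO rp rD]]|t a_t tb].
    exists (s ++ r); split.
    - move=> p; rewrite mem_cat => /orP[/sO[? ? py ?]|/rO[yp ? ? ?]]; split => //.
        exact: le_trans py yz.
      exact: le_trans xy yp.
    - rewrite pairwise_cat sp rp !andbT; apply/allrelP => p q /sO[_ _ py _].
      by move=> /rO[yq _ _ _]; exact: le_trans py yq.
    - rewrite big_cat/=; have := ler_distD (D y) (D z) (D x).
      by move: sD rD; lra.
  have [Nt|Nt] := pselect (N t).
    have /nbhs_ballP[r /= r0 rO] : nbhs t O by apply: open_nbhs_nbhs; split=> //; exact: NO.
    exists r => // u v au ut tv vb ru vr; exists [:: (u, v)]; split => //.
    - move=> p; rewrite inE => /eqP ->/=; split => //; first exact: le_trans tv.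
      move=> z /=; rewrite in_itv/= => /andP[uz zv]; apply: rO.
      rewrite /ball/= ltr_distlC; apply/andP; split; first exact: lt_trans ru uz.
      exact: le_lt_trans zv vr.
    - rewrite big_seq1/= lerDr addr_ge0//.
        by rewrite subr_ge0 Mmono// (le_trans ut).
      by rewrite mulr_ge0 ?(ltW k0)// subr_ge0 (le_trans ut).
  have [|L [l [DL Ml Ll]]] := NP t _ Nt; first by rewrite /= in_itv/= a_t.
  (* One half of the slope error is spent on [D], the other on [M]. *)
  have k2 : 0 < k / 2 by rewrite divr_gt0.
  have [r r0 rD] := DL _ k2; have [r' r'0 rM] := Ml _ k2.
  exists (Num.min r r'); first by rewrite lt_min r0.
  move=> u v au ut tv vb; rewrite ltrBlDr -ltrBlDl lt_min => /andP[ur ur'].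
  rewrite -ltrBlDl lt_min => /andP[vr vr'].
  exists [::]; split => //; rewrite big_nil addr0.
  have ru : `|u - t| = t - u by rewrite distrC ger0_norm// subr_ge0.
  have rv : `|v - t| = v - t by rewrite ger0_norm// subr_ge0.
  have := rD u; rewrite ru => /(_ ur) Du; have := rD v; rewrite rv => /(_ vr) Dv.
  have := rM u; rewrite ru => /(_ ur'); have := rM v; rewrite rv => /(_ vr').
  rewrite !ler_norml => /andP[Mv _] /andP[_ Mu].
  have -> : D v - D u = (D v - D t - (v - t) *: L) - (D u - D t - (u - t) *: L)
      + (v - u) *: L.
    have -> : v - u = (v - t) - (u - t) by ring.
    by rewrite (scalerBl (v - t)) [RHS]addrAC subrKA opprB subrKA opprB subrKA.
  have vu : `|(v - u) *: L| <= (v - u) * l.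
    rewrite normrZ ger0_norm ?subr_ge0 ?(le_trans ut)// ler_wpM2l//.
    by rewrite subr_ge0 (le_trans ut).
  rewrite (le_trans (ler_normD _ _))//.
  have := ler_normB (D v - D t - (v - t) *: L) (D u - D t - (u - t) *: L).
  rewrite /GRing.scale/= in Mv Mu.
  by move: vu Du Dv Mv Mu; lra.
have kb : k * (b - a) <= e / 2.
  by rewrite /k mulrAC ler_pdivrMr ?ltr_wpDl// ler_pM2l ?divr_gt0// lerDl.
have : \sum_(p <- s) `|D p.2 - D p.1| < e / 2.
  apply: dD => // [p /sO[]//|].
  rewrite -lte_fin (le_lt_trans _ muO)//; apply: sum_length_le => // p /sO[]//.
by move: sD kb; lra.
Qed.

End mean_value.

(** * Absolute continuity *)

Section absolute_continuity.
Variable R : realType.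
Implicit Types (V W : normedModType R) (a b : R).

Definition unif_continuous_on V a b (F : R -> V) :=
  forall e : R, 0 < e -> exists2 d : R, 0 < d & forall x y,
    a <= x -> x <= b -> a <= y -> y <= b -> `|y - x| < d -> `|F y - F x| < e.

Lemma abs_continuous_uniform V (F : R -> V) a b :
  abs_continuous_on a b F -> unif_continuous_on a b F.
Proof.
move=> Fac e /(abs_continuous_seq Fac)[d d0 dF]; exists d => //.
move=> x y; wlog xy : x y / x <= y => [H|] ax xb ay yb.
  have [/H|/ltW/H] := leP x y; first exact.
  by rewrite distrC => {}H dxy; rewrite distrC H// distrC.
rewrite ger0_norm ?subr_ge0// => dxy.
have := dF [:: (x, y)]; rewrite !big_seq1/=; apply => // p.
by rewrite inE => /eqP ->.
Qed.

Lemma unif_continuous_bounded V (F : R -> V) a b : a <= b ->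
  unif_continuous_on a b F ->
  exists2 C : R, 0 < C & forall t, a <= t -> t <= b -> `|F t| <= C.
Proof.
move=> ab Fac; have [d d0 dF] := Fac _ ltr01.
pose P u v := exists2 C : R, 0 < C & forall t, u <= t -> t <= v -> `|F t| <= C.
apply: (cousin (P := P) ab) => [x y z _ _ _ _ [C C0 FC] [K K0 FK]|t a_t tb].
  exists (C + K) => [|t xt tz]; first by rewrite addr_gt0.
  have [ty|/ltW yt] := leP t y; first by have := FC _ xt ty; lra.
  by have := FK _ yt tz; lra.
exists d => // u v au ut tv vb ru vr; exists (`|F t| + 1) => [|s us sv].
  by rewrite ltr_wpDl.
rewrite -lerBlDl (le_trans (lerB_dist _ _))// ltW//.
apply: dF => //; [exact: le_trans us|exact: le_trans sv vb|].
by rewrite ltr_distl; apply/andP; split;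
  [exact: lt_le_trans ru us|exact: le_lt_trans sv vr].
Qed.

Lemma abs_continuous_dominated2 V1 V2 V (f : R -> V1) (g : R -> V2) (h : R -> V)
    a b (C : R) : 0 < C ->
  (forall x y, a <= x -> x <= y -> y <= b ->
     `|h y - h x| <= C * (`|f y - f x| + `|g y - g x|)) ->
  abs_continuous_on a b f -> abs_continuous_on a b g -> abs_continuous_on a b h.
Proof.
move=> C0 hC fac gac e e0.
have e2 : 0 < e / C / 2 by rewrite !divr_gt0.
have [d d0 df] := fac _ e2; have [d' d'0 dg] := gac _ e2.
exists (Num.min d d'); first by rewrite lt_min d0.
move=> n x y xy nxy; rewrite lt_min => /andP[/(df n x y xy nxy) fs /(dg n x y xy nxy) gs].
apply: (@le_lt_trans _ _ (C * (\sum_(i < n) `|f (y i) - f (x i)| +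
    \sum_(i < n) `|g (y i) - g (x i)|))).
  rewrite -big_split mulr_sumr; apply: ler_sum => i _.
  by have [? [? ?]] := xy i; exact: hC.
by rewrite mulrC -ltr_pdivlMr// [ltRHS]splitr ltrD.
Qed.

Lemma abs_continuous_lipschitz V (h : R -> V) a b (C : R) :
  (forall x y, x <= y -> `|h y - h x| <= C * (y - x)) -> abs_continuous_on a b h.
Proof.
move=> hC e e0; have C0 : 0 < `|C| + 1 by rewrite ltr_wpDl.
exists (e / (`|C| + 1)) => [|n x y xy _]; first by rewrite divr_gt0.
rewrite ltr_pdivlMr// mulr_suml => /(le_lt_trans _); apply; apply: ler_sum => i _.
have [_ [xyi _]] := xy i; rewrite (le_trans (hC _ _ xyi))// mulrC ler_wpM2l ?subr_ge0//.
by rewrite (le_trans (ler_norm _))// lerDl.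
Qed.

Lemma abs_continuousW V (h : R -> V) a b a' b' : a <= a' -> b' <= b ->
  abs_continuous_on a b h -> abs_continuous_on a' b' h.
Proof.
move=> aa' bb' hac e /hac[d d0 dh]; exists d => // n x y xy; apply: dh => i.
have [ax [xyi yb]] := xy i; split; first exact: le_trans ax.
by split => //; exact: le_trans yb _.
Qed.

(** The family is unordered, so the induction removes the interval with the largest right end; the
    others then end before its left end, which becomes the new bound [c]. *)
Lemma sum_increments_le (M : R -> R) a b n (x y : 'I_n -> R) :
  a <= b -> (forall u v, a <= u -> u <= v -> v <= b -> M u <= M v) ->
  (forall i, a <= x i /\ x i <= y i /\ y i <= b) -> nonoverlapping x y ->
  \sum_(i < n) (M (y i) - M (x i)) <= M b - M a.
Proof.
move=> ab Mm xy nxy.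
suff H k (A : {set 'I_n}) c : (#|A| <= k)%N -> a <= c -> c <= b ->
    (forall i, i \in A -> y i <= c) ->
    \sum_(i in A) (M (y i) - M (x i)) <= M c - M a.
  have := H _ [set: 'I_n]%SET b (leqnn _) ab (lexx _).
  rewrite (eq_bigl xpredT) => [|i]; last by rewrite inE.
  by apply => i _; have [_ []] := xy i.
elim: k A c => [|k IH] A c Ak ac cb Ac.
  have /eqP : #|A| = 0%N by apply/eqP; rewrite -leqn0.
  by rewrite cards_eq0 => /eqP ->; rewrite big_set0 subr_ge0 Mm.
have [->|[i0 i0A]] := set_0Vmem A; first by rewrite big_set0 subr_ge0 Mm.
have [i iA imax] : exists2 i, i \in A & forall j, j \in A -> y j <= y i.
  by case: (arg_maxP y i0A) => i iA imax; exists i.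
have [ax [xyi yb]] := xy i.
rewrite (bigD1 i)//=.
(* The intervals reaching beyond [x i] are degenerate, by maximality of [y i]. *)
have -> : \sum_(j in A | j != i) (M (y j) - M (x j)) =
    \sum_(j in [set j in A | (j != i) && (y j <= x i)%R]%SET) (M (y j) - M (x j)).
  rewrite (bigID (fun j => y j <= x i))/= [X in _ + X]big1 ?addr0.
    by apply: eq_bigl => j; rewrite inE andbA.
  move=> j /andP[/andP[jA ji]]; have [->//|yx _] := nxy _ _ ji.
  have [_ [xj _]] := xy j.
  have -> : y j = x j by apply/eqP; rewrite eq_le xj (le_trans (imax j jA)).
  by rewrite subrr.
have := IH [set j in A | (j != i) && (y j <= x i)%R]%SET (x i).
have -> // : (#|[set j in A | (j != i) && (y j <= x i)%R]%SET| <= k)%N.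
  rewrite -ltnS (leq_trans _ Ak)//; apply: proper_card; apply/properP; split.
    by apply/fintype.subsetP => j; rewrite inE => /andP[].
  by exists i => //; rewrite inE eqxx andbF.
move=> /(_ isT ax (le_trans xyi yb)) {}IH.
have {}IH := IH (fun j => _); have := Mm _ _ (le_trans ax xyi) (Ac i iA) cb.
have : \sum_(j in [set j in A | (j != i) && (y j <= x i)%R]%SET) (M (y j) - M (x j))
    <= M (x i) - M a.
  by apply: IH => j; rewrite inE => /and3P[].
lra.
Qed.

(** Passes absolute continuity to a limit: over any nonoverlapping family the errors add up to at
    most the total increment of [M]. *)
Lemma abs_continuous_approx V (G : R -> V) a b : a <= b ->
  (forall e : R, 0 < e -> exists (F : R -> V) (M : R -> R),
    [/\ abs_continuous_on a b F,
        forall u v, a <= u -> u <= v -> v <= b -> M u <= M v, M b - M a <= e &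
        forall u v, a <= u -> u <= v -> v <= b ->
          `|G v - G u - (F v - F u)| <= M v - M u]) ->
  abs_continuous_on a b G.
Proof.
move=> ab GF e e0; have e2 : 0 < e / 2 by rewrite divr_gt0.
have [F [M [Fac Mm Mab FM]]] := GF _ e2.
have [d d0 dF] := Fac _ e2; exists d => // n x y xy nxy /(dF n x y xy nxy) Fs.
have Ms := sum_increments_le ab Mm xy nxy.
apply: (@le_lt_trans _ _ (\sum_(i < n) `|F (y i) - F (x i)| +
    \sum_(i < n) (M (y i) - M (x i)))); last by move: Fs Ms Mab; lra.
rewrite -big_split; apply: ler_sum => i _; have [ax [xyi yb]] := xy i.
rewrite -[G _ - _](subrK (F (y i) - F (x i))) (le_trans (ler_normD _ _))//.
by rewrite addrC lerD// FM.
Qed.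

End absolute_continuity.

Section locally_absolutely_continuous.
Variables (R : realType) (I : set R).

Lemma locally_abs_continuousB (V : normedModType R) (f g : R -> V) :
  locally_abs_continuous I f -> locally_abs_continuous I g ->
  locally_abs_continuous I (fun t => f t - g t).
Proof.
move=> [fac fd] [gac gd]; split=> [a b Ia Ib|].
  apply: (abs_continuous_dominated2 ltr01 _ (fac a b Ia Ib) (gac a b Ia Ib)).
  move=> x y _ _ _; rewrite mul1r opprD opprK addrACA.
  by rewrite (_ : - g y + g x = - (g y - g x)) ?ler_normB// opprB addrC.
apply: ae_onS2 fd gd => t _ /derivable_has_deriv ft /derivable_has_deriv gt.
exact: has_deriv_derivable (has_derivB ft gt).
Qed.

Let zmod_telescope (V : zmodType) (a b c p q r : V) :
  a - p - (q + r) = (a - b - c) + (c - q) + (b - p - r).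
Proof.
by rewrite subrKA -(addrA b) [in RHS](addrAC a) subrKA opprD addrACA.
Qed.

Lemma has_deriv_bcomp (U V W : normedModType R[i]) (S : R -> bop V W)
    (T : R -> bop U V) t S' T' :
  has_deriv S t S' -> has_deriv T t T' ->
  has_deriv (fun s => S s \bo T s) t (S' \bo T t + S t \bo T').
Proof.
move=> SS' TT' e e0.
(* The remainder splits into three terms. [K] bounds the sum of the factors [|T s|] (for |h| at most
   1) and [|S t|] of the two linearization errors; [L] bounds the coefficient of the quadratic term
   [h S' (T s - T t)]. *)
pose K := `|T t| + `|T'| + 1 + `|S t|.
have K0 : 0 < K by rewrite /K ltr_pwDl// ltr_pwDr// addr_ge0.
pose L := `|S'| * (`|T'| + 1) + 1.
have L0 : 0 < L by rewrite /L ltr_pwDr// mulr_ge0// addr_ge0.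
have [d1 d10 dS] := SS' _ (divr_gt0 (divr_gt0 e0 (ltr0Sn _ 1)) K0).
have [d2 d20 dT] := TT' _ (divr_gt0 (divr_gt0 e0 (ltr0Sn _ 1)) K0).
have [d3 d30 bT] := has_deriv_bound TT'.
pose d4 := e / 2 / L; have d40 : 0 < d4 by rewrite !divr_gt0.
exists (Num.min (Num.min d1 d2) (Num.min d3 (Num.min 1 d4))).
  by rewrite !lt_min d10 d20 d30 d40 ltr01.
move=> s; rewrite !lt_min => /andP[/andP[sd1 sd2] /andP[sd3 /andP[s1 s4]]].
have DS := dS s sd1; have DT := dT s sd2; have BT := bT s sd3.
set h := s - t in DS DT BT s1 s4 *.
have -> : S s \bo T s - S t \bo T t - h *: (S' \bo T t + S t \bo T') =
    (S s - S t - h *: S') \bo T s + (h *: S') \bo (T s - T t) +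
    S t \bo (T s - T t - h *: T').
  rewrite scalerDr -bcompZl -bcompZr
    !(bcompBl, bcompBr).
  exact: zmod_telescope.
have h1 : `|h| <= 1 by exact: ltW.
have Ts : `|T s| <= `|T t| + `|T'| + 1.
  rewrite -[T s](subrK (T t)) (le_trans (ler_normD _ _))// addrC -addrA lerD//.
  by rewrite (le_trans BT)// ler_piMr// addr_ge0.
have X1 : `|(S s - S t - h *: S') \bo T s| <= e / 2 / K * `|h| * (`|T t| + `|T'| + 1).
  by rewrite (le_trans (bcomp_norm _ _))// ler_pM.
have X2 : `|(h *: S') \bo (T s - T t)| <= `|h| * (e / 2).
  rewrite bcompZl normrZ ler_wpM2l// (le_trans (bcomp_norm _ _))//.
  rewrite (@le_trans _ _ (L * `|h|))//; last first.
    by rewrite mulrC -ler_pdivlMr// ltW.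
  rewrite (@le_trans _ _ (`|S'| * ((`|T'| + 1) * `|h|)))//; first by rewrite ler_wpM2l.
  by rewrite mulrA ler_wpM2r// lerDl.
have X3 : `|S t \bo (T s - T t - h *: T')| <= e / 2 / K * `|h| * `|S t|.
  by rewrite (le_trans (bcomp_norm _ _))// mulrC ler_wpM2r.
rewrite (le_trans (ler_normD _ _))// (le_trans (lerD (ler_normD _ _) (lexx _)))//.
have -> : e * `|h| = e / 2 / K * `|h| * K + `|h| * (e / 2).
  by field; rewrite gt_eqF.
have -> : e / 2 / K * `|h| * K = e / 2 / K * `|h| * (`|T t| + `|T'| + 1) +
    e / 2 / K * `|h| * `|S t| by rewrite -mulrDr.
by move: X1 X2 X3; lra.
Qed.

Lemma locally_abs_continuous_bcomp (U V W : normedModType R[i])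
    (S : R -> bop V W) (T : R -> bop U V) :
  locally_abs_continuous I S -> locally_abs_continuous I T ->
  locally_abs_continuous I (fun t => S t \bo T t).
Proof.
move=> [Sac Sd] [Tac Td]; split=> [a b Ia Ib|]; last first.
  apply: ae_onS2 Sd Td => t _ /derivable_has_deriv St /derivable_has_deriv Tt.
  exact: has_deriv_derivable (has_deriv_bcomp St Tt).
have [ab|ba] := leP a b; last first.
  move=> e e0; exists 1 => // n x y xy _ _; rewrite big1// => i _.
  have [ax [xyi yb]] := xy i.
  by have := lt_le_trans ba (le_trans ax (le_trans xyi yb)); rewrite ltxx.
have [C C0 SC] := unif_continuous_bounded ab (abs_continuous_uniform (Sac a b Ia Ib)).
have [K K0 TK] := unif_continuous_bounded ab (abs_continuous_uniform (Tac a b Ia Ib)).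
have CK : 0 < C + K + 1 by rewrite ltr_wpDl// addr_ge0// ltW.
apply: (abs_continuous_dominated2 CK _ (Sac a b Ia Ib) (Tac a b Ia Ib)).
move=> x y ax xy yb.
have -> : S y \bo T y - S x \bo T x = (S y - S x) \bo T y + S x \bo (T y - T x).
  by rewrite bcompBl bcompBr subrKA.
rewrite (le_trans (ler_normD _ _))// mulrDr lerD//.
  rewrite (le_trans (bcomp_norm _ _))// mulrC ler_wpM2r//.
  by rewrite (le_trans (TK _ (le_trans ax xy) yb))//; lra.
rewrite (le_trans (bcomp_norm _ _))// ler_wpM2r//.
by rewrite (le_trans (SC _ ax (le_trans xy yb)))//; lra.
Qed.

End locally_absolutely_continuous.

(** * Primitives of Bochner integrable functions *)

Section simple_functions.
Variable R : realType.
Implicit Types V W : normedModType R.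

Lemma simple_preimage V (f : R -> V) (A : set V) :
  simple_function f -> measurable (f @^-1` A).
Proof.
move=> [ff mf].
have -> : f @^-1` A = \bigcup_(v in range f `&` A) f @^-1` [set v].
  apply/seteqP; split => [t /= At|t [v [_ Av] /= ->]]; last exact: Av.
  by exists (f t) => //; split => //; exists t.
by apply: fin_bigcup_measurable => [|v _]; [exact: finite_setIl|exact: mf].
Qed.

Lemma simple_function2 V W (X : normedModType R) (f : R -> V) (g : R -> W)
    (h : V -> W -> X) :
  simple_function f -> simple_function g ->
  @simple_function R X (fun t => h (f t) (g t)).
Proof.
move=> [ff mf] [fg mg]; split.
  apply: sub_finite_set (finite_image (fun p => h p.1 p.2) (finite_setX ff fg)).
  by move=> _ [t _ <-]; exists (f t, g t) => //; split; exists t.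
move=> v.
have -> : (fun t => h (f t) (g t)) @^-1` [set v] =
    \bigcup_(p in (range f `*` range g) `&` [set p | h p.1 p.2 = v])
      (f @^-1` [set p.1] `&` g @^-1` [set p.2]).
  apply/seteqP; split => [t /= hv|t [[p q] [_ /= hv] [/= -> ->]]//].
  by exists (f t, g t) => //; split => //; split; exists t.
apply: fin_bigcup_measurable => [|p _]; last exact: measurableI.
by apply: finite_setIl; exact: finite_setX.
Qed.

Lemma simple_cst V (c : V) : simple_function (fun _ : R => c).
Proof.
split; first by apply: sub_finite_set (finite_set1 c) => _ [t _ <-].
by move=> v; rewrite preimage_cst; case: ifP.
Qed.

Lemma simple_restrict V (f : R -> V) (J : set R) : measurable J ->
  simple_function f -> simple_function (fun t => (\1_J t : R) *: f t).
Proof.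
move=> mJ sf; apply: (@simple_function2 R V V \1_J f (fun r v => r *: v)) => //.
split; last first.
  by move=> r; rewrite -[X in measurable X]setTI; exact: measurable_indic.
apply: sub_finite_set (finite_set2 (0 : R) 1) => _ [t _ <-].
by rewrite indicE; case: (t \in J); [right|left].
Qed.

Lemma simple_measurable V (f : R -> V) (h : V -> R) :
  simple_function f -> measurable_fun setT (fun t => h (f t)).
Proof.
by move=> sf _ Y mY; rewrite setTI; exact: (simple_preimage (h @^-1` Y)).
Qed.

Lemma simple_range V (f : R -> V) : simple_function f ->
  exists s : seq V, uniq s /\ forall t, f t \in s.
Proof.
move=> [/finite_seqP[s sE] _]; exists (undup s); rewrite undup_uniq; split=> // t.
have : [set` s] (f t) by rewrite -sE; exists t.
by rewrite /= mem_undup.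
Qed.

End simple_functions.

Section real_primitive.
Variable R : realType.
Local Notation mu := (@lebesgue_measure R).

(** To be applied with [g] the norm of a strongly measurable function, which need not be Borel; the
    integral as a supremum over simple functions is monotone all the same. *)
Lemma ge0_le_integralW (D : set R) (f g : R -> R) :
  (forall t, D t -> 0 <= f t) -> (forall t, D t -> f t <= g t) ->
  (\int[mu]_(t in D) (f t)%:E <= \int[mu]_(t in D) (g t)%:E)%E.
Proof.
move=> f0 fg; have g0 t : D t -> 0 <= g t.
  by move=> Dt; exact: le_trans (f0 t Dt) (fg t Dt).
rewrite !ge0_integralE; last 2 first.
- by move=> t Dt; rewrite lee_fin g0.
- by move=> t Dt; rewrite lee_fin f0.
apply: ereal_sup_le => _ [h hf <-]; exists h => //.
move=> t; apply: le_trans (hf t) _; rewrite !patchE; case: ifPn => // /set_mem Dt.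
by rewrite lee_fin fg.
Qed.

(** Starting at [-oo] makes every increment an integral over []x, y]], with no sign convention. *)
Definition primitive (g : R -> R) (t : R) : R :=
  \int[mu]_(s in `]-oo, t]) g s.

Section props.
Variable g : R -> R.
Hypothesis g0 : forall t, 0 <= g t.
Hypothesis gi : mu.-integrable setT (EFin \o g).

Let gS (A : set R) : measurable A -> mu.-integrable A (EFin \o g).
Proof. by move=> mA; exact: integrableS gi. Qed.

Lemma primitive_increment x y : x <= y ->
  primitive g y - primitive g x = \int[mu]_(s in `]x, y]) g s.
Proof.
by move=> xy; rewrite /primitive Rintegral_itvB ?bnd_simp//; exact: gS.
Qed.

Lemma primitive_nondecreasing x y : x <= y -> primitive g x <= primitive g y.
Proof.
by move=> xy; rewrite -subr_ge0 primitive_increment//; exact: Rintegral_ge0.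
Qed.

Lemma primitive_lipschitz x y : (forall t, g t <= 1) -> x <= y ->
  `|primitive g y - primitive g x| <= y - x.
Proof.
move=> g1 xy; rewrite ger0_norm ?subr_ge0 ?primitive_nondecreasing//.
rewrite primitive_increment//.
have -> : y - x = \int[mu]_(s in `]x, y]) 1.
  rewrite Rintegral_cst// mul1r.
  by rewrite -[LHS]/(fine (y - x)%:E) -(lebesgue_measure_itvoc xy).
apply: le_Rintegral => //; first exact: gS.
apply/integrableP; split; first exact: measurable_cst.
under eq_integral => t _ do rewrite /= normr1.
rewrite integral_cst// mul1e.
by rewrite [X in (X < _)%E](lebesgue_measure_itvoc xy) ltry.
Qed.

Lemma primitive_deriv : measurable_fun setT g ->
  ae_on setT (fun t => has_deriv (primitive g) t (g t)).
Proof.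
move=> mg; have locg : locally_integrable setT g.
  by have := integrable_locally measurableT gi; rewrite patch_setT.
have := FTC1Ny (fun y => gS (measurable_itv _)) locg.
rewrite /ae_on; apply: filterS; first exact: (ae_filter_ringOfSetsType mu).
by move=> t [dt <-] _; exact: derivable_has_deriv dt.
Qed.

Lemma primitive_total a b : a <= b ->
  primitive g b - primitive g a <= \int[mu]_(s in `[a, b]) g s.
Proof.
move=> ab; rewrite primitive_increment//.
rewrite -Rintegral_itv_obnd_cbnd//; exact: gS.
Qed.

End props.

End real_primitive.

Section ae_intervals.
Variable R : realType.
Local Notation mu := (@lebesgue_measure R).

Lemma negligible_point (x : R) : mu.-negligible [set x].
Proof. by apply/negligibleP => //; exact: lebesgue_measure_set1. Qed.

Lemma ae_on_neq (I : set R) (x : R) : ae_on I (fun t => t != x).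
Proof.
apply: negligibleS (negligible_point x) => t /= /not_implyP[_ /negP].
by rewrite negbK => /eqP.
Qed.

Lemma negligible_subsingleton (A : set R) :
  (forall x y, A x -> A y -> x = y) -> mu.-negligible A.
Proof.
move=> As; have [[x Ax]|nA] := pselect (exists x, A x).
  by apply: negligibleS (negligible_point x) => y Ay; exact: As.
by apply: negligibleS (negligible_set0 _) => y Ay; apply: nA; exists y.
Qed.

(** Countably many intervals with rational end points in [I] cover [I] except for its possible
    minimum and maximum, which are two null sets. *)
Lemma ae_on_itv (I : set R) (P : R -> Prop) : is_interval I ->
  (forall a b, I a -> I b -> ae_on `[a, b] P) -> ae_on I P.
Proof.
move=> Ii IP.
pose N (n : nat) : set R := if unpickle n is Some (p, q) then
  [set t | [/\ I (ratr p), I (ratr q), ratr p <= t, t <= ratr q & ~ P t]] else set0.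
have N0 : mu.-negligible (\bigcup_n N n).
  apply: negligible_bigcup => n; rewrite /N.
  case: (unpickle n) => [[p q]|]; last exact: negligible_set0.
  have [Ip|Ip] := pselect (I (ratr p)); last first.
    by apply: negligibleS (negligible_set0 _) => t [].
  have [Iq|Iq] := pselect (I (ratr q)); last first.
    by apply: negligibleS (negligible_set0 _) => t [].
  apply: negligibleS (IP _ _ Ip Iq) => t /= [_ _ pt tq Pt] /(_ _)Pt'.
  by apply: Pt; apply: Pt'; rewrite in_itv/= pt tq.
have L0 : mu.-negligible [set t | I t /\ forall s, I s -> t <= s].
  apply: negligible_subsingleton => x y [Ix xm] [Iy ym].
  by apply/eqP; rewrite eq_le xm// ym.
have U0 : mu.-negligible [set t | I t /\ forall s, I s -> s <= t].
  apply: negligible_subsingleton => x y [Ix xm] [Iy ym].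
  by apply/eqP; rewrite eq_le ym// xm.
apply: negligibleS (negligibleU N0 (negligibleU L0 U0)) => t /=.
move=> /not_implyP[It Pt].
have [Lt|/existsNP[x /not_implyP[Ix /negP]]] := pselect (forall s, I s -> t <= s).
  by right; left.
rewrite -ltNge => xt.
have [Ut|/existsNP[y /not_implyP[Iy /negP]]] := pselect (forall s, I s -> s <= t).
  by right; right.
rewrite -ltNge => ty; left.
have [p] := rat_in_itvoo xt; rewrite in_itv/= => /andP[xp pt].
have [q] := rat_in_itvoo ty; rewrite in_itv/= => /andP[tq qy].
exists (pickle (p, q)); first exact: Logic.I.
rewrite /N pickleK; split; [| |exact: ltW|exact: ltW|by []].
- by apply: (Ii x t) => //; rewrite (ltW xp) (ltW pt).
- by apply: (Ii t y) => //; rewrite (ltW tq) (ltW qy).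
Qed.

End ae_intervals.

Section more_derivatives.
Variables (R : realType) (V : normedModType R).

Lemma has_derivZ (M : R -> R) t (l : R) (v : V) : has_deriv M t l ->
  has_deriv (fun s => M s *: v) t (l *: v).
Proof.
move=> Ml e e0; have v0 : 0 < `|v| + 1 by rewrite ltr_wpDl.
have [d d0 dM] := Ml _ (divr_gt0 e0 v0); exists d => // s /dM H.
rewrite scalerA -!scalerBl normrZ (le_trans (ler_wpM2r (normr_ge0 _) H))//.
rewrite mulrAC ler_wpM2r// mulrAC ler_pdivrMr// ler_pM2l//.
by rewrite lerDl.
Qed.

(** Write [phi] as a sum of indicators of level sets times values. The bounded support makes the
    indicators integrable, and their primitives are 1-Lipschitz. *)
Lemma simple_primitive (phi : R -> V) (K : R) : simple_function phi ->
  (forall t, ~ `[- K, K]%classic t -> phi t = 0) ->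
  exists (G : R -> V) (C : R),
    (forall x y, x <= y -> `|G y - G x| <= C * (y - x)) /\
    ae_on setT (fun t => has_deriv G t (phi t)).
Proof.
move=> sphi phi0; have [s [us sP]] := simple_range sphi.
pose S v : set R := phi @^-1` [set v] `&` `[- K, K].
have mS v : measurable (S v).
  by apply: measurableI => //; exact: simple_preimage.
have iS v : (@lebesgue_measure R).-integrable setT (EFin \o \1_(S v)).
  apply: le_integrable (integrable_indic_itv (- K) K true false) => //.
    by apply/measurable_EFinP; apply: measurable_indic; exact: mS.
  move=> t _ /=; rewrite lee_fin !indicE !normr_nat ler_nat.
  by case: (boolP (t \in S v)) => // /set_mem[_ tK]; rewrite mem_set.
have S0 v t : 0 <= \1_(S v) t :> R by rewrite indicE.
have S1 v t : \1_(S v) t <= 1 :> R by rewrite indicE; case: (_ \in _).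
have phiE t : phi t = \sum_(v <- s) (\1_(S v) t : R) *: v.
  have [tK|tK] := pselect (`[- K, K]%classic t); last first.
    rewrite phi0// big1// => v _; rewrite indicE memNset ?scale0r//.
    by move=> [].
  rewrite (bigD1_seq (phi t))//= big1 ?addr0.
    by rewrite indicE mem_set ?scale1r.
  by move=> v vt; rewrite indicE memNset ?scale0r// => -[/= tv _]; rewrite tv eqxx in vt.
have -> : phi = fun t => \sum_(v <- s) (\1_(S v) t : R) *: v by exact/funext.
(* Forgetting that [s] enumerates the values of [phi] permits induction on [s]. *)
move: {us sP phiE}s => s.
exists (fun t => \sum_(v <- s) primitive \1_(S v) t *: v), (\sum_(v <- s) `|v|).
elim: s => [|v s [IHl IHd]]; split.
- by move=> x y _; rewrite !big_nil subrr normr0 mul0r.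
- apply: ae_on_all => t _; under eq_fun do rewrite big_nil.
  by rewrite big_nil; exact: has_deriv_cst.
- move=> x y xy; rewrite !big_cons opprD addrACA -scalerBl.
  rewrite (le_trans (ler_normD _ _))// mulrDl lerD ?IHl// normrZ mulrC ler_wpM2l//.
  exact: primitive_lipschitz.
- apply: ae_onS2 IHd (primitive_deriv (iS v) _).
    move=> t _ IH /(has_derivZ v) dv; under eq_fun do rewrite big_cons.
    by rewrite big_cons; exact: has_derivD.
  exact: measurable_indic.
Qed.

Lemma abs_continuous_on_gt (F : R -> V) a b : b < a -> abs_continuous_on a b F.
Proof.
move=> ba e e0; exists 1 => // n x y xy _ _; rewrite big1// => i _.
have [ax [xyi yb]] := xy i.
by have := lt_le_trans ba (le_trans ax (le_trans xyi yb)); rewrite ltxx.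
Qed.

End more_derivatives.

(** * Limits of primitives *)

Section limit_primitive.
Variables (R : realType) (V : completeNormedModType R).
Variables (I : set R) (F : R -> V) (phi G : nat -> R -> V) (t0 : R).
Hypothesis Ii : is_interval I.
Hypothesis It0 : I t0.
Hypothesis Gac : forall n a b, abs_continuous_on a b (G n).
Hypothesis Gd : forall n, ae_on I (fun t => has_deriv (G n) t (phi n t)).
Hypothesis phiF : ae_on I (fun t => forall e : R, 0 < e ->
  exists N, forall n, (N <= n)%N -> `|F t - phi n t| <= e).
Hypothesis mF : forall a b, I a -> I b -> a <= b -> exists m : nat -> R -> R,
  [/\ forall n x y, x <= y -> m n x <= m n y,
      forall n, ae_on `[a, b] (fun t => has_deriv (m n) t `|F t - phi n t|) &
      forall e : R, 0 < e -> exists N, forall n, (N <= n)%N -> m n b - m n a <= e].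

Let sub_itv a b : I a -> I b -> `[a, b]%classic `<=` I.
Proof. by move=> Ia Ib t; rewrite /= in_itv/=; exact: Ii. Qed.

Let distrC2 (a b c d : V) : `|a - b - (c - d)| = `|b - a - (d - c)|.
Proof. by rewrite -(opprB b a) -(opprB d c) -opprD normrN. Qed.

Let zmod4 (a b c d e : V) : a - b - e = (a - c) - (b - d) + (c - d - e).
Proof.
have -> : (a - c) - (b - d) = (a - b) - (c - d).
  by rewrite !opprD !opprK addrACA.
by rewrite subrKA.
Qed.

(** The mean value inequality for [G k - G n], whose derivative is compared with [m k + m n] by
    passing through [F]. *)
Let approx_increment a b (m : nat -> R -> R) : I a -> I b ->
  (forall n x y, x <= y -> m n x <= m n y) ->
  (forall n, ae_on `[a, b] (fun t => has_deriv (m n) t `|F t - phi n t|)) ->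
  forall k n x y, a <= x -> x <= y -> y <= b ->
  `|G k y - G k x - (G n y - G n x)| <= (m k y - m k x) + (m n y - m n x).
Proof.
move=> Ia Ib mm md k n x y ax xy yb.
have -> : G k y - G k x - (G n y - G n x) = (G k y - G n y) - (G k x - G n x).
  by rewrite !opprD !opprK addrACA.
have -> : m k y - m k x + (m n y - m n x) = (m k y + m n y) - (m k x + m n x).
  by ring.
apply: (@mean_value_ae _ _ (fun t => G k t - G n t) (fun t => m k t + m n t)) => //.
- apply: (abs_continuous_dominated2 ltr01 _ (@Gac k x y) (@Gac n x y)).
  move=> u v _ _ _; rewrite mul1r opprD opprK addrACA.
  by rewrite (_ : - G n v + G n u = - (G n v - G n u)) ?ler_normB// opprB addrC.
- by move=> u v _ uv _; rewrite lerD ?mm.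
- have xyab : `[x, y]%classic `<=` `[a, b]%classic.
    by move=> t; rewrite /= !in_itv/= => /andP[xt ty]; rewrite (le_trans ax) ?(le_trans ty).
  have xyI := subset_trans xyab (sub_itv Ia Ib).
  apply: ae_onS2 (ae_onS2 _ (ae_on_sub xyI (Gd k)) (ae_on_sub xyI (Gd n)))
    (ae_onS2 _ (ae_on_sub xyab (md k)) (ae_on_sub xyab (md n))).
  + move=> t _ GG mmt; exists (phi k t - phi n t), (`|F t - phi k t| + `|F t - phi n t|).
    split; [exact: GG|exact: mmt|].
    by rewrite (distrC (F t)) ler_distD.
  + by move=> t _; exact: has_derivB.
  + by move=> t _; exact: has_derivD.
Qed.

Let increment_cvg t : I t -> cvg ((G k t - G k t0) @[k --> \oo]).
Proof.
move=> It; apply: cauchy_seq_cvg => e e0.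
have key a b : I a -> I b -> a <= b -> exists N, forall k n, (N <= k)%N -> (N <= n)%N ->
    `|G k b - G k a - (G n b - G n a)| <= e.
  move=> Ia Ib ab; have [m [mm md m0]] := mF Ia Ib ab.
  have [N mN] := m0 _ (divr_gt0 e0 (ltr0Sn _ 1)).
  exists N => k n Nk Nn; rewrite (le_trans (approx_increment Ia Ib mm md _ _ _ ab _))//.
  by rewrite [leRHS]splitr lerD ?mN.
have [tt|/ltW tt] := leP t0 t; first exact: key.
have [N NG] := key t t0 It It0 tt; exists N => k n Nk Nn.
by rewrite distrC2 NG.
Qed.

Let H t := lim ((G k t - G k t0) @[k --> \oo]).

Let increment_le a b (m : nat -> R -> R) : I a -> I b ->
  (forall n x y, x <= y -> m n x <= m n y) ->
  (forall n, ae_on `[a, b] (fun t => has_deriv (m n) t `|F t - phi n t|)) ->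
  (forall e : R, 0 < e -> exists N, forall n, (N <= n)%N -> m n b - m n a <= e) ->
  forall n x y, a <= x -> x <= y -> y <= b ->
  `|H y - H x - (G n y - G n x)| <= m n y - m n x.
Proof.
move=> Ia Ib mm md m0 n x y ax xy yb; apply/ler_addgt0Pl => e e0.
have Ix : I x by apply: sub_itv Ia Ib _ _; rewrite /= in_itv/= ax (le_trans xy).
have Iy : I y by apply: sub_itv Ia Ib _ _; rewrite /= in_itv/= yb (le_trans ax).
have /cvgrPdist_le/(_ (e / 3)) [|N1 _ N1H] := increment_cvg Ix; first by rewrite divr_gt0.
have /cvgrPdist_le/(_ (e / 3)) [|N2 _ N2H] := increment_cvg Iy; first by rewrite divr_gt0.
have [|N3 mN3] := m0 (e / 3); first by rewrite divr_gt0.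
pose k := maxn N1 (maxn N2 N3).
have := N1H k (leq_maxl _ _); rewrite /= -/(H x) => Hx.
have := N2H k _; rewrite /= -/(H y) => /(_ _)Hy.
have {}Hy : `|H y - (G k y - G k t0)| <= e / 3.
  by apply: Hy; rewrite /k leq_max leq_maxl orbT.
have km : m k b - m k a <= e / 3 by apply: mN3; rewrite /k !leq_max leqnn !orbT.
have -> : H y - H x - (G n y - G n x) = (H y - (G k y - G k t0)) -
   (H x - (G k x - G k t0)) + (G k y - G k x - (G n y - G n x)).
  have -> : G k y - G k x = (G k y - G k t0) - (G k x - G k t0).
    by rewrite opprB subrKA.
  exact: zmod4.
rewrite (le_trans (ler_normD _ _))//.
have := approx_increment Ia Ib mm md k n ax xy yb.
have := ler_normB (H y - (G k y - G k t0)) (H x - (G k x - G k t0)).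
have := mm k _ _ ax; have := mm k _ _ yb.
by move: Hx Hy km; lra.
Qed.

(** Differentiability of the limit at [t] needs only one index n: the increments of [H] and [G n]
    differ by at most those of [m n], whose derivative [|F t - phi n t|] is small. *)
Lemma limit_primitive : exists G0 : R -> V, [/\ locally_abs_continuous I G0,
  G0 t0 = 0 & ae_on I (fun t => has_deriv G0 t (F t))].
Proof.
have Hd : ae_on I (fun t => has_deriv H t (F t)).
  apply: ae_on_itv => // a b Ia Ib.
  have [ab|ba] := leP a b; last first.
    by apply: ae_on_all => t; rewrite /= in_itv/= => /andP[/le_trans h /h]; rewrite leNgt ba.
  have [m [mm md m0]] := mF Ia Ib ab.
  have HG := increment_le Ia Ib mm md m0.
  have abI := sub_itv Ia Ib.
  apply: (ae_onS2 _ (ae_onS2 (fun t _ => @conj _ _) (ae_on_sub abI phiF)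
    (ae_on_foralln (fun n => ae_onS2 (fun t _ => @conj _ _) (ae_on_sub abI (Gd n)) (md n))))
    (ae_onS2 (fun t _ => @conj _ _) (ae_on_neq `[a, b] a) (ae_on_neq `[a, b] b))).
  move=> t; rewrite /= in_itv/= => /andP[a_t tb] [Ft GMt] [ta tb'].
  have {ta}a_t : a < t by rewrite lt_neqAle eq_sym ta.
  have {tb'}tb : t < b by rewrite lt_neqAle tb'.
  (* The increment of [m n] accounts for [e / 2]; the linearization of [G n] and the distance of
     [phi n t] from [F t] account for [e / 4] each. *)
  move=> e e0; have e4 : 0 < e / 4 by rewrite divr_gt0.
  have [n nF] := Ft _ e4; have {}nF := nF n (leqnn n).
  have [Gn mn] := GMt n.
  have [d1 d10 dG] := Gn _ e4; have [d2 d20 dm] := mn _ e4.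
  exists (Num.min (Num.min d1 d2) (Num.min (t - a) (b - t))).
    by rewrite !lt_min d10 d20 !subr_gt0 a_t.
  move=> s; rewrite !lt_min => /andP[/andP[/dG Gs /dm ms] /andP[sa sb]].
  have as' : a <= s.
    by move: sa; rewrite ltr_norml => /andP[+ _]; lra.
  have sb' : s <= b.
    by move: sb; rewrite ltr_norml => /andP[_]; lra.
  set h := s - t in Gs ms sa sb *.
  have Hm : `|H s - H t - (G n s - G n t)| <= `|m n s - m n t|.
    have [ts|/ltW st] := leP t s.
      by rewrite (le_trans (HG n t s (ltW a_t) ts sb'))// ler_norm.
    rewrite (distrC (m n s)) (le_trans _ (ler_norm _))//.
    by rewrite distrC2 HG// ltW.
  have ms' : `|m n s - m n t| <= e / 2 * `|h|.
    rewrite -(subrK (h *: `|F t - phi n t|) (m n s - m n t)).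
    rewrite (le_trans (ler_normD _ _))//.
    have : `|h *: `|F t - phi n t| | <= e / 4 * `|h|.
      by rewrite normrZ normr_id mulrC ler_wpM2r.
    by move: ms; lra.
  have -> : H s - H t - h *: F t = (H s - H t - (G n s - G n t)) +
     (G n s - G n t - h *: phi n t) - h *: (F t - phi n t).
    by rewrite scalerBr subrKA opprB subrKA.
  rewrite (le_trans (ler_normB _ _))//.
  have : `|h *: (F t - phi n t)| <= e / 4 * `|h|.
    by rewrite normrZ mulrC ler_wpM2r.
  have := ler_normD (H s - H t - (G n s - G n t)) (G n s - G n t - h *: phi n t).
  by move: Gs ms' Hm; lra.
exists H; split => //; last first.
  by rewrite /H; under eq_fun do rewrite subrr; exact: lim_cst.
split; last by apply: ae_onS Hd => t _; exact: has_deriv_derivable.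
move=> a b Ia Ib; have [ab|ba] := leP a b; last exact: abs_continuous_on_gt.
have [m [mm md m0]] := mF Ia Ib ab.
apply: abs_continuous_approx => // e /m0[N mN].
exists (G N), (m N); split => //; [by move=> u v _ uv _; exact: mm|exact: mN|].
exact: (increment_le Ia Ib mm md m0).
Qed.

End limit_primitive.

(** * Existence of primitives of Bochner integrable functions *)

Section bochner.
Variables (R : realType) (V : completeNormedModType R) (I : set R).
Local Notation mu := (@lebesgue_measure R).
Hypothesis Ii : is_interval I.

(* Local Bochner integrability with a Borel majorant of the norm in place of the
   norm, which need not be Borel measurable. *)
Definition bochner (F : R -> V) : Prop :=
  strongly_measurable I F /\
  forall a b, I a -> I b -> exists g : R -> R,
    [/\ measurable_fun setT g, forall t, 0 <= g t,
        mu.-integrable `[a, b] (EFin \o g) & ae_on `[a, b] (fun t => `|F t| <= g t)].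

Lemma bochner_majorant (F : R -> V) a b : bochner F -> I a -> I b -> a <= b ->
  exists m : R -> R, (forall x y, x <= y -> m x <= m y) /\
    ae_on `[a, b] (fun t => exists2 l : R, has_deriv m t l & `|F t| <= l).
Proof.
move=> [_ Fg] Ia Ib ab; have [g [mg g0 gi Fle]] := Fg a b Ia Ib.
have gi' : mu.-integrable setT (EFin \o (g \_ `[a, b])).
  by move: gi; rewrite integrable_mkcond//= (restrict_EFin g).
have g0' t : 0 <= (g \_ `[a, b]) t by rewrite patchE; case: ifP.
have mg' : measurable_fun setT (g \_ `[a, b]).
  apply/(measurable_restrictT _ _).1 => //.
  exact: measurable_funTS mg.
exists (primitive (g \_ `[a, b])); split.
  by move=> x y; exact: primitive_nondecreasing.
have := ae_on_sub (@subsetT _ `[a, b]) (primitive_deriv gi' mg').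
apply: ae_onS2 Fle => t tab Ft gt; exists (g t) => //.
by move: gt; rewrite patchE mem_set.
Qed.

(** Setting everything to zero off [I] and on the exceptional set gives convergence everywhere, so
    that [|F0|] is Borel; the pointwise bound by [|F|] preserves finiteness of the integral. *)
Lemma strongly_measurable_regular (F : R -> V) : strongly_measurable I F ->
  exists (s : nat -> R -> V) (F0 : R -> V),
    [/\ forall n, simple_function (s n), forall t, s n t @[n --> \oo] --> F0 t,
        ae_on I (fun t => F t = F0 t) & forall t, `|F0 t| <= `|F t|].
Proof.
move=> [s ss /ae_on_null[N [mN N0 sF]]].
have mI : measurable I by exact: is_interval_measurable.
pose J := I `\` N; have mJ : measurable J by exact: measurableD.
exists (fun n t => (\1_J t : R) *: s n t), (fun t => (\1_J t : R) *: F t); split.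
- by move=> n; exact: simple_restrict.
- move=> t; rewrite indicE; case: (boolP (t \in J)) => [/set_mem[It Nt]|_].
    by under eq_fun do rewrite scale1r; rewrite scale1r; exact: sF.
  by under eq_fun do rewrite scale0r; rewrite scale0r; exact: cvg_cst.
- exists N; split => // t /= /not_implyP[It Ft]; apply: contrapT => Nt.
  by apply: Ft; rewrite indicE mem_set ?scale1r.
- move=> t; rewrite normrZ indicE; case: (t \in J).
    by rewrite normr1 mul1r.
  by rewrite normr0 mul0r.
Qed.

Lemma measurable_dist (s : nat -> R -> V) (F0 c : R -> V) :
  (forall n, simple_function (s n)) -> (forall t, s n t @[n --> \oo] --> F0 t) ->
  simple_function c -> measurable_fun setT (fun t => `|F0 t - c t|).
Proof.
move=> ss sF sc; apply/measurable_EFinP.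
apply: (emeasurable_fun_cvg (fun n t => `|s n t - c t|%:E)).
  move=> n; apply/measurable_EFinP.
  apply: (simple_measurable (f := fun t => s n t - c t) (fun v => `|v|)).
  exact: (@simple_function2 _ _ _ _ (s n) c (fun x y => x - y)).
move=> t _; apply: cvg_EFin; first by near=> n.
by apply: cvg_norm; apply: cvgB; [exact: sF|exact: cvg_cst].
Unshelve. all: by end_near. Qed.

Lemma locally_bochner_integrable_bochner (F : R -> V) :
  locally_bochner_integrable I F -> bochner F.
Proof.
move=> [mF iF]; split=> // a b Ia Ib.
have [s [F0 [ss sF FF0 F0F]]] := strongly_measurable_regular mF.
have mF0 : measurable_fun setT (fun t => `|F0 t|).
  have := measurable_dist ss sF (@simple_cst R V 0).
  by under eq_fun do rewrite subr0.
exists (fun t => `|F0 t|); split => //.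
- apply/integrableP; split.
    by apply/measurable_EFinP; exact: measurable_funTS mF0.
  apply: le_lt_trans (iF a b Ia Ib).
  under eq_integral do rewrite /= normr_id.
  exact: ge0_le_integralW.
- have abI : `[a, b]%classic `<=` I.
    by move=> t; rewrite /= in_itv/=; exact: Ii.
  by apply: ae_onS (ae_on_sub abI FF0) => t _ ->.
Qed.

Lemma bochner_primitive (F : R -> V) t0 : bochner F -> I t0 ->
  exists G : R -> V, [/\ locally_abs_continuous I G, G t0 = 0 &
    ae_on I (fun t => has_deriv G t (F t))].
Proof.
move=> [mF Fg] It0.
have [s [F0 [ss sF FF0 F0F]]] := strongly_measurable_regular mF.
have mF0 : measurable_fun setT (fun t => `|F0 t|).
  have := measurable_dist ss sF (@simple_cst R V 0).
  by under eq_fun do rewrite subr0.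
(* The truncation gives bounded support and the domination of [F0 - phi n] by [3 |F0|]. The factor 2
   leaves room for [s n t] to pass the test eventually when [F0 t] is nonzero; when it is zero,
   every [phi n t] vanishes. *)
pose J n : set R := `[- n%:R, n%:R] `&` [set t | `|s n t| <= 2 * `|F0 t|].
have mJ n : measurable (J n).
  apply: measurableI => //.
  have ms : measurable_fun setT (fun t => `|s n t|).
    exact: (simple_measurable (fun v : V => `|v|) (ss n)).
  have m2 : measurable_fun setT (fun t => 2 * `|F0 t|) by exact: measurable_funM.
  have := measurable_funB ms m2 measurableT (measurable_itv `]-oo, 0]).
  rewrite setTI; congr measurable; apply/seteqP; split => t /=.
    by rewrite in_itv/= subr_le0.
  by rewrite in_itv/= subr_le0.
pose phi n t := (\1_(J n) t : R) *: s n t.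
have sphi n : simple_function (phi n) by exact: simple_restrict.
have phi2 n t : `|phi n t| <= 2 * `|F0 t|.
  rewrite /phi normrZ indicE; case: (boolP (t \in J n)) => [/set_mem[_ /= h]|_].
    by rewrite normr1 mul1r.
  by rewrite normr0 mul0r mulr_ge0.
have phiF0 t (e : R) : 0 < e ->
    exists N, forall n, (N <= n)%N -> `|F0 t - phi n t| <= e.
  move=> e0; have [F00|F00] := eqVneq (F0 t) 0.
    exists 0%N => n _; have := phi2 n t; rewrite F00 normr0 mulr0 normr_le0.
    by move=> /eqP ->; rewrite subrr normr0 ltW.
  have Fp : 0 < `|F0 t| by rewrite normr_gt0.
  have /cvgrPdist_le/(_ _ e0)[N1 _ N1s] := sF t.
  have /cvgrPdist_le/(_ _ Fp)[N2 _ N2s] := sF t.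
  exists (maxn (maxn N1 N2) (Num.bound `|t|)) => n.
  rewrite !geq_max => /andP[/andP[n1 n2] n3].
  rewrite /phi indicE mem_set ?scale1r; first exact: N1s.
  split=> /=.
    rewrite in_itv/= -ler_norml ltW// (lt_le_trans (archi_boundP _))//.
    by rewrite ler_nat.
  have := N2s n n2; rewrite /= => h.
  have := lerB_dist (s n t) (F0 t); rewrite distrC.
  by move: h; lra.
have /choice[G /choice[C GC]] n : exists (G : R -> V) (C : R),
    (forall x y, x <= y -> `|G y - G x| <= C * (y - x)) /\
    ae_on setT (fun t => has_deriv G t (phi n t)).
  apply: (simple_primitive (K := n%:R) (sphi n)) => t tn.
  by rewrite /phi indicE memNset ?scale0r// => -[].
apply: (limit_primitive (G := G) (phi := phi)) => //.
- by move=> n a b; apply: abs_continuous_lipschitz; exact: (GC n).1.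
- by move=> n; apply: ae_on_sub (GC n).2.
- by apply: ae_onS FF0 => t _ ->; exact: phiF0.
move=> a b Ia Ib ab; have [g [mg g0 gi Fle]] := Fg a b Ia Ib.
have abI : `[a, b]%classic `<=` I.
  by move=> t; rewrite /= in_itv/=; exact: Ii.
pose h n t := `|F0 t - phi n t|.
have mh n : measurable_fun setT (h n) by exact: measurable_dist ss sF (sphi n).
have F0i : mu.-integrable `[a, b] (EFin \o (fun t => 3 * `|F0 t|)).
  have m3 : measurable_fun setT (fun t => 3 * `|F0 t|) by exact: measurable_funM.
  apply/integrableP; split; first by apply/measurable_EFinP; exact: measurable_funTS m3.
  have /integrableP[mg3 gfin] : mu.-integrable `[a, b] (fun t => (3%:E * (g t)%:E)%E).
    exact: integrableZl.
  apply: le_lt_trans gfin; apply: ae_ge0_le_integral => //.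
  - by apply/measurable_EFinP/measurableT_comp => //; exact: measurable_funTS m3.
  - exact: measurableT_comp.
  - apply: (@filterS _ _ (ae_filter_ringOfSetsType mu) _ _ _
      (ae_onS2 (fun t _ => @conj _ _) (ae_on_sub abI FF0) Fle)).
    move=> t FFt /FFt[FE Ft].
    by rewrite /= -FE lee_fin !normrM normr_id ler_wpM2l// ger0_norm.
have hF0 n t : h n t <= 3 * `|F0 t|.
  by have := phi2 n t; have := ler_normB (F0 t) (phi n t); rewrite /h; lra.
have hi n : mu.-integrable `[a, b] (EFin \o h n).
  apply: le_integrable F0i => //.
    by apply/measurable_EFinP; exact: measurable_funTS (mh n).
  by move=> t _ /=; rewrite lee_fin normr_id ger0_norm ?mulr_ge0//; exact: hF0.
have hi' n : mu.-integrable setT (EFin \o (h n \_ `[a, b])).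
  by have := hi n; rewrite integrable_mkcond//= (restrict_EFin (h n)).
have h0' n t : 0 <= (h n \_ `[a, b]) t by rewrite patchE; case: ifP => // _; exact: normr_ge0.
have mh' n : measurable_fun setT (h n \_ `[a, b]).
  apply/(measurable_restrictT _ _).1 => //; exact: measurable_funTS (mh n).
exists (fun n => primitive (h n \_ `[a, b])); split.
- by move=> n x y; exact: primitive_nondecreasing.
- move=> n; have := ae_on_sub (@subsetT _ `[a, b]) (primitive_deriv (hi' n) (mh' n)).
  by apply: ae_onS2 (ae_on_sub abI FF0) => t tab ->; rewrite patchE mem_set.
have h0 : (\int[mu]_(t in `[a, b]) (h n t)%:E)%E @[n --> \oo] --> 0%E.
  rewrite -(integral0 mu `[a, b]).
  apply: (@dominated_cvg _ _ _ mu _ _ _ _ (EFin \o (fun t => 3 * `|F0 t|))) => //.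
  + by move=> n; apply/measurable_EFinP; exact: measurable_funTS (mh n).
  + move=> t _; apply: cvg_EFin; first by near=> n.
    apply/cvgr0Pnorm_le => e e0; have [N NF] := phiF0 t e e0.
    by exists N => // n /NF; rewrite /= /h normr_id.
  + by move=> n t _; rewrite /= lee_fin ger0_norm ?hF0//; exact: normr_ge0.
move=> e e0; have /fine_cvgP[_ /cvgr0Pnorm_le/(_ _ e0)[N _ Nh]] := h0.
exists N => n /Nh /=; rewrite /comp ger0_norm; last first.
  by apply/fine_ge0/integral_ge0 => t _; rewrite lee_fin /h.
move=> hn.
rewrite (le_trans (primitive_total (hi' n) ab))// (le_trans _ hn)//.
rewrite (_ : \int[mu]_(s in `[a, b]) _ = \int[mu]_(s in `[a, b]) h n s).
  exact: lexx.
by apply: eq_Rintegral => t tab; rewrite patchE tab.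
Unshelve. all: by end_near. Qed.

End bochner.

(** * Linear differential equations *)

Section weight.
Variable R : realType.

Lemma has_deriv_is_derive (V : normedModType R) (F : R -> V) t L :
  has_deriv F t L <-> is_derive t 1 F L.
Proof.
split=> [FL|[dF <-]].
  apply: DeriveDef; first exact: has_deriv_derivable FL.
  by rewrite -derive1E (has_deriv_derive1 FL).
by rewrite -derive1E; exact: derivable_has_deriv.
Qed.

Lemma has_deriv_expR (g : R -> R) t l :
  has_deriv g t l -> has_deriv (fun s => expR (g s)) t (expR (g t) * l).
Proof.
by move=> /has_deriv_is_derive gl; apply/has_deriv_is_derive.
Qed.

(** The first exponential controls the side of the initial point where [m] is nonnegative, the
    second the side where it is nonpositive. *)
Definition weight (m : R -> R) t : R := expR (2 * m t) + expR (- (2 * m t)).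

Lemma weight_ge1 m t : 1 <= weight m t.
Proof.
rewrite /weight; have [m0|/ltW m0] := leP 0 (m t).
  have := expR_ge1Dx (2 * m t); have := expR_ge0 (- (2 * m t)); lra.
have := expR_ge1Dx (- (2 * m t)); have := expR_ge0 (2 * m t); lra.
Qed.

Lemma weight_bounded (m : R -> R) a b : (forall x y, x <= y -> m x <= m y) ->
  exists2 W : R, 0 < W & forall t, a <= t -> t <= b -> weight m t <= W.
Proof.
move=> mm; exists (expR (2 * m b) + expR (- (2 * m a))).
  by rewrite addr_gt0 ?expR_gt0.
move=> t a_t tb; rewrite /weight lerD// ler_expR.
  by rewrite ler_pM2l// mm.
by rewrite lerN2 ler_pM2l// mm.
Qed.

(* Bielecki's trick: against the weight [exp (2 m) + exp (- 2 m)], integration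
   of a function dominated by [m'] times the weight halves the bound. *)
Lemma weighted_bound (V : normedModType R) (Z : R -> V) (m : R -> R) (a b t0 C : R) :
  0 <= C -> a <= t0 -> t0 <= b -> abs_continuous_on a b Z -> Z t0 = 0 ->
  (forall x y, x <= y -> m x <= m y) -> m t0 = 0 ->
  ae_on `[a, b] (fun t => exists K l,
    [/\ has_deriv Z t K, has_deriv m t l & `|K| <= l * (C * weight m t)]) ->
  forall t, a <= t -> t <= b -> `|Z t| <= C / 2 * weight m t.
Proof.
move=> C0 at0 t0b Zac Z0 mm m0 Zd t a_t tb.
(* An antiderivative of [m' C] times the weight; the factor 2 in the exponents is what produces
   [C / 2]. *)
pose M s := (expR (2 * m s) - expR (- (2 * m s))) * (C / 2).
have C2 : 0 <= C / 2 by rewrite divr_ge0.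
have Mm x y : x <= y -> M x <= M y.
  move=> /mm xy; rewrite ler_wpM2r// lerB// ler_expR.
    by rewrite ler_pM2l.
  by rewrite lerN2 ler_pM2l.
have M0 : M t0 = 0 by rewrite /M m0 mulr0 oppr0 subrr mul0r.
have Md : ae_on `[a, b] (fun t => exists K l,
    [/\ has_deriv Z t K, has_deriv M t l & `|K| <= l]).
  apply: ae_onS Zd => s _ [K [l [ZK ml Kl]]].
  have m2 : has_deriv (fun s => 2 * m s) s (2 * l).
    have := has_derivZ (2 : R) ml; rewrite [l *: _]mulrC.
    by under eq_fun do rewrite [_ *: _]mulrC.
  have Ml := has_derivZ (C / 2) (has_derivB (has_deriv_expR m2)
    (has_deriv_expR (has_derivN m2))).
  exists K, ((expR (2 * m s) * (2 * l) - expR (- (2 * m s)) * - (2 * l)) * (C / 2)).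
  split => //; rewrite (le_trans Kl)// /weight le_eqVlt; apply/orP; left; apply/eqP.
  by field.
have itvS x y : a <= x -> y <= b -> `[x, y]%classic `<=` `[a, b]%classic.
  move=> ax yb u; rewrite /= !in_itv/= => /andP[xu uy].
  by rewrite (le_trans ax xu) (le_trans uy yb).
have Mw s : `|M s| <= C / 2 * weight m s.
  rewrite /M normrM (ger0_norm C2) mulrC ler_wpM2l// ler_norml /weight.
  have := expR_ge0 (2 * m s); have := expR_ge0 (- (2 * m s)); move: (expR _) (expR _).
  by move=> p q p0 q0; apply/andP; split; lra.
rewrite (le_trans _ (Mw t))//; have [tt|/ltW tt] := leP t0 t.
  have := @mean_value_ae _ _ Z M t0 t tt (abs_continuousW at0 tb Zac)
    (fun x y _ xy _ => Mm x y xy) (ae_on_sub (itvS _ _ at0 tb) Md).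
  by rewrite Z0 M0 !subr0 => /le_trans; apply; exact: ler_norm.
have := @mean_value_ae _ _ Z M t t0 tt (abs_continuousW a_t t0b Zac)
  (fun x y _ xy _ => Mm x y xy) (ae_on_sub (itvS _ _ a_t t0b) Md).
rewrite Z0 M0 !sub0r normrN => /le_trans; apply.
by rewrite -normrN ler_norm.
Qed.

End weight.

Section uniform_continuity.
Variables (R : realType) (I : set R).
Hypothesis Ii : is_interval I.

Definition locally_unif_continuous (V : normedModType R) (F : R -> V) :=
  forall a b, I a -> I b -> unif_continuous_on a b F.

Lemma locally_abs_continuous_unif (V : normedModType R) (F : R -> V) :
  locally_abs_continuous I F -> locally_unif_continuous F.
Proof. by move=> [Fac _] a b Ia Ib; exact: abs_continuous_uniform (Fac a b Ia Ib). Qed.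

Import HBSimple.

Let identity_approx : exists u : nat -> R -> R, (forall n (V : normedModType R)
    (h : R -> V), simple_function (fun t => h (u n t))) /\
  forall t, u n t @[n --> \oo] --> t.
Proof.
have mid : measurable_fun setT (EFin : R -> \bar R) by exact/measurable_EFinP.
have [g gid] := approximation_sfun measurableT mid.
exists (fun n t => g n t); split; last first.
  by move=> t; have /fine_cvgP[] := gid t Logic.I.
move=> n V h; have sg : @simple_function R R (g n).
  split; first exact: fimfunP.
  by move=> v; exact: measurable_funPTI.
apply: (@simple_function2 R R R V (g n) (fun=> 0) (fun x _ => h x)) => //.
exact: simple_cst.
Qed.

(** Composing [F] with simple approximations of the identity gives simple functions that converge by
    continuity at interior points. *)
Lemma unif_continuous_strongly_measurable (V : normedModType R) (F : R -> V) :
  locally_unif_continuous F -> strongly_measurable I F.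
Proof.
move=> Fc; have [u [su ut]] := identity_approx.
exists (fun n t => F (u n t)) => [n|]; first exact: su.
apply: ae_on_itv => // a b Ia Ib.
apply: ae_onS2 (ae_on_neq _ a) (ae_on_neq _ b) => t.
rewrite /= in_itv/= => /andP[a_t tb] ta tb'.
have {ta}a_t' : a < t by rewrite lt_neqAle eq_sym ta.
have {tb'}tb' : t < b by rewrite lt_neqAle tb'.
apply/cvgrPdist_le => e e0; have [d d0 dF] := Fc a b Ia Ib e e0.
have r0 : 0 < Num.min d (Num.min (t - a) (b - t)).
  by rewrite !lt_min d0 !subr_gt0 a_t'.
have /cvgrPdist_lt/(_ _ r0)[N _ Nu] := ut t.
exists N => // n /Nu /=; rewrite !lt_min => /and3P[ud ua ub].
apply/ltW/dF => //.
  by move: ua; rewrite ltr_norml => /andP[_]; lra.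
by move: ub; rewrite ltr_norml => /andP[+ _]; lra.
Qed.

Lemma strongly_measurableB (V : normedModType R) (F G : R -> V) :
  strongly_measurable I F -> strongly_measurable I G ->
  strongly_measurable I (fun t => F t - G t).
Proof.
move=> [s ss sF] [r sr rG]; exists (fun n t => s n t - r n t).
  by move=> n; exact: (@simple_function2 _ _ _ _ (s n) (r n) (fun x y => x - y)).
by apply: ae_onS2 sF rG => t _; exact: cvgB.
Qed.

Lemma bcomp_cvg (U V W : normedModType R[i]) (s : nat -> bop V W)
    (r : nat -> bop U V) S T :
  s n @[n --> \oo] --> S -> r n @[n --> \oo] --> T ->
  s n \bo r n @[n --> \oo] --> S \bo T.
Proof.
move=> sS rT; apply/cvgrPdist_le => e e0.
have c0 : 0 < `|S| + `|T| + 1 by rewrite ltr_wpDl// addr_ge0.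
have d0 : 0 < Num.min 1 (e / (`|S| + `|T| + 1)) by rewrite lt_min ltr01 divr_gt0.
have /cvgrPdist_le/(_ _ d0)[N1 _ N1s] := sS.
have /cvgrPdist_le/(_ _ d0)[N2 _ N2r] := rT.
exists (maxn N1 N2) => // n /=; rewrite distrC geq_max => /andP[/N1s + /N2r].
rewrite !le_min (distrC S) (distrC T) => /andP[_ sn] /andP[rn1 rn].
rewrite !ler_pdivlMr// in sn rn.
have -> : s n \bo r n - S \bo T = (s n - S) \bo r n + S \bo (r n - T).
  by rewrite bcompBl bcompBr subrKA.
have rT1 : `|r n| <= `|T| + 1.
  by rewrite -(subrK T (r n)) (le_trans (ler_normD _ _))// addrC lerD2l.
rewrite (le_trans (ler_normD _ _))//.
have h1 : `|(s n - S) \bo r n| <= `|s n - S| * (`|T| + 1).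
  by rewrite (le_trans (bcomp_norm _ _))// ler_wpM2l.
have h2 : `|S \bo (r n - T)| <= `|r n - T| * `|S|.
  by rewrite (le_trans (bcomp_norm _ _))// mulrC.
have := normr_ge0 (s n - S); have := normr_ge0 (r n - T).
have := normr_ge0 S; have := normr_ge0 T; nra.
Qed.

Lemma strongly_measurable_bcomp (U V W : normedModType R[i]) (S : R -> bop V W)
    (T : R -> bop U V) :
  strongly_measurable I S -> strongly_measurable I T ->
  strongly_measurable I (fun t => S t \bo T t).
Proof.
move=> [s ss sS] [r sr rT]; exists (fun n t => s n t \bo r n t).
  by move=> n; exact: (@simple_function2 _ _ _ _ (s n) (r n) (fun x y => x \bo y)).
by apply: ae_onS2 sS rT => t _; exact: bcomp_cvg.
Qed.

End uniform_continuity.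

(** * Uniqueness and existence by Picard iteration *)

Section linear_ode.
Variables (R : realType) (V : completeNormedModType R) (I : set R) (t0 : R).
Hypothesis Ii : is_interval I.
Hypothesis It0 : I t0.

Let hull a b : I a -> I b -> exists a' b',
  [/\ I a' /\ I b', a' <= a /\ a' <= b, a <= b' /\ b <= b', a' <= t0 & t0 <= b'].
Proof.
move=> Ia Ib; exists (Num.min t0 (Num.min a b)), (Num.max t0 (Num.max a b)); split.
- by split; rewrite /Num.min /Num.max; do 2?case: ifP.
- by rewrite !ge_min !lexx !orbT.
- by rewrite !le_max !lexx !orbT.
- by rewrite ge_min lexx.
- by rewrite le_max lexx.
Qed.

Let geometric_small (K e : R) : 0 <= K -> 0 < e ->
  exists N, forall n, (N <= n)%N -> K / 2 ^+ n <= e.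
Proof.
move=> K0 e0; exists (Num.bound (K / e)) => n Nn.
rewrite ler_pdivrMr ?exprn_gt0// mulrC -ler_pdivrMr//.
have /ltW := archi_boundP (divr_ge0 K0 (ltW e0)); move=> /le_trans; apply.
by rewrite -natrX ler_nat (leq_trans Nn)// ltnW// ltn_expl.
Qed.

(** Each use of [weighted_bound] halves the constant, so [|Z|] is below [C / 2^n] times the weight
    for all n. Asking for a differential inequality covers the two different equations to which this
    is applied. *)
Lemma linear_ode_unique (Z : R -> V) :
  locally_abs_continuous I Z -> Z t0 = 0 ->
  (forall a b, I a -> I b -> a <= b -> exists m : R -> R,
     (forall x y, x <= y -> m x <= m y) /\
     ae_on `[a, b] (fun t => exists K l,
       [/\ has_deriv Z t K, has_deriv m t l, 0 <= l & `|K| <= l * `|Z t|])) ->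
  forall t, I t -> Z t = 0.
Proof.
move=> Zac Z0 Zm t It.
have [a [b [[Ia Ib] [at' _] [tb _] at0 t0b]]] := hull It It.
have ab : a <= b by exact: le_trans t0b.
have [m [mm md]] := Zm a b Ia Ib ab.
pose m0 s := m s - m t0.
have mm0 x y : x <= y -> m0 x <= m0 y by move=> xy; rewrite lerD2r mm.
have md0 : ae_on `[a, b] (fun t => exists K l,
    [/\ has_deriv Z t K, has_deriv m0 t l, 0 <= l & `|K| <= l * `|Z t|]).
  apply: ae_onS md => s _ [K [l [ZK ml l0 Kl]]]; exists K, l; split => //.
  by have := has_derivB ml (has_deriv_cst (m t0) s); rewrite subr0.
have [C C0 ZC] := unif_continuous_bounded ab (abs_continuous_uniform (Zac.1 a b Ia Ib)).
have Zn n s : a <= s -> s <= b -> `|Z s| <= C / 2 ^+ n * weight m0 s.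
  elim: n s => [|n IH] s as' sb.
    by rewrite expr0 divr1 (le_trans (ZC s as' sb))// ler_peMr ?weight_ge1// ltW.
  rewrite exprSr invfM mulrA.
  apply: (weighted_bound _ at0 t0b (Zac.1 a b Ia Ib) Z0 mm0 _ _ as' sb).
  - by rewrite divr_ge0 ?exprn_ge0// ltW.
  - by rewrite /m0 subrr.
  apply: ae_onS md0 => u; rewrite /= in_itv/= => /andP[au ub] [K [l [ZK ml l0 Kl]]].
  exists K, l; split => //; rewrite (le_trans Kl)//.
  by rewrite ler_wpM2l// IH.
have w0 : 0 < weight m0 t by rewrite (lt_le_trans ltr01)// weight_ge1.
apply/eqP; rewrite -normr_le0; apply/ler_addgt0Pl => e e0; rewrite addr0.
have [N Ne] := geometric_small (mulr_ge0 (ltW C0) (ltW w0)) e0.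
by rewrite (le_trans (Zn N t at' tb))// mulrAC Ne.
Qed.

Section existence.
Variables (L : R -> V -> V) (X0 : V).
Hypothesis LB : forall t x y, L t (x - y) = L t x - L t y.
Hypothesis Lbochner : forall X, locally_unif_continuous I X ->
  bochner I (fun t => L t (X t)).
Hypothesis Lm : forall a b, I a -> I b -> a <= b -> exists m : R -> R,
  (forall x y, x <= y -> m x <= m y) /\
  ae_on `[a, b] (fun t => exists2 l : R, has_deriv m t l &
    0 <= l /\ forall x, `|L t x| <= l * `|x|).

Lemma linear_ode_exists : exists X : R -> V, [/\ locally_abs_continuous I X,
  X t0 = X0 & ae_on I (fun t => has_deriv X t (L t (X t)))].
Proof.
(* [P] is the Picard operator; on functions that are not locally uniformly continuous its value is a
   dummy. *)
have /choice[P PP] (X : R -> V) : exists Y : R -> V, locally_unif_continuous I X ->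
    [/\ locally_abs_continuous I Y, Y t0 = X0 &
        ae_on I (fun t => has_deriv Y t (L t (X t)))].
  have [Xc|nXc] := pselect (locally_unif_continuous I X); last by exists X.
  have [G [Gac G0 Gd]] := bochner_primitive Ii (Lbochner Xc) It0.
  exists (fun t => G t - - X0) => _; split.
  - apply: locally_abs_continuousB => //; split.
      by move=> a b _ _ e e0; exists 1 => // n x y _ _ _; rewrite big1// => i _;
        rewrite subrr normr0.
    by apply: ae_on_all => t _; exact: has_deriv_derivable (has_deriv_cst _ t).
  - by rewrite G0 sub0r opprK.
  - apply: ae_onS Gd => t _ Gt.
    by have := has_derivB Gt (has_deriv_cst (- X0) t); rewrite subr0.
pose S n := iter n P (fun=> X0).
have Sc n : locally_unif_continuous I (S n).
  elim: n => [|n IH]; last by have [+ _ _] := PP _ IH; exact: locally_abs_continuous_unif.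
  by move=> a b _ _ e e0; exists 1 => // x y *; rewrite /= subrr normr0.
have SP n := PP _ (Sc n).
have S0 n : S n t0 = X0 by case: n => [//|n]; have [] := SP n.
pose C := `|X0|.
have C0 : 0 <= C := normr_ge0 _.
have Lm0 a b : I a -> I b -> a <= b -> exists m : R -> R,
    [/\ forall x y, x <= y -> m x <= m y, m t0 = 0 &
    ae_on `[a, b] (fun t => exists2 l : R, has_deriv m t l &
      0 <= l /\ forall x, `|L t x| <= l * `|x|)].
  move=> Ia Ib ab; have [m [mm md]] := Lm Ia Ib ab.
  exists (fun t => m t - m t0); split.
  - by move=> x y xy; rewrite lerD2r mm.
  - by rewrite subrr.
  - apply: ae_onS md => t _ [l ml ll]; exists l => //.
    by have := has_derivB ml (has_deriv_cst (m t0) t); rewrite subr0.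
have Pstep (a b : R) (m : R -> R) (X Y : R -> V) (K : R) :
    I a -> I b -> a <= t0 -> t0 <= b ->
    (forall x y, x <= y -> m x <= m y) -> m t0 = 0 ->
    ae_on `[a, b] (fun t => exists2 l : R, has_deriv m t l &
      0 <= l /\ forall x, `|L t x| <= l * `|x|) ->
    locally_unif_continuous I X -> locally_unif_continuous I Y -> 0 <= K ->
    (forall t, a <= t -> t <= b -> `|X t - Y t| <= K * weight m t) ->
    forall t, a <= t -> t <= b -> `|P X t - P Y t| <= K / 2 * weight m t.
  move=> Ia Ib at0 t0b mm m0 md Xc Yc K0 XY.
  have [PXac PX0 PXd] := PP X Xc; have [PYac PY0 PYd] := PP Y Yc.
  have abI : `[a, b]%classic `<=` I.
    by move=> t; rewrite /= in_itv/=; exact: Ii.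
  apply: (weighted_bound K0 at0 t0b _ _ mm m0).
  - exact: (locally_abs_continuousB PXac PYac).1.
  - by rewrite PX0 PY0 subrr.
  apply: ae_onS2 md (ae_onS2 (fun t _ => @conj _ _) (ae_on_sub abI PXd) (ae_on_sub abI PYd)).
  move=> t; rewrite /= in_itv/= => /andP[a_t tb] [l ml [l0 Ll]] [Xt Yt].
  exists (L t (X t) - L t (Y t)), l; split => //; first exact: has_derivB.
  by rewrite -LB (le_trans (Ll _))// ler_wpM2l// XY.
have Sstep (a b : R) (m : R -> R) n : I a -> I b -> a <= t0 -> t0 <= b ->
    (forall x y, x <= y -> m x <= m y) -> m t0 = 0 ->
    ae_on `[a, b] (fun t => exists2 l : R, has_deriv m t l &
      0 <= l /\ forall x, `|L t x| <= l * `|x|) ->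
    forall t, a <= t -> t <= b -> `|S n.+1 t - S n t| <= C / 2 ^+ n * weight m t.
  move=> Ia Ib at0 t0b mm m0 md; elim: n => [|n IH] t a_t tb; last first.
    rewrite exprSr invfM mulrA.
    apply: (Pstep a b m (S n.+1) (S n) (C / 2 ^+ n) Ia Ib at0 t0b mm m0 md
      (Sc n.+1) (Sc n) _ IH t a_t tb).
    by rewrite divr_ge0// exprn_ge0.
  rewrite divr1.
  have [PXac PX0 PXd] := SP 0%N.
  have abI : `[a, b]%classic `<=` I.
    by move=> s; rewrite /= in_itv/=; exact: Ii.
  apply: (le_trans (@weighted_bound _ _ (fun t => S 1%N t - X0) m a b t0 C
    C0 at0 t0b _ _ mm m0 _ t a_t tb)).
  - apply: abs_continuous_dominated2 ltr01 _ (PXac.1 a b Ia Ib) (PXac.1 a b Ia Ib).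
    by move=> x y _ _ _; rewrite opprB addrA subrK mul1r lerDl.
  - by rewrite S0 subrr.
  - apply: ae_onS2 md (ae_on_sub abI PXd).
    move=> s _ [l ml [l0 Ll]] Xs; exists (L s X0), l; split => //.
      by have := has_derivB Xs (has_deriv_cst X0 s); rewrite subr0.
    by rewrite (le_trans (Ll _))// ler_wpM2l// ler_peMr// weight_ge1.
  - by rewrite ler_wpM2r ?(le_trans ler01) ?weight_ge1// ler_pdivrMr// ler_peMr// ler1n.
have Stail (a b : R) (m : R -> R) : I a -> I b -> a <= t0 -> t0 <= b ->
    (forall x y, x <= y -> m x <= m y) -> m t0 = 0 ->
    ae_on `[a, b] (fun t => exists2 l : R, has_deriv m t l &
      0 <= l /\ forall x, `|L t x| <= l * `|x|) ->
    forall n k t, a <= t -> t <= b ->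
      `|S (n + k)%N t - S n t| <= 2 * C / 2 ^+ n * weight m t.
  move=> Ia Ib at0 t0b mm m0 md n k t a_t tb.
  have w0 : 0 <= weight m t by rewrite (le_trans ler01)// weight_ge1.
  (* The subtracted term makes the geometric sum telescope under induction on [k]. *)
  have : `|S (n + k)%N t - S n t| <= (2 * C / 2 ^+ n - 2 * C / 2 ^+ (n + k)) * weight m t.
    elim: k => [|k IH]; first by rewrite addn0 !subrr normr0 mul0r.
    rewrite addnS -(subrKA (S (n + k)%N t)) (le_trans (ler_normD _ _))//.
    have := Sstep a b m (n + k)%N Ia Ib at0 t0b mm m0 md t a_t tb.
    have -> : C / 2 ^+ (n + k) = 2 * C / 2 ^+ (n + k) - 2 * C / 2 ^+ (n + k).+1.
      by rewrite exprSr; field; rewrite expf_neq0.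
    by move: IH; lra.
  move=> /le_trans; apply; rewrite ler_wpM2r// gerBl.
  by rewrite divr_ge0 ?exprn_ge0// mulr_ge0.
have Scvg t : I t -> cvg (S n t @[n --> \oo]).
  move=> It; apply: cauchy_seq_cvg => e e0.
  have [a [b [[Ia Ib] [a_t _] [tb _] at0 t0b]]] := hull It It.
  have [m [mm m0 md]] := Lm0 a b Ia Ib (le_trans at0 t0b).
  have w0 : 0 <= weight m t by rewrite (le_trans ler01)// weight_ge1.
  have [||N Ne] := @geometric_small (2 * C * weight m t) (e / 2).
    by rewrite !mulr_ge0.
    by rewrite divr_gt0.
  have SN k : (N <= k)%N -> `|S k t - S N t| <= e / 2.
    move=> Nk; rewrite -(subnKC Nk).
    rewrite (le_trans (Stail a b m Ia Ib at0 t0b mm m0 md N _ t a_t tb))//.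
    by rewrite mulrAC Ne.
  exists N => k n /SN + /SN; rewrite (distrC (S n t)).
  by move=> h1 h2; rewrite (le_trans (ler_distD (S N t) _ _))// [leRHS]splitr lerD.
pose X t := lim (S n t @[n --> \oo]).
have Xtail (a b : R) (m : R -> R) : I a -> I b -> a <= t0 -> t0 <= b ->
    (forall x y, x <= y -> m x <= m y) -> m t0 = 0 ->
    ae_on `[a, b] (fun t => exists2 l : R, has_deriv m t l &
      0 <= l /\ forall x, `|L t x| <= l * `|x|) ->
    forall n t, a <= t -> t <= b -> `|X t - S n t| <= 2 * C / 2 ^+ n * weight m t.
  move=> Ia Ib at0 t0b mm m0 md n t a_t tb; apply/ler_addgt0Pl => e e0.
  have It : I t by apply: (Ii Ia Ib); rewrite a_t.
  have /cvgrPdist_le/(_ _ e0)[N _ NX] := Scvg t It.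
  have := NX (n + N)%N (leq_addl _ _); rewrite /= -/(X t) => h1.
  have h2 := Stail a b m Ia Ib at0 t0b mm m0 md n N t a_t tb.
  by rewrite (le_trans (ler_distD (S (n + N)%N t) _ _))// lerD.
have Xc : locally_unif_continuous I X.
  move=> a1 b1 Ia1 Ib1 e e0.
  have [a [b [[Ia Ib] [aa1 _] [_ b1b] at0 t0b]]] := hull Ia1 Ib1.
  have [m [mm m0 md]] := Lm0 a b Ia Ib (le_trans at0 t0b).
  have [W W0 mW] := weight_bounded a b mm.
  have [||N Ne] := @geometric_small (2 * C * W) (e / 3).
    by rewrite !mulr_ge0// ltW.
    by rewrite divr_gt0.
  have XN t : a <= t -> t <= b -> `|X t - S N t| <= e / 3.
    move=> a_t tb; rewrite (le_trans (Xtail a b m Ia Ib at0 t0b mm m0 md N t a_t tb))//.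
    rewrite (le_trans _ (Ne N (leqnn N)))// mulrAC ler_wpM2r ?invr_ge0 ?exprn_ge0//.
    by rewrite ler_wpM2l ?mulr_ge0// mW.
  have [|d d0 dS] := Sc N a1 b1 Ia1 Ib1 (e / 3); first by rewrite divr_gt0.
  exists d => // x y ax xb ay yb yx.
  have := XN x (le_trans aa1 ax) (le_trans xb b1b).
  have := XN y (le_trans aa1 ay) (le_trans yb b1b).
  have := dS x y ax xb ay yb yx; rewrite (distrC (X x)).
  have := ler_distD (S N x) (X y) (X x); have := ler_distD (S N y) (X y) (S N x).
  lra.
have [PXac PX0 PXd] := PP X Xc.
(* The witness is [P X]: its regularity and derivative are known, whereas the limit [X] is
   controlled on [I] only. *)
suff PXX t : I t -> P X t = X t.
  exists (P X); split => //.
  by apply: ae_onS PXd => t It; rewrite PXX.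
move=> It; have [a [b [[Ia Ib] [a_t _] [tb _] at0 t0b]]] := hull It It.
have [m [mm m0 md]] := Lm0 a b Ia Ib (le_trans at0 t0b).
have w0 : 0 <= weight m t by rewrite (le_trans ler01)// weight_ge1.
apply/eqP; rewrite -subr_eq0 -normr_le0; apply/ler_addgt0Pl => e e0; rewrite addr0.
have [||N Ne] := @geometric_small (2 * C * weight m t) (e / 2).
  by rewrite !mulr_ge0.
  by rewrite divr_gt0.
have h1 : `|P X t - S N.+1 t| <= e / 2.
  have C2 : 0 <= 2 * C / 2 ^+ N by rewrite divr_ge0 ?exprn_ge0// mulr_ge0.
  rewrite (le_trans (Pstep a b m X (S N) _ Ia Ib at0 t0b mm m0 md Xc (Sc N) C2
    (Xtail a b m Ia Ib at0 t0b mm m0 md N) t a_t tb))//.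
  have := Ne N (leqnn N); rewrite mulrAC; have := mulr_ge0 C2 w0.
  lra.
have h2 : `|X t - S N.+1 t| <= e / 2.
  rewrite (le_trans (Xtail a b m Ia Ib at0 t0b mm m0 md N.+1 t a_t tb))//.
  by rewrite mulrAC Ne.
by rewrite (le_trans (ler_distD (S N.+1 t) _ _))// [leRHS]splitr lerD// distrC.
Qed.

End existence.

End linear_ode.

(** * Vessels *)

Section continuity_closure.
Variables (R : realType) (I : set R).

Lemma locally_abs_continuous_cst (V : normedModType R) (c : V) :
  locally_abs_continuous I (fun=> c).
Proof.
split=> [a b _ _ e e0|]; last first.
  by apply: ae_on_all => t _; exact: has_deriv_derivable (has_deriv_cst c t).
by exists 1 => // n x y _ _ _; rewrite big1// => i _; rewrite subrr normr0.
Qed.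

Lemma locally_abs_continuousD (V : normedModType R) (f g : R -> V) :
  locally_abs_continuous I f -> locally_abs_continuous I g ->
  locally_abs_continuous I (fun t => f t + g t).
Proof.
move=> fac gac.
have -> : (fun t => f t + g t) = (fun t => f t - (0 - g t)).
  by apply/funext => t; rewrite sub0r opprK.
apply: locally_abs_continuousB fac _.
exact: locally_abs_continuousB (locally_abs_continuous_cst 0) gac.
Qed.

Lemma adjZr (U V : hilbertType R) (r : R) (T : bop U V) : adj (r *: T) = r *: adj T.
Proof.
apply: adj_eq => x y; rewrite !bopZE hdotZl hdotZr adjP; congr (_ * _).
by rewrite /= oppr0.
Qed.

Lemma locally_abs_continuous_adj (U V : hilbertType R) (f : R -> bop U V) :
  locally_abs_continuous I f -> locally_abs_continuous I (fun t => adj (f t)).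
Proof.
move=> [fac fd]; split=> [a b Ia Ib|].
  apply: (abs_continuous_dominated2 ltr01 _ (fac a b Ia Ib) (fac a b Ia Ib)).
  move=> x y _ _ _; rewrite mul1r -adjB (le_trans (adj_norm _))// lerDl.
  exact: normr_ge0.
apply: ae_onS fd => t _ /derivable_has_deriv ft.
apply: (@has_deriv_derivable _ _ _ _ (adj (derive1 f t))) => e /ft[d d0 df].
exists d => // s /df; apply: le_trans.
by rewrite -adjZr -!adjB adj_norm.
Qed.

(** A nonzero value persists on an interval of positive length on one side of [t]; the points
    [a < b] of [I] guarantee room to the right or to the left. *)
Lemma unif_continuous_ae0 (V : normedModType R) (F : R -> V) : is_interval I ->
  (exists a b : R, I a /\ I b /\ a < b) ->
  locally_unif_continuous I F -> ae_on I (fun t => F t = 0) ->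
  forall t, I t -> F t = 0.
Proof.
move=> Ii [a [b [Ia [Ib ab]]]] Fc F0 t It; apply/eqP/negPn/negP => Ft.
have e0 : 0 < `|F t| by rewrite normr_gt0.
suff [x [y [xy xyI xyF]]] : exists x y : R, [/\ x < y, `]x, y[%classic `<=` I &
    forall s, x < s -> s < y -> `|F s - F t| < `|F t| ].
  have N0 : (@lebesgue_measure R).-negligible `]x, y[.
    apply: negligibleS F0 => s /= sxy /(_ (xyI s sxy)) Fs.
    move: sxy; rewrite in_itv/= => /andP[xs sy].
    by have := xyF s xs sy; rewrite Fs sub0r normrN ltxx.
  have : @lebesgue_measure R `]x, y[ = 0%E by exact/negligibleP.
  rewrite lebesgue_measure_itv/= lte_fin xy -EFinB => -[] /eqP.
  by rewrite subr_eq0 => /eqP yx; rewrite yx ltxx in xy.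
have [ta|ta] := ltP t b.
  have [d d0 dF] := Fc t b It Ib _ e0.
  exists t, (Num.min b (t + d)); split.
  - by rewrite lt_min ta ltrDl.
  - move=> s; rewrite /= in_itv/= lt_min => /and3P[ts sb _].
    by apply: (Ii t b) => //; rewrite (ltW ts) (ltW sb).
  - move=> s ts; rewrite lt_min => /andP[sb sd].
    apply: dF => //; [exact: ltW|exact: ltW|exact: ltW|].
    by rewrite gtr0_norm ?subr_gt0// ltrBlDl.
have a_t : a < t by exact: lt_le_trans ta.
have [d d0 dF] := Fc a t Ia It _ e0.
exists (Num.max a (t - d)), t; split.
- by rewrite gt_max a_t ltrBlDr ltrDl.
- move=> s; rewrite /= in_itv/= gt_max => /andP[/andP[as' _] st].
  by apply: (Ii a t) => //; rewrite (ltW as') (ltW st).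
- move=> s; rewrite gt_max => /andP[as' sd] st.
  apply: dF => //; [exact: ltW|exact: ltW|exact: ltW|].
  by rewrite distrC gtr0_norm ?subr_gt0// ltrBlDr -ltrBlDl.
Qed.

(** Near [t], with Q and T the inverses at [s] and [t], [Q = T - T (S s - S t) Q]. When
    [|S s - S t|] is below [1 / (2 c)] this gives [|Q| <= c + |Q| / 2]; Cousin's lemma makes the
    bound global. *)
Lemma binv_bounded (U V : normedModType R[i]) (S : R -> bop U V) a b : a <= b ->
  unif_continuous_on a b S ->
  (forall t, a <= t -> t <= b -> binvertible (S t)) ->
  exists2 C : R, 0 < C & forall t, a <= t -> t <= b -> `|binv (S t)| <= C.
Proof.
move=> ab Sc Si.
pose P u v := exists2 C : R, 0 < C & forall t, u <= t -> t <= v -> `|binv (S t)| <= C.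
apply: (cousin (P := P) ab) => [x y z _ _ _ _ [C C0 FC] [K K0 FK]|t a_t tb].
  exists (C + K) => [|t xt tz]; first by rewrite addr_gt0.
  have [ty|/ltW yt] := leP t y; first by have := FC _ xt ty; lra.
  by have := FK _ yt tz; lra.
pose c := `|binv (S t)| + 1; have c0 : 0 < c by rewrite ltr_wpDl.
have [|d d0 dS] := Sc ((2 * c)^-1); first by rewrite invr_gt0 mulr_gt0.
exists d => // u v au ut tv vb ru vr; exists (2 * c) => [|s us sv].
  by rewrite mulr_gt0.
have as' : a <= s by exact: le_trans us.
have sb : s <= b by exact: le_trans sv vb.
have {}dS : `|S s - S t| < (2 * c)^-1.
  apply: dS => //; rewrite ltr_distl; apply/andP; split;
    [exact: lt_le_trans ru us|exact: le_lt_trans sv vr].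
have [Pt _] := binvP (Si t a_t tb); have [_ Qs] := binvP (Si s as' sb).
set Q := binv (S s) in Qs *; set T := binv (S t) in Pt.
have QE : Q = T - T \bo (S s - S t) \bo Q.
  rewrite bcompBr bcompBl -bcompA Qs bcomp1r Pt bcomp1l.
  by rewrite opprB addrC subrK.
have Tc : `|T| <= c by rewrite lerDl.
have : `|Q| <= c + 2^-1 * `|Q|.
  rewrite {1}QE (le_trans (ler_normB _ _))// lerD//.
  rewrite (le_trans (bcomp_norm _ _))// ler_wpM2r//.
  rewrite (le_trans (bcomp_norm _ _))//.
  rewrite (@le_trans _ _ (c * (2 * c)^-1))//; first by rewrite ler_pM// ltW.
  by rewrite invfM mulrCA divff ?gt_eqF// mulr1.
lra.
Qed.

End continuity_closure.

Section intertwining_coefficient.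
Variables (R : realType) (H H' : hilbertType R) (I : set R).
Variables (A2 : R -> bop H H) (A2' : R -> bop H' H').
Hypothesis Ii : is_interval I.
Hypothesis bA : bochner I A2.
Hypothesis bA' : bochner I A2'.

Let L t (X : bop H H') : bop H H' := A2' t \bo X - X \bo A2 t.

Let L_norm t X : `|L t X| <= (`|A2' t| + `|A2 t|) * `|X|.
Proof.
rewrite (le_trans (ler_normB _ _))// mulrDl lerD ?bcomp_norm//.
by rewrite mulrC bcomp_norm.
Qed.

Lemma intertwining_bochner (X : R -> bop H H') : locally_unif_continuous I X ->
  bochner I (fun t => L t (X t)).
Proof.
move=> Xc; have [mA gA] := bA; have [mA' gA'] := bA'.
have mX := unif_continuous_strongly_measurable Ii Xc.
split; first by apply: strongly_measurableB; apply: strongly_measurable_bcomp.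
move=> a b Ia Ib; have [g [mg g0 gi gle]] := gA a b Ia Ib.
have [g' [mg' g0' gi' gle']] := gA' a b Ia Ib.
have [ab|ba] := leP a b; last first.
  exists g; split => //; apply: ae_on_all => t; rewrite /= in_itv/= => /andP[at' tb].
  by have := lt_le_trans ba (le_trans at' tb); rewrite ltxx.
have [C C0 XC] := unif_continuous_bounded ab (Xc a b Ia Ib).
exists (fun t => C * (g' t + g t)); split.
- by apply: measurable_funM => //; exact: measurable_funD.
- by move=> t; rewrite mulr_ge0 ?addr_ge0// ltW.
- have -> : EFin \o (fun t => C * (g' t + g t)) =
      (fun t => C%:E * ((EFin \o g') t + (EFin \o g) t))%E.
    by apply/funext => t /=; rewrite EFinM EFinD.
  by apply: integrableZl => //; exact: integrableD.
- apply: ae_onS2 gle gle' => t; rewrite /= in_itv/= => /andP[at' tb] gt gt'.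
  rewrite (le_trans (L_norm _ _))// mulrC ler_pM ?addr_ge0//; first exact: XC.
  exact: lerD.
Qed.

Lemma intertwining_majorant a b : I a -> I b -> a <= b -> exists m : R -> R,
  (forall x y, x <= y -> m x <= m y) /\
  ae_on `[a, b] (fun t => exists2 l : R, has_deriv m t l &
    0 <= l /\ forall X, `|L t X| <= l * `|X|).
Proof.
move=> Ia Ib ab.
have [m [mm md]] := bochner_majorant bA Ia Ib ab.
have [m' [mm' md']] := bochner_majorant bA' Ia Ib ab.
exists (fun t => m' t + m t); split; first by move=> x y xy; rewrite lerD ?mm ?mm'.
apply: ae_onS2 md md' => t _ [l ml Al] [l' ml' Al'].
exists (l' + l); first exact: has_derivD.
split; first by rewrite addr_ge0 ?(le_trans _ Al) ?(le_trans _ Al').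
by move=> X; rewrite (le_trans (L_norm _ _))// ler_wpM2r// lerD.
Qed.

End intertwining_coefficient.

(** * From equal transfer functions to gauge equivalence *)

Section vessel_facts.
Variables (R : realType) (I : set R) (E : hilbertType R).
Variables sigma1 sigma2 gamma gammas : R -> bop E E.
Hypothesis Ii : is_interval I.
Hypothesis nondeg : exists a b : R, I a /\ I b /\ a < b.
Hypothesis params : vessel_parameters I sigma1 sigma2 gamma gammas.

(** The Gram matrices are compared at each single time, while condition (i) is given almost
    everywhere; continuity of its left side closes the gap. *)
Lemma colligation_everywhere (H : hilbertType R) (v : vessel E H) :
  conservative_vessel I sigma1 sigma2 gamma gammas v ->
  forall t, I t ->
  vA1 v t + adj (vA1 v t) + vB v t \bo sigma1 t \bo adj (vB v t) = 0.
Proof.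
move=> [Aac Bac _ vP]; have [sac _ _ _ _] := params.
have aB := locally_abs_continuous_adj Bac.
pose F t := vA1 v t + adj (vA1 v t) + vB v t \bo sigma1 t \bo adj (vB v t).
have Fac : locally_abs_continuous I F.
  apply: locally_abs_continuousD; last first.
    exact/locally_abs_continuous_bcomp/aB/locally_abs_continuous_bcomp.
  exact: locally_abs_continuousD (locally_abs_continuous_adj Aac).
apply: (unif_continuous_ae0 Ii nondeg (locally_abs_continuous_unif Fac)).
by apply: ae_onS vP => t _ [[]].
Qed.

Section two_vessels.
Variables (H H' : hilbertType R) (v : vessel E H) (v' : vessel E H').
Hypothesis vc : conservative_vessel I sigma1 sigma2 gamma gammas v.
Hypothesis vc' : conservative_vessel I sigma1 sigma2 gamma gammas v'.

Lemma transfer_function_gauge (U : bop H H') t l : unitary U ->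
  vA1 v' t = U \bo vA1 v t \bo binv U -> vB v' t = U \bo vB v t ->
  analytic_point v t l ->
  transfer_function sigma1 v l t = transfer_function sigma1 v' l t.
Proof.
move=> Uu AE BE lv; rewrite /transfer_function AE BE.
have UV : is_binv U (adj U) by exact: Uu.
rewrite (binvE UV) (binv_similar UV lv) adjM; congr (_ - _); congr (_ \bo _).
set Z := binv _.
have -> : adj (vB v t) \bo adj U \bo (U \bo Z \bo adj U) \bo (U \bo vB v t) =
    adj (vB v t) \bo (adj U \bo U \bo Z) \bo ((adj U \bo U) \bo vB v t).
  by rewrite !bcompA.
by have [-> _] := UV; rewrite !bcomp1l.
Qed.

Hypothesis vmin : minimal I v.
Hypothesis vmin' : minimal I v'.

Let krylov (K : hilbertType R) (w : vessel E K) t (p : nat * E) : K :=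
  iter p.1 (vA1 w t) (vB w t p.2).

Let krylov_dense (K : hilbertType R) (w : vessel E K) t : minimal I w -> I t ->
  closure (lin_span (range (krylov w t))) = setT.
Proof.
move=> wm It; rewrite -(wm t It); congr (closure (lin_span _)).
apply/seteqP; split => [_ [[n e] _ <-]|_ [n [e ->]]]; first by exists n, e.
by exists (n, e).
Qed.

Hypothesis same_transfer : forall (t : R) (l : R[i]), I t ->
  analytic_point v t l -> analytic_point v' t l ->
  transfer_function sigma1 v l t = transfer_function sigma1 v' l t.

Lemma pointwise_gauge t : I t -> exists2 U : bop H H', unitary U &
  forall p, U (krylov v t p) = krylov v' t p.
Proof.
move=> It; apply: gram_unitary (krylov_dense vmin It) (krylov_dense vmin' It).
move=> [n e] [m e']; rewrite /krylov /=.
have [_ sinv _ _ _] := params; have [_ ss] := binvP (sinv t It).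
apply: gram_of_moments (colligation_everywhere vc It) (colligation_everywhere vc' It) _ _ _ _ _.
(* A real [l] above both norms lies in both resolvent sets, so the hypothesis applies there; the
   factor [sigma1] is then cancelled on the right. *)
apply: (@moments_eq _ E H H' _ _ _ _ _ _ (Num.max `|vA1 v t| `|vA1 v' t|)) => l.
rewrite gt_max => /andP[/large_resolvent Al /large_resolvent Al'].
have := same_transfer It Al Al'; rewrite /transfer_function => /addrI/oppr_inj.
move=> /(congr1 (fun T => T \bo binv (sigma1 t))).
by rewrite -!(bcompA _ (sigma1 t)) ss !bcomp1r.
Qed.

Variables (W : R -> bop H H') (t0 : R).
Hypothesis It0 : I t0.
Hypothesis Wac : locally_abs_continuous I W.
Hypothesis Wd : ae_on I (fun t =>
  has_deriv W t (vA2 v' t \bo W t - W t \bo vA2 v t)).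
Hypothesis Wt0 : forall p, W t0 (krylov v t0 p) = krylov v' t0 p.

Let abI a b : I a -> I b -> `[a, b]%classic `<=` I.
Proof. by move=> Ia Ib t; rewrite /= in_itv/=; exact: Ii. Qed.

Let bA : bochner I (vA2 v).
Proof. by have [_ _ + _] := vc; exact: locally_bochner_integrable_bochner. Qed.

Let bA' : bochner I (vA2 v').
Proof. by have [_ _ + _] := vc'; exact: locally_bochner_integrable_bochner. Qed.

(** By condition (ii) for both vessels, [Z = W A1 - A1' W] satisfies the equation of W itself: its
    derivative is [A2' Z - Z A2]. *)
Lemma intertwines_A1 t : I t -> W t \bo vA1 v t = vA1 v' t \bo W t.
Proof.
have [Aac _ _ vP] := vc; have [Aac' _ _ vP'] := vc'.
move=> It; apply/eqP; rewrite -subr_eq0; apply/eqP; move: t It.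
pose Z t := W t \bo vA1 v t - vA1 v' t \bo W t.
change (forall t, I t -> Z t = 0).
apply: (@linear_ode_unique _ (bop H H') _ t0 It0 Z).
- exact: locally_abs_continuousB (locally_abs_continuous_bcomp Wac Aac)
    (locally_abs_continuous_bcomp Aac' Wac).
(* At [t0] both sides send the Krylov vector with index n to the one of [v'] with index n + 1. *)
- apply/eqP; rewrite subr_eq0; apply/eqP.
  apply: (bop_dense_eq (krylov_dense vmin It0)) => -[n e].
  by rewrite !bcompE Wt0; exact: (Wt0 (n.+1, e)).
move=> a b Ia Ib ab; have [m [mm md]] := intertwining_majorant bA bA' Ia Ib ab.
exists m; split => //; have sub := abI Ia Ib.
apply: ae_onS2 (ae_onS2 (fun t _ => @conj _ _) md (ae_on_sub sub Wd))
  (ae_onS2 (fun t _ => @conj _ _)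
    (ae_onS2 (fun t _ => @conj _ _) (ae_on_sub sub vP) (ae_on_sub sub Aac.2))
    (ae_onS2 (fun t _ => @conj _ _) (ae_on_sub sub vP') (ae_on_sub sub Aac'.2))).
move=> t _ [[l ml [l0 Ll]] Wt] [[[_ AE _ _ _] /derivable_has_deriv At]
  [[_ AE' _ _ _] /derivable_has_deriv At']].
exists (vA2 v' t \bo Z t - Z t \bo vA2 v t), l; split => //; last exact: Ll.
have := has_derivB (has_deriv_bcomp Wt At) (has_deriv_bcomp At' Wt).
congr has_deriv; rewrite AE AE' /Z.
rewrite !(bcompBl, bcompBr) !bcompA.
set p1 := vA2 v' t \bo W t \bo vA1 v t.
set p2 := W t \bo vA2 v t \bo vA1 v t.
set p3 := W t \bo vA1 v t \bo vA2 v t.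
set p4 := vA2 v' t \bo vA1 v' t \bo W t.
set p5 := vA1 v' t \bo vA2 v' t \bo W t.
set p6 := vA1 v' t \bo W t \bo vA2 v t.
by rewrite !subrKA !opprB addrACA [RHS]addrACA (addrC (- p3)).
Qed.

Let zmod_solve (T : zmodType) (a b c d : T) : a - b + c + d = 0 -> a = b - c - d.
Proof.
by move=> /eqP; rewrite -!addrA addr_eq0 => /eqP ->; rewrite !opprD !opprK addrA.
Qed.

Let zmod_regroup (T : zmodType) (a b c d e f g : T) :
  a - b + (b - c - d) - (e - f - g) = a - e - (c - f) - (d - g).
Proof.
rewrite -(addrA b) subrKA !opprD !opprK !addrA.
by rewrite [LHS](ACl (1*4*2*5*3*6)).
Qed.

(** Condition (iii) differentiates [B sigma1], so [sigma1] is kept in Z. With Y = Z sigma1^-1,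
    condition (iii) and [W A1 = A1' W] give the derivative [A2' Z - A1' Y sigma2 - Y gamma] of Z,
    which is homogeneous in Z. *)
Lemma intertwines_B t : I t -> W t \bo vB v t = vB v' t.
Proof.
have [Aac Bac _ vP] := vc; have [Aac' Bac' _ vP'] := vc'.
have [sac sinv [bs bg _] _ _] := params.
have Bsac := locally_abs_continuous_bcomp Bac sac.
have Bsac' := locally_abs_continuous_bcomp Bac' sac.
pose Z t := W t \bo (vB v t \bo sigma1 t) - vB v' t \bo sigma1 t.
have ZE t1 : I t1 -> W t1 \bo vB v t1 - vB v' t1 = Z t1 \bo binv (sigma1 t1).
  move=> It1; have [_ ss] := binvP (sinv t1 It1).
  by rewrite /Z bcompBl -!bcompA ss !bcomp1r.
suff Z0 : forall t, I t -> Z t = 0.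
  by move=> It; apply/eqP; rewrite -subr_eq0; apply/eqP; rewrite ZE// Z0// bcomp0l.
clear t; apply: (@linear_ode_unique _ (bop E H') _ t0 It0 Z).
- exact: locally_abs_continuousB (locally_abs_continuous_bcomp Wac Bsac) Bsac'.
- rewrite /Z bcompA -bcompBl (_ : _ - _ = 0) ?bcomp0l//.
  by apply/eqP; rewrite subr_eq0; apply/eqP/bopP => e; exact: (Wt0 (0%N, e)).
move=> a b Ia Ib ab; have sub := abI Ia Ib.
have [m1 [mm1 md1]] := bochner_majorant bA' Ia Ib ab.
have [m2 [mm2 md2]] := bochner_majorant (locally_bochner_integrable_bochner Ii bs) Ia Ib ab.
have [m3 [mm3 md3]] := bochner_majorant (locally_bochner_integrable_bochner Ii bg) Ia Ib ab.
have [C C0 AC] := unif_continuous_bounded ab (abs_continuous_uniform (Aac'.1 a b Ia Ib)).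
have [D D0 sD] : exists2 D : R, 0 < D & forall t, a <= t -> t <= b -> `|binv (sigma1 t)| <= D.
  apply: (binv_bounded ab (abs_continuous_uniform (sac.1 a b Ia Ib))) => t a_t tb.
  by apply: sinv; apply: sub; rewrite /= in_itv/= a_t.
(* [m1], [m2], [m3] majorize [A2'], [sigma2], [gamma]; [C] bounds [A1'], and [D] bounds the inverse
   of [sigma1] and so turns Y into Z. *)
exists (fun t => m1 t + (m2 t * (C * D) + m3 t * D)); split.
  move=> x y xy; rewrite lerD ?mm1// lerD// ler_wpM2r ?mm2 ?mm3//; last exact: ltW.
  by rewrite mulr_ge0// ltW.
apply: ae_onS2 (ae_onS2 (fun t _ => @conj _ _)
    (ae_onS2 (fun t _ => @conj _ _) md1 (ae_on_sub sub Wd))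
    (ae_onS2 (fun t _ => @conj _ _) md2 md3))
  (ae_onS2 (fun t _ => @conj _ _)
    (ae_onS2 (fun t _ => @conj _ _) (ae_on_sub sub vP) (ae_on_sub sub Bsac.2))
    (ae_onS2 (fun t _ => @conj _ _) (ae_on_sub sub vP') (ae_on_sub sub Bsac'.2))).
move=> t tab [[[l1 ml1 l1A] Wt] [[l2 ml2 l2s] [l3 ml3 l3g]]]
  [[[_ _ BE _ _] /derivable_has_deriv Bt] [[_ _ BE' _ _] /derivable_has_deriv Bt']].
have It : I t by exact: sub.
have := tab; rewrite /= in_itv/= => /andP[a_t tb].
pose Y := W t \bo vB v t - vB v' t.
have YE : Y = Z t \bo binv (sigma1 t) by exact: ZE.
have Yle : `|Y| <= D * `|Z t|.
  by rewrite YE (le_trans (bcomp_norm _ _))// mulrC ler_wpM2r// sD.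
have l10 : 0 <= l1 by exact: le_trans l1A.
have l20 : 0 <= l2 by exact: le_trans l2s.
have l30 : 0 <= l3 by exact: le_trans l3g.
exists (vA2 v' t \bo Z t - vA1 v' t \bo Y \bo sigma2 t - Y \bo gamma t),
  (l1 + (l2 * (C * D) + l3 * D)); split.
- have := has_derivB (has_deriv_bcomp Wt Bt) Bt'.
  congr has_deriv.
  have -> : derive1 (fun s => vB v s \bo sigma1 s) t =
      vA2 v t \bo vB v t \bo sigma1 t - vA1 v t \bo vB v t \bo sigma2 t
        - vB v t \bo gamma t by exact: zmod_solve BE.
  have -> : derive1 (fun s => vB v' s \bo sigma1 s) t =
      vA2 v' t \bo vB v' t \bo sigma1 t - vA1 v' t \bo vB v' t \bo sigma2 t
        - vB v' t \bo gamma t by exact: zmod_solve BE'.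
  rewrite /Z /Y !(bcompBl, bcompBr) !bcompA intertwines_A1//.
  exact: zmod_regroup.
- apply: has_derivD ml1 _; apply: has_derivD.
    exact: (has_derivZ (C * D) ml2).
  exact: (has_derivZ D ml3).
- by rewrite !addr_ge0// !mulr_ge0// ltW.
- rewrite (le_trans (ler_normB _ _))// !mulrDl addrA; apply: lerD; last first.
    rewrite (le_trans (bcomp_norm _ _))// mulrC -mulrA.
    by rewrite ler_pM.
  rewrite (le_trans (ler_normB _ _))//; apply: lerD.
    by rewrite (le_trans (bcomp_norm _ _))// ler_wpM2r.
  rewrite (le_trans (bcomp_norm _ _))// mulrC -mulrA ler_pM//.
  rewrite (le_trans (bcomp_norm _ _))// -mulrA ler_pM//.
  exact: AC.
Qed.

Lemma intertwiner_gauge : gauge_equivalent I v v'.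
Proof.
have Wu t : I t -> unitary (W t).
  move=> It; have [U Uu UK] := pointwise_gauge It.
  suff -> : W t = U by [].
  apply: (bop_dense_eq (krylov_dense vmin It)) => p; rewrite UK.
  case: p => n e; rewrite /krylov/=; elim: n => [|n IH] /=.
    by have := congr1 (fun T : bop E H' => T e) (intertwines_B It).
  rewrite -IH; set x := iter n _ _.
  by have := congr1 (fun T : bop H H' => T x) (intertwines_A1 It).
have WV t : I t -> W t \bo binv (W t) = bid H'.
  move=> It; have Wi : binvertible (W t) by exists (adj (W t)); exact: Wu.
  by have [] := binvP Wi.
exists W; split => //.
- by move=> t It; rewrite intertwines_A1// -bcompA WV// bcomp1r.
- apply: ae_onS Wd => t It /has_deriv_derive1 ->.
  by rewrite bcompBl -(bcompA (vA2 v' t)) WV// bcomp1r addrC subrK.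
- by move=> t It; rewrite intertwines_B.
Qed.

End two_vessels.

End vessel_facts.

Theorem theorem3p5 (R : realType) (I : set R) (E H H' : hilbertType R)
    (sigma1 sigma2 gamma gammas : R -> bop E E)
    (v : vessel E H) (v' : vessel E H') :
  is_interval I ->
  (exists a b : R, I a /\ I b /\ (a < b)%R) ->
  vessel_parameters I sigma1 sigma2 gamma gammas ->
  conservative_vessel I sigma1 sigma2 gamma gammas v ->
  conservative_vessel I sigma1 sigma2 gamma gammas v' ->
  minimal I v -> minimal I v' ->
  (gauge_equivalent I v v' <->
   forall (t : R) (l : R[i]%C), I t ->
     analytic_point v t l -> analytic_point v' t l ->
     transfer_function sigma1 v l t = transfer_function sigma1 v' l t).
Proof.
move=> Ii nondeg params vc vc' vm vm'; split=> [[U [_ Uu UA _ UB]] t l It lv _|ST].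
  apply: (@transfer_function_gauge _ _ _ _ _ _ _ (U t)) => //.
  - exact: Uu.
  - exact: UA.
  - exact: UB.
have [t0 [_ [It0 _]]] := nondeg.
have [U Uu UK] := pointwise_gauge Ii nondeg params vc vc' vm vm' ST It0.
have [_ _ bA _] := vc; have [_ _ bA' _] := vc'.
have {}bA := locally_bochner_integrable_bochner Ii bA.
have {}bA' := locally_bochner_integrable_bochner Ii bA'.
have [|||W [Wac W0 Wd]] := @linear_ode_exists _ (bop H H') I t0 Ii It0
    (fun t X => vA2 v' t \bo X - X \bo vA2 v t) U.
- by move=> t X Y; rewrite bcompBl bcompBr !opprD !opprK addrACA.
- by move=> X; exact: intertwining_bochner.
- by move=> a b; exact: intertwining_majorant.
by apply: (intertwiner_gauge Ii nondeg params vc vc' vm vm' ST It0 Wac Wd); rewrite W0.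
Qed.
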